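(* For $n\in\{6,7,8\}$ and every uniform realizable rank-3 chirotope $\chi$ on $[n]$, the chirotropical Grassmannian $\mathrm{Trop}^\chi\mathrm{G}(3,n)$ is 2-determined: every cone of it is either a maximal cone or the intersection of exactly two maximal cones.
   Context: A uniform realizable chirotope is $\chi\in\{\pm1\}^{\binom{[n]}3}$ with $\chi_I=\operatorname{sign}p_I(g)$ for a real $3\times n$ matrix $g$ with all maximal minors nonzero. For a real polynomial $f$ in Plücker variables, $f^\chi_\pm$ is the sum of terms of $f$ whose evaluation at $p=\chi$ has sign $\pm1$; $\mathrm{Trop}(h)(x)=\min\alpha\cdot x$ over exponent vectors of monomials of $h$; $\mathrm{Trop}^\chi V(f)=\{x:\mathrm{Trop}(f^\chi_+)(x)=\mathrm{Trop}(f^\chi_-)(x)\}$; $\mathrm{Trop}^\chi\mathrm{G}(k,n)=\bigcap_{f\in I_{k,n}}\mathrm{Trop}^\chi V(f)$ with $I_{k,n}$ the Plücker ideal of $\mathrm{G}(k,n)$, considered as a polyhedral fan (with cones generated by its rays modulo lineality). *)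

(* Defs.v *)
From HB Require Import structures.
From mathcomp Require Import all_boot all_order all_algebra.
From mathcomp Require Import classical_sets cardinality reals constructive_ereal.
(* The notations of mpoly clash with those of classical_sets. *)
From mathcomp Require Import -(notations) mpoly.

Set Implicit Arguments.
Unset Strict Implicit.
Unset Printing Implicit Defensive.

Import Order.TTheory GRing.Theory Num.Theory.
Local Open Scope classical_set_scope.
Local Open Scope ring_scope.

Definition ksub (k n : nat) : finType := {I : {set 'I_n} | #|I| == k}.

Lemma ksub_card k n (I : ksub k n) : #|val I| = k.
Proof. exact: eqP (valP I). Qed.

(* [enum_val] lists the elements of a subset of 'I_n in increasing order. *)
Definition ksub_nth k n (I : ksub k n) (j : 'I_k) : 'I_n :=
  enum_val (cast_ord (esym (ksub_card I)) j).

Definition minor (A : comNzRingType) k n (g : 'M[A]_(k, n)) (I : ksub k n) : A :=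
  \det (colsub (ksub_nth I) g).

Definition uniform_realizable_chirotope (R : realType) k n
    (chi : {ffun ksub k n -> int}) : Prop :=
  exists g : 'M[R]_(k, n),
    forall I, minor g I != 0 /\ chi I = sgz (minor g I).

(* The Pluecker variable p_I is the variable of index [enum_rank I]. *)
Definition plucker_poly (R : realType) (k n : nat) := mpoly #|{: ksub k n}| R.
Definition plucker_exp (k n : nat) := multinom #|{: ksub k n}|.

Definition exponent k n (m : plucker_exp k n) (I : ksub k n) : nat :=
  m (enum_rank I).

Definition generic_mx (R : realType) k n : 'M[mpoly (k * n) R]_(k, n) :=
  \matrix_(i, j) mpolyX R (mnm1 (mxvec_index i j)).

(* I_{k,n}: the polynomial relations among the maximal minors of a k x n
   matrix of indeterminates. *)
Definition plucker_ideal (R : realType) k n : set (plucker_poly R k n) :=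
  [set f | comp_mpoly
     [tuple minor (generic_mx R k n) (enum_val i) | i < #|{: ksub k n}|] f = 0].

Definition term_at (R : realType) k n (chi : {ffun ksub k n -> int})
    (f : plucker_poly R k n) (m : plucker_exp k n) : R :=
  mcoeff m f * \prod_(I : ksub k n) (chi I)%:~R ^+ exponent m I.

Definition pos_part (R : realType) k n (chi : {ffun ksub k n -> int})
    (f : plucker_poly R k n) : plucker_poly R k n :=
  \sum_(m <- msupp f | 0 < term_at chi f m) mcoeff m f *: mpolyX R m.

Definition neg_part (R : realType) k n (chi : {ffun ksub k n -> int})
    (f : plucker_poly R k n) : plucker_poly R k n :=
  \sum_(m <- msupp f | term_at chi f m < 0) mcoeff m f *: mpolyX R m.

Definition weight_space (R : realType) (k n : nat) := {ffun ksub k n -> R^o}.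

Definition weight (R : realType) k n (m : plucker_exp k n)
    (x : weight_space R k n) : R :=
  \sum_(I : ksub k n) (exponent m I)%:R * x I.

(* The minimum over the empty set of monomials is +oo. *)
Definition Trop (R : realType) k n (h : plucker_poly R k n)
    (x : weight_space R k n) : \bar R :=
  (\big[mine/+oo]_(m <- msupp h) (weight m x)%:E)%E.

Definition chi_trop_hypersurface (R : realType) k n
    (chi : {ffun ksub k n -> int}) (f : plucker_poly R k n) :
    set (weight_space R k n) :=
  [set x | Trop (pos_part chi f) x = Trop (neg_part chi f) x].

Definition chirotropical_Grassmannian (R : realType) k n
    (chi : {ffun ksub k n -> int}) : set (weight_space R k n) :=
  \bigcap_(f in @plucker_ideal R k n) chi_trop_hypersurface chi f.

Section Fans.
Variables (R : realType) (V : lmodType R).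
Implicit Types (C D M N T : set V) (F G : set (set V)).

(* Cones need not be pointed: a cone spanned by rays r_j modulo a lineality
   space with basis l_i is the conic hull of the r_j, the l_i and the - l_i. *)
Definition conic_hull (s : seq V) : set V :=
  [set v | exists a : 'I_(size s) -> R,
     (forall i, 0 <= a i) /\ v = \sum_i a i *: s`_i].

Definition polyhedral_cone C := exists s : seq V, C = conic_hull s.

Definition face_of C D := exists u : {scalar V},
  (forall v, C v -> 0 <= u v) /\ D = C `&` [set v | u v = 0].

Definition is_fan F :=
  [/\ finite_set F,
      forall C, F C -> polyhedral_cone C,
      forall C D, F C -> face_of C D -> F D
    & forall C D, F C -> F D -> face_of C (C `&` D)].

Definition fan_structure_on T F := is_fan F /\ \bigcup_(C in F) C = T.

Definition refines G F := forall D, G D -> exists2 C, F C & D `<=` C.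

(* Fans that refine each other have the same maximal cones, hence the same
   cones: a set has at most one coarsest fan structure. *)
Definition coarsest_fan_structure T F :=
  fan_structure_on T F /\ forall G, fan_structure_on T G -> refines G F.

Definition maximal_cone F M := F M /\ forall C, F C -> M `<=` C -> C = M.

Definition two_determined F := forall C, F C ->
  maximal_cone F C \/
  exists M N, [/\ maximal_cone F M, maximal_cone F N, M <> N & C = M `&` N].

End Fans.

(* Main.v *)
(* The three-term Pluecker relations cut out a prevariety containing the
   chirotropical Grassmannian; its points are functions on triples such that in
   each relation the term of the isolated sign is the minimum of the other two.
   Grouping points by the signs of the differences of these two terms gives the
   coarsest fan.  For at most eight elements, induction on their number shows:
   (1) every point [X] of the prevariety is, up to a bounded error, minus the
   logarithm of the absolute values of the minors of a real matrix with the
   given chirotope; applied to the multiples of [X] this identifies the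
   prevariety with the Grassmannian;
   (2) no star is a lineality space plus a single ray.
   To remove an element [e], one studies the points that differ from [x] only in
   the triples containing [e].  They are functions on the pairs of remaining
   elements, constant on the classes of a colouring of these pairs.  Generically
   some [e] has at most three colours, since otherwise the chirotope would
   contain a Fano plane or a Moebius-Kantor configuration.  The minors
   of [e] with three pairs of distinct colours then determine the position of
   [e] well enough to approximate all the others.
   By (2), whenever a cone is not the intersection of two maximal cones with
   minimal intersection, one of these can be exchanged for a maximal cone on the
   other side of a wall, which makes the intersection smaller. *)
Require Import Defs.
From HB Require Import structures.
From mathcomp Require Import all_boot all_order all_algebra.
From mathcomp Require Import ring lra zify.
From mathcomp Require Import boolp classical_sets functions cardinality reals constructive_ereal.
From mathcomp Require Import sequences exp.
From mathcomp Require Import -(notations) mpoly.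

Set Implicit Arguments.
Unset Strict Implicit.
Unset Printing Implicit Defensive.
Import Order.TTheory GRing.Theory Num.Theory.
Local Open Scope ring_scope.

(** * Minima and three-term relations *)

(** An element [e] is a vector with three coordinates, so three of its brackets determine it: this
    is why three colours are the threshold. The other brackets follow by three-term relations whose
    terms are positive, or in which one product is dominated by a definite gap; cancellation is
    never met. That this propagation reaches all lines, and can be started, rests on directions in
    which only [e] moves. They come from geometry: a large multiple of the point is realised without
    [e], and [e] slides along its line with some [a] until it meets the first lines spanned by other
    elements. So realisability of smaller sets is needed inside the proof of realisability, with one
    error bound for the whole prevariety. On the boundary of a cell the gaps vanish; a multiple of a
    generic point of the cell is then added and absorbed in the error. Eight enters by counting:
    when every element has more than three colours, blocks of three or more elements would need nine
    elements. *)

Section Minimum.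
Variable R : realType.
Implicit Types u v w : R.

Definition ismin u v w := (v <= w /\ u = v) \/ (w <= v /\ u = w).

(* Infinitesimal version of [ismin]: the first-order condition on
   [(u', v', w')] for [u + t u'] to remain the minimum of [v + t v'] and
   [w + t w'] for small [t >= 0]. *)
Definition smin (v w u' v' w' : R) :=
  [/\ v < w -> u' = v', w < v -> u' = w' & v = w -> ismin u' v' w'].

Definition slin (v w u' v' w' : R) :=
  [/\ v < w -> u' = v', w < v -> u' = w' & v = w -> u' = v' /\ u' = w'].

Lemma ismin_min u v w : ismin u v w <-> u = Num.min v w.
Proof.
rewrite minEle; split.
  by move=> [[h ->]|[h ->]]; case: ifP => // hh; lra.
by case: ifP => h ->; [left|right]; split=> //; lra.
Qed.

Lemma isminC u v w : ismin u v w <-> ismin u w v.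
Proof. by rewrite /ismin; lra. Qed.

Lemma sminC v w u' v' w' : smin v w u' v' w' <-> smin w v u' w' v'.
Proof.
by split=> -[h1 h2 h3]; split=> // h; rewrite isminC; apply: h3.
Qed.

Lemma smin_eq v w a b c v' w' a' b' c' : v = v' -> w = w' -> a = a' -> b = b' -> c = c' ->
  smin v w a b c -> smin v' w' a' b' c'.
Proof. by move=> -> -> -> -> ->. Qed.

Lemma slinW v w u' v' w' : slin v w u' v' w' -> smin v w u' v' w'.
Proof. by move=> [h1 h2 h3]; split=> // /h3 [-> ?]; left; split=> //; lra. Qed.

Lemma slinP v w u' v' w' :
  slin v w u' v' w' <-> smin v w u' v' w' /\ smin v w (- u') (- v') (- w').
Proof.
split.
  move=> h; split; first exact: slinW.
  by apply: slinW; case: h => h1 h2 h3; split=> h; [rewrite h1|rewrite h2|case: (h3 h) => <- <-].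
move=> [[h1 h2 h3] [k1 k2 k3]]; split=> // h.
by move: (h3 h) (k3 h); rewrite /ismin; lra.
Qed.

Lemma smin_small u v w u' v' w' : ismin u v w -> smin v w u' v' w' ->
  exists2 e, 0 < e & forall t, 0 <= t -> t <= e ->
    ismin (u + t * u') (v + t * v') (w + t * w').
Proof.
move=> h [h1 h2 h3].
have key (a b a' b' : R) : a < b -> exists2 e, 0 < e & forall t, 0 <= t -> t <= e ->
    a + t * a' <= b + t * b'.
  move=> ab; exists ((b - a) / (`|a'| + `|b'| + 1)).
    by rewrite divr_gt0 ?subr_gt0 // ltr_wpDl // addr_ge0.
  move=> t t0; rewrite ler_pdivlMr ?ltr_wpDl ?addr_ge0 // => ht.
  have := ler_norm a'; have := ler_norm (- b'); rewrite normrN => hb ha.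
  by have : t * (a' - b') <= t * (`|a'| + `|b'|); [apply: ler_wpM2l => //; lra | nra].
have [vw|vw|vw] := ltgtP v w.
- have [e e0 he] := key v w v' w' vw; exists e => // t t0 te.
  by left; split; [exact: he | move: (h1 vw) h => ->; rewrite /ismin => ?; congr (_ + _); lra].
- have [e e0 he] := key w v w' v' vw; exists e => // t t0 te.
  by right; split; [exact: he | move: (h2 vw) h => ->; rewrite /ismin => ?; congr (_ + _); lra].
- exists 1 => // t t0 _; have [[h4 ->]|[h4 ->]] := h3 vw; [left|right];
  by (split; [nra | move: h; rewrite /ismin => ?; congr (_ + _); lra]).
Qed.

(** With [smin_small], this lets a first-order relation be deduced from others by working with
    actual points at a small [t]. *)
Lemma small_smin u v w u' v' w' e : ismin u v w -> 0 < e ->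
  (forall t, 0 < t -> t <= e -> ismin (u + t * u') (v + t * v') (w + t * w')) ->
  smin v w u' v' w'.
Proof.
move=> h e0 he.
have main (a b a' b' u'' : R) : a < b -> (forall t, 0 < t -> t <= e ->
     ismin (a + t * u'') (a + t * a') (b + t * b')) -> u'' = a'.
  move=> ab hh; pose t := Num.min e ((b - a) / 2 / (`|a'| + `|b'| + 1)).
  have N0 : 0 < `|a'| + `|b'| + 1 by rewrite ltr_wpDl // addr_ge0.
  have t0 : 0 < t by rewrite lt_min e0 !divr_gt0 ?subr_gt0.
  have te : t <= e by rewrite ge_min lexx.
  have tN : t * (`|a'| + `|b'| + 1) <= (b - a) / 2.
    by rewrite -ler_pdivlMr // ge_min lexx orbT.
  have := ler_norm a'; have := ler_norm (- b'); rewrite normrN => hb ha.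
  have k : t * (a' - b') <= t * (`|a'| + `|b'|) by apply: ler_wpM2l; lra.
  have [[h1 h2]|[h1 h2]] := hh t t0 te.
    by apply: (mulfI (lt0r_neq0 t0)); lra.
  by exfalso; nra.
split=> vw.
- apply: (main v w v' w' u' vw) => t t0 te.
  by have := he t t0 te; move: h; rewrite /ismin => -[[_ ->]|[? ->]] //; exfalso; lra.
- apply: (main w v w' v' u' vw) => t t0 te.
  by have := he t t0 te; rewrite isminC; move: h; rewrite /ismin => -[[? ->]|[_ ->]] //; exfalso; lra.
- subst w; have := he e e0 (lexx _); have -> : u = v by move: h; rewrite /ismin; lra.
  by move=> [[h1 h2]|[h1 h2]]; [left|right]; split; nra.
Qed.

Lemma isminZ c u v w : 0 <= c -> ismin u v w -> ismin (c * u) (c * v) (c * w).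
Proof. by move=> c0 [[h ->]|[h ->]]; [left|right]; split=> //; apply: ler_wpM2l. Qed.

End Minimum.

Section Plucker.
Variable R : realType.

Definition pt := (R * R * R)%type.

Definition det3 (u v w : pt) : R :=
  u.1.1 * (v.1.2 * w.2 - v.2 * w.1.2) - u.1.2 * (v.1.1 * w.2 - v.2 * w.1.1)
  + u.2 * (v.1.1 * w.1.2 - v.1.2 * w.1.1).

Lemma det3_swapl u v w : det3 v u w = - det3 u v w.
Proof. by rewrite /det3; ring. Qed.

Lemma det3_swapr u v w : det3 u w v = - det3 u v w.
Proof. by rewrite /det3; ring. Qed.

Lemma plucker3 p a b c d :
  det3 p a b * det3 p c d + det3 p a c * det3 p d b + det3 p a d * det3 p b c = 0.
Proof. by rewrite /det3; ring. Qed.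

End Plucker.

Definition distinct (I : finType) (V : {set I}) (s : seq I) :=
  uniq s && all (fun a => a \in V) s.

Ltac dsplit := rewrite /distinct /= ?inE ?negb_or ?andbT;
  repeat (apply/andP; split); try done; try assumption;
  try (rewrite eq_sym; assumption).
Ltac dsplitand H := lazymatch type of H with
  | is_true (_ && _) => let h1 := fresh "ds" in let h2 := fresh "ds" in
      move/andP: H => [h1 h2]; dsplitand h1; dsplitand h2
  | _ => idtac end.
Ltac dcase h := let H := fresh "ds" in pose proof h as H;
  rewrite /distinct /= ?inE ?negb_or ?andbT in H; dsplitand H.

Ltac dsub := exfalso; subst; match goal with
  | H : is_true (?a != ?a) |- _ => by rewrite eqxx in H
  end.

Section Triples.
Variables (R : realType) (I : finType).
Implicit Types (x w : I -> I -> I -> R) (V : {set I}).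

(** [true] is the positive sign, so [(+)] holds for a negative product; [sg3] reflects that three
    nonzero numbers of the same sign do not sum to zero. *)
Record chirotope (sg : I -> I -> I -> bool) := Chirotope {
  sgl : forall a b c, uniq [:: a; b; c] -> sg b a c = ~~ sg a b c;
  sgr : forall a b c, uniq [:: a; b; c] -> sg a c b = ~~ sg a b c;
  sg3 : forall p a b c d, uniq [:: p; a; b; c; d] ->
    ~ (sg p a b (+) sg p c d = sg p a c (+) sg p d b /\
       sg p a c (+) sg p d b = sg p a d (+) sg p b c) }.

Definition sym3 x := (forall a b c, x b a c = x a b c) /\ (forall a b c, x a c b = x a b c).

Variable sg : I -> I -> I -> bool.

(* The products [p a b] [p c d], [p a c] [p d b] and [p a d] [p b c] of a
   three-term Pluecker relation sum to zero; [special] says that the first one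
   has the sign opposite to the other two. *)
Definition special p a b c d := sg p a c (+) sg p d b == sg p a d (+) sg p b c.

(* Points of the prevariety of the three-term relations among elements of [V];
   [St] and [Lin] are the star of [x] in it and the lineality space of this star. *)
Definition TD V x := sym3 x /\ forall p a b c d, distinct V [:: p; a; b; c; d] ->
  special p a b c d ->
  ismin (x p a b + x p c d) (x p a c + x p b d) (x p a d + x p b c).

Definition St V x w := sym3 w /\ forall p a b c d, distinct V [:: p; a; b; c; d] ->
  special p a b c d ->
  smin (x p a c + x p b d) (x p a d + x p b c)
    (w p a b + w p c d) (w p a c + w p b d) (w p a d + w p b c).

Definition Lin V x w := sym3 w /\ forall p a b c d, distinct V [:: p; a; b; c; d] ->
  special p a b c d ->
  slin (x p a c + x p b d) (x p a d + x p b c)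
    (w p a b + w p c d) (w p a c + w p b d) (w p a d + w p b c).

Definition tadd x w t a b c := x a b c + t * w a b c.

End Triples.

(** Brings all occurrences of the symmetric function [x] on the same triple to one order of
    arguments, so that [lra] sees a single unknown. *)
Ltac symn x hs := let s1 := fresh "s1" in let s2 := fresh "s2" in
  have [s1 s2] := hs;
  repeat match goal with
  | |- context [x ?a ?b ?c] =>
     match goal with
     | |- context [x a c b] => first [constr_eq b c; fail 1 | rewrite (s2 a b c)]
     | |- context [x b a c] => first [constr_eq b a; fail 1 | rewrite (s1 a b c)]
     | |- context [x c b a] => first [constr_eq c a; fail 1 | rewrite (s1 b c a) (s2 b a c) (s1 a b c)]
     | |- context [x b c a] => first [constr_eq a b; constr_eq b c; fail 1 | rewrite (s2 b a c) (s1 a b c)]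
     | |- context [x c a b] => first [constr_eq a b; constr_eq b c; fail 1 | rewrite (s1 a c b) (s2 a b c)]
     end
  end; clear s1 s2.

(** * The ordered tree seen from an element, rooted at [e] *)

Section Pencil.
Variables (R : realType) (I : finType) (sg : I -> I -> I -> bool).
Hypothesis chi : chirotope sg.
Variables (V : {set I}) (e : I) (x : I -> I -> I -> R).
Hypothesis eV : e \in V.
Hypothesis xTD : TD sg V x.
Local Notation dst := (distinct V).

(* Seen from [a], the other elements are linearly ordered, starting at [e];
   [lo a b c] says that [b] comes before [c]. *)
Definition lo a b c := ~~ (sg a b c (+) sg a e b (+) sg a e c).

Lemma lo_anti a b c : dst [:: e; a; b; c] -> lo a c b = ~~ lo a b c.
Proof.
move=> h; dcase h; rewrite /lo (sgr chi (a := a) (b := b) (c := c)); last by dsplit.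
by case: (sg a b c); case: (sg a e b); case: (sg a e c).
Qed.

(** A failure would give the three products at [a] among [e], [b], [c], [d] the same sign. *)
Lemma lo_trans a b c d : dst [:: e; a; b; c; d] -> lo a b c -> lo a c d -> lo a b d.
Proof.
move=> h; dcase h; move: (sg3 chi (p := a) (a := e) (b := b) (c := c) (d := d)).
rewrite /lo (sgr chi (a := a) (b := b) (c := d)); last by dsplit.
have -> : uniq [:: a; e; b; c; d] by dsplit.
move=> /(_ isT).
case: (sg a b c); case: (sg a e b); case: (sg a e c); case: (sg a e d);
   case: (sg a c d); case: (sg a b d) => //= h' _ _; case: h'; by [].
Qed.

Lemma lo_special a b c d : dst [:: e; a; b; c; d] -> lo a b c -> lo a c d ->
  special sg a e c b d.
Proof.
move=> h; dcase h; rewrite /special /lo.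
rewrite (sgr chi (a := a) (b := c) (c := d)); last by dsplit.
rewrite (sgr chi (a := a) (b := b) (c := c)); last by dsplit.
by case: (sg a b c); case: (sg a e b); case: (sg a e c); case: (sg a e d);
   case: (sg a c d).
Qed.

(** The Farris transform with base [e] of the tree seen from [a]: subtracting the terms through [e]
    turns the four-point condition into an ultrametric one. With minima in place of maxima, a larger
    value means closer. *)
Definition del a b c := x a b c - x a b e - x a c e.

Lemma delC a b c : del a b c = del a c b.
Proof. by rewrite /del; case: xTD => -[_ h] _; rewrite (h a b c); lra. Qed.

Lemma del_min a b c d : dst [:: e; a; b; c; d] -> lo a b c -> lo a c d ->
  ismin (del a b d) (del a b c) (del a c d).
Proof.
move=> h h1 h2; have sp := lo_special h h1 h2; dcase h.
have [xs /(_ a e c b d)] := xTD; case/(_ _ sp); first by dsplit.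
all: rewrite /del /ismin; symn x xs; lra.
Qed.

Lemma lo_cases (P : I -> I -> I -> Prop) a :
  (forall b c d, dst [:: e; a; b; c; d] -> lo a b c -> lo a c d -> P b c d) ->
  (forall b c d, P b c d -> P c b d) -> (forall b c d, P b c d -> P b d c) ->
  forall b c d, dst [:: e; a; b; c; d] -> P b c d.
Proof.
move=> H s1 s2 b c d h; dcase h.
have A u v : dst [:: e; a; u; v] -> lo a u v = false -> lo a v u.
  by move=> h'; rewrite (lo_anti h') => ->.
case bc: (lo a b c); case cd: (lo a c d); case bd: (lo a b d).
- by apply: H => //; dsplit.
- by apply: H => //; dsplit.
- by apply/s2/H => //; [dsplit | apply: A => //; dsplit].
- by apply/s2/s1/H; [dsplit | apply: A => //; dsplit | ].
- by apply/s1/H => //; [dsplit | apply: A => //; dsplit].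
- by apply/s1/s2/H => //; [dsplit | apply: A => //; dsplit].
- have := @lo_trans a d c b; rewrite (A c d) ?(A b c) //; try by dsplit.
  by rewrite lo_anti ?bd; last dsplit; move=> h'; have : ~~ true by apply: h' => //; dsplit.
- by apply/s1/s2/s1/H; [dsplit | apply: A => //; dsplit | apply: A => //; dsplit].
Qed.

Lemma del_ultra a b c d : dst [:: e; a; b; c; d] ->
  [\/ del a b c = del a b d /\ del a b c <= del a c d,
      del a b c = del a c d /\ del a b c <= del a b d |
      del a b d = del a c d /\ del a b d <= del a b c].
Proof.
move: b c d; apply: lo_cases => [b c d h h1 h2|b c d|b c d].
- have := del_min h h1 h2; rewrite /ismin => -[[? ?]|[? ?]].
    by constructor 1; lra.
  by constructor 3; lra.
- by rewrite (delC a c b) => -[] [? ?]; [constructor 2|constructor 1|constructor 3]; lra.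
- by rewrite (delC a d c) => -[] [? ?]; [constructor 1|constructor 3|constructor 2]; lra.
Qed.

(* The relations through [a] and [e] make [del a] an ultrametric compatible with
   that order; [sb a b c] says that [b] and [c] are in the same branch at the
   root of the corresponding tree. *)
Definition sb a b c := (b == c) ||
  [exists d, distinct V [:: e; a; b; c; d] && (del a b d < del a b c)].

Lemma sb_refl a b : sb a b b.
Proof. by rewrite /sb eqxx. Qed.

Lemma sbC a b c : dst [:: e; a; b; c] -> sb a b c = sb a c b.
Proof.
move=> h; dcase h.
suff H u v : dst [:: e; a; u; v] -> sb a u v -> sb a v u.
  by apply/idP/idP; apply: H; dsplit.
move=> h'; dcase h'; rewrite /sb (negPf (_ : u != v)) //= eq_sym (negPf (_ : u != v)) //=.
move=> /existsP[d /andP[hd lt]]; apply/existsP; exists d; dcase hd.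
apply/andP; split; first by dsplit.
have := del_ultra hd; rewrite (delC a v u) => -[] [? ?]; lra.
Qed.

(** By definition of [sb] the value is minimal among pairs through [b]; the ultrametric property
    extends this to pairs through [c] and then to all pairs. *)
Lemma nsb_min a b c f g : dst [:: e; a; b; c] -> ~~ sb a b c -> dst [:: e; a; f; g] ->
  del a b c <= del a f g.
Proof.
move=> h; dcase h; rewrite /sb negb_or => /andP[_ /existsPn H] h'; dcase h'.
have H1 d : dst [:: e; a; b; c; d] -> del a b c <= del a b d.
  by move=> hd; have := H d; rewrite hd /= -leNgt.
have H2 d : dst [:: e; a; b; c; d] -> del a b c <= del a c d.
  by move=> hd; have := H1 _ hd; have := del_ultra hd => -[] [? ?]; lra.
have H3 d : a != d -> e != d -> d \in V -> b != d -> del a b c <= del a b d.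
  move=> ? ? ? ?; have [<-//|cd] := eqVneq c d; apply: H1; dsplit.
have H4 d : a != d -> e != d -> d \in V -> c != d -> del a b c <= del a c d.
  move=> ? ? ? ?; have [<-|bd] := eqVneq b d; first by rewrite (delC a c b).
  by apply: H2; dsplit.
have [eb|bf] := eqVneq b f; first by rewrite -eb; apply: H3 => //; rewrite eb.
have [eb|bg] := eqVneq b g; first by rewrite -eb (delC a f b); apply: H3 => //; rewrite eb eq_sym.
have hf : del a b c <= del a b f by exact: H3.
have hg : del a b c <= del a b g by exact: H3.
have : dst [:: e; a; b; f; g] by dsplit.
by move=> /del_ultra -[] [? ?]; lra.
Qed.

Lemma sb_lt a b c d : dst [:: e; a; b; c; d] -> sb a b c -> ~~ sb a b d ->
  del a b d < del a b c /\ del a c d = del a b d.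
Proof.
move=> h; dcase h => /orP[/eqP bc|/existsP[g /andP[hg lt]]] nd; first by dsub.
dcase hg; have bd : dst [:: e; a; b; d] by dsplit.
have : del a b d <= del a b g by apply: nsb_min bd nd _; dsplit.
by have := del_ultra h => -[] [? ?]; lra.
Qed.

Lemma sb_trans a b c d : dst [:: e; a; b; c; d] -> sb a b c -> sb a c d -> sb a b d.
Proof.
move=> h bc cd; apply: contraT => nbd; dcase h.
have [lt e1] := sb_lt h bc nbd; move: cd => /orP[/eqP cd|/existsP[g /andP[hg lt2]]].
  by dsub.
dcase hg; have bd : dst [:: e; a; b; d] by dsplit.
by have : del a b d <= del a c g; [apply: nsb_min bd nbd _; dsplit | lra].
Qed.

Lemma nsb_ex a b c : dst [:: e; a; b; c] -> exists2 d, dst [:: e; a; b; d] & ~~ sb a b d.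
Proof.
move=> h; pose P d := dst [:: e; a; b; d].
have [d hd dmin] := @arg_minP _ R I c P (fun d => del a b d) h.
rewrite /P in hd dmin; exists d => //; dcase hd; apply/norP; split=> //.
apply/existsPn => g; rewrite negb_and -implybE; apply/implyP => hg.
by rewrite -leNgt; apply: dmin; dcase hg; dsplit.
Qed.

Lemma sb_interval a b c d : dst [:: e; a; b; c; d] -> lo a b c -> lo a c d ->
  sb a b d -> sb a b c && sb a c d.
Proof.
move=> h bc cd bd; dcase h.
have hm := del_min h bc cd.
have H u v : dst [:: e; a; u; v] -> ~~ sb a u v -> del a b d <= del a u v -> False.
  move=> huv nuv le; dcase huv; move: bd => /orP[/eqP bd|/existsP[g /andP[hg lt2]]].
    by dsub.
  dcase hg; have : del a u v <= del a b g by apply: nsb_min huv nuv _; dsplit.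
  lra.
by apply/andP; split; apply: contraT => n; exfalso; apply: (H _ _ _ n); try dsplit;
  move: hm; rewrite /ismin; lra.
Qed.

Lemma nsb_del a b c f g : dst [:: e; a; b; c] -> dst [:: e; a; f; g] ->
  ~~ sb a b c -> ~~ sb a f g -> del a b c = del a f g.
Proof. by move=> h h' n n'; apply/eqP; rewrite eq_le !nsb_min. Qed.

Definition emove (w : I -> I -> R) a b c :=
  if a == e then w b c else if b == e then w a c else if c == e then w a b else 0.

Definition sym2 (w : I -> I -> R) := forall a b, w a b = w b a.

(* The elements of the star of [x] that move [e] only, see [fib_St]. *)
Definition fib w := sym2 w /\ forall a b c d, dst [:: e; a; b; c; d] ->
  lo a b c -> lo a c d -> smin (del a c d) (del a b c) (w a c) (w a b) (w a d).

(** The same directions read off the trees. As [e] is the base of each tree, moving it only matters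
    at the root: values are constant on root branches, and of three branches in order the middle one
    takes the smaller of the two outer values. *)
Definition fibb (w : I -> I -> R) := [/\ sym2 w,
  forall a b c, dst [:: e; a; b; c] -> sb a b c -> w a b = w a c &
  forall a b c d, dst [:: e; a; b; c; d] -> lo a b c -> lo a c d ->
     ~~ sb a b c -> ~~ sb a c d -> ismin (w a c) (w a b) (w a d)].

Lemma fibb_fib w : fibb w -> fib w.
Proof.
move=> [ws H1 H2]; split=> // a b c d h bc cd; dcase h.
have hm := del_min h bc cd.
have dbc : dst [:: e; a; b; c] by dsplit.
have dcd : dst [:: e; a; c; d] by dsplit.
have dbd : dst [:: e; a; b; d] by dsplit.
split=> lt.
- case nbc: (sb a b c); first by rewrite (H1 _ _ _ dbc nbc).
  by have := nsb_min dbc (negbT nbc) dcd; lra.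
- case ncd: (sb a c d); first by rewrite (H1 _ _ _ dcd ncd).
  by have := nsb_min dcd (negbT ncd) dbc; lra.
- case nbc: (sb a b c); case ncd: (sb a c d).
  + by rewrite -(H1 _ _ _ dcd ncd) (H1 _ _ _ dbc nbc); left; split=> //; lra.
  + have := @sb_lt a c b d; rewrite -(sbC dbc) nbc ncd (delC a c b) => /(_ _ isT isT) [].
      by dsplit.
    lra.
  + have := @sb_lt a c d b; rewrite -(sbC dbc) nbc ncd (delC a c b) => /(_ _ isT isT) [].
      by dsplit.
    lra.
  + by apply: H2; rewrite ?nbc ?ncd.
Qed.

Lemma fib_fibb w : fib w -> fibb w.
Proof.
move=> [ws H].
(* Among three elements, a strictly closest pair must have equal values. *)
pose P a b c d := [/\ (del a b d < del a b c -> del a c d < del a b c -> w a b = w a c),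
  (del a b c < del a b d -> del a c d < del a b d -> w a b = w a d) &
  (del a b c < del a c d -> del a b d < del a c d -> w a c = w a d)].
have K a b c d : dst [:: e; a; b; c; d] -> P a b c d.
  move: b c d; apply: lo_cases => [b c d h h1 h2|b c d [h1 h2 h3]|b c d [h1 h2 h3]].
  - have hm := del_min h h1 h2; have [k1 k2 k3] := H _ _ _ _ h h1 h2.
    split=> l1 l2.
    + exact/esym/(k1 l2).
    + by move: hm; rewrite /ismin => ?; exfalso; lra.
    + exact: (k2 l1).
  - by rewrite /P (delC a c b); split=> l1 l2; [exact/esym/h1 | exact: h3 | exact: h2].
  - by rewrite /P (delC a d c); split=> l1 l2; [exact: h2 | exact: h1 | exact/esym/h3].
split=> // [a b c h bc|a b c d h b_c c_d nbc ncd]; last first.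
  have [_ _] := H _ _ _ _ h b_c c_d; apply; apply: nsb_del => //; dcase h; dsplit.
have [d hd nbd] := nsb_ex h; dcase h; dcase hd.
have cd : c != d by apply: contra nbd => /eqP <-.
have h' : dst [:: e; a; b; c; d] by dsplit.
have [lt e1] := sb_lt h' bc nbd.
by have [k1 _ _] := K _ _ _ _ h'; apply: k1; lra.
Qed.

End Pencil.

(** * Moving a single element *)

Section FivePoints.
Variables (R : realType) (I : finType) (sg : I -> I -> I -> bool).
Hypothesis chi : chirotope sg.

Definition allb (P : bool -> bool) := P true && P false.

Lemma allbP P : allb P -> forall b, P b.
Proof. by move=> /andP[? ?] []. Qed.

(** The first five hypotheses are [sg3] at the five pivots; the 1024 sign vectors are enumerated. *)
Lemma special5_bool : allb (fun eab => allb (fun eac => allb (fun ead => allb (fun ebc => allb (fun ebd => allb (fun ecd => allb (fun abc => allb (fun abd => allb (fun acd => allb (fun bcd =>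
  ~~ ((eab (+) ecd == eac (+) (~~ ebd)) && (eac (+) (~~ ebd) == ead (+) ebc)) ==>
  ~~ (((~~ eab) (+) acd == (~~ eac) (+) (~~ abd)) && ((~~ eac) (+) (~~ abd) == (~~ ead) (+) abc)) ==>
  ~~ ((eab (+) bcd == (~~ ebc) (+) abd) && ((~~ ebc) (+) abd == (~~ ebd) (+) (~~ abc))) ==>
  ~~ ((eac (+) (~~ bcd) == ebc (+) acd) && (ebc (+) acd == (~~ ecd) (+) abc)) ==>
  ~~ ((ead (+) bcd == ebd (+) (~~ acd)) && (ebd (+) (~~ acd) == ecd (+) abd)) ==>
  (eac (+) (~~ ebd) == ead (+) ebc) ==>
  [|| [&& ((~~ eac) (+) (~~ abd) == (~~ ead) (+) abc), (ead (+) bcd == ebd (+) (~~ acd)), (eab (+) (~~ bcd) == (~~ ebd) (+) abc) & (eac (+) bcd == (~~ ecd) (+) (~~ abc))],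
      [&& ((~~ ebc) (+) abd == (~~ ebd) (+) (~~ abc)), (ebd (+) acd == ead (+) (~~ bcd)), ((~~ eab) (+) (~~ acd) == (~~ ead) (+) (~~ abc)) & (ebc (+) acd == (~~ ecd) (+) abc)],
      [&& ((~~ ead) (+) (~~ abc) == (~~ eac) (+) abd), (eac (+) (~~ bcd) == ebc (+) acd), (eab (+) bcd == (~~ ebc) (+) abd) & (ead (+) (~~ bcd) == ecd (+) (~~ abd))] |
      [&& ((~~ ebd) (+) abc == (~~ ebc) (+) (~~ abd)), (ebc (+) (~~ acd) == eac (+) bcd), ((~~ eab) (+) acd == (~~ eac) (+) (~~ abd)) & (ebd (+) (~~ acd) == ecd (+) abd)]])))))))))).
Proof. by vm_compute. Qed.

Lemma sgp p q r : uniq [:: p; q; r] ->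
  (sg q p r = ~~ sg p q r) * (sg p r q = ~~ sg p q r) * (sg q r p = sg p q r) *
  (sg r p q = sg p q r) * (sg r q p = ~~ sg p q r).
Proof.
rewrite /= !inE !negb_or !andbT => /andP[/andP[pq pr] qr].
have L a b c : a != b -> a != c -> b != c -> sg b a c = ~~ sg a b c.
  by move=> h1 h2 h3; apply: (sgl chi); rewrite /= !inE negb_or h1 h2 h3.
have Q a b c : a != b -> a != c -> b != c -> sg a c b = ~~ sg a b c.
  by move=> h1 h2 h3; apply: (sgr chi); rewrite /= !inE negb_or h1 h2 h3.
have qp : q != p by rewrite eq_sym.
have rp : r != p by rewrite eq_sym.
have rq : r != q by rewrite eq_sym.
have e1 := L p q r pq pr qr; have e2 := Q p q r pq pr qr.
have e3 : sg q r p = sg p q r by rewrite (Q q p r qp qr pr) e1 negbK.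
have e4 : sg r p q = sg p q r by rewrite (L p r q pr pq rq) e2 negbK.
have e5 : sg r q p = ~~ sg p q r by rewrite (L q r p qr qp rp) e3.
by do !split.
Qed.

(* Five points in general position lie on a conic; seen from it, [e] has the
   other four points in a linear order, and [special a e b c d] says that [b]
   lies between [c] and [d]. *)
Lemma special5 e a b c d : uniq [:: e; a; b; c; d] -> special sg e a b c d ->
  [\/ [/\ special sg a e b c d, special sg d e c a b, special sg b e c a d & special sg c e b a d],
      [/\ special sg b e a c d, special sg d e c b a, special sg a e c b d & special sg c e a b d],
      [/\ special sg a e b d c, special sg c e d a b, special sg b e d a c & special sg d e b a c] |
      [/\ special sg b e a d c, special sg c e d b a, special sg a e d b c & special sg d e a b c]].
Proof.
move=> u; have := u; rewrite /= !inE !negb_or.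
move=> /and5P[/and4P[ea eb ec ed] /and3P[ab ac ad] /andP[bc bd] cd _].
have X p q r s t : uniq [:: p; q; r; s; t] ->
    ~~ ((sg p q r (+) sg p s t == sg p q s (+) sg p t r) &&
        (sg p q s (+) sg p t r == sg p q t (+) sg p r s)).
  by move=> h; apply/negP => /andP[/eqP h1 /eqP h2]; apply: (sg3 chi h).
have := special5_bool.
move/allbP/(_ (sg e a b)); move/allbP/(_ (sg e a c)); move/allbP/(_ (sg e a d)); move/allbP/(_ (sg e b c)); move/allbP/(_ (sg e b d)); move/allbP/(_ (sg e c d)); move/allbP/(_ (sg a b c)); move/allbP/(_ (sg a b d)); move/allbP/(_ (sg a c d)); move/allbP/(_ (sg b c d)).
have := X d e a b c; have := X c e a b d; have := X b e a c d.
have := X a e b c d; have := X e a b c d.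
have -> : uniq [:: e; a; b; c; d] by dsplit.
have -> : uniq [:: a; e; b; c; d] by dsplit.
have -> : uniq [:: b; e; a; c; d] by dsplit.
have -> : uniq [:: c; e; a; b; d] by dsplit.
have -> : uniq [:: d; e; a; b; c] by dsplit.
move=> /(_ isT) h1 /(_ isT) h2 /(_ isT) h3 /(_ isT) h4 /(_ isT) h5 + h6.
move: h1 h2 h3 h4 h5 h6; rewrite /special.
have U (p q r : I) : p != q -> p != r -> q != r -> uniq [:: p; q; r].
  by move=> h1 h2 h3; rewrite /= !inE negb_or h1 h2 h3.
rewrite !(sgp (U _ _ _ ea eb ab)) !(sgp (U _ _ _ ea ec ac)) !(sgp (U _ _ _ ea ed ad))
  !(sgp (U _ _ _ eb ec bc)) !(sgp (U _ _ _ eb ed bd)) !(sgp (U _ _ _ ec ed cd))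
  ?(sgp (U _ _ _ ab ac bc)) ?(sgp (U _ _ _ ab ad bd)) ?(sgp (U _ _ _ ac ad cd))
  ?(sgp (U _ _ _ bc bd cd)).
move=> -> -> -> -> -> -> /= /or4P[] /and4P[h1 h2 h3 h4].
- by constructor 1.
- by constructor 2.
- by constructor 3.
- by constructor 4.
Qed.

Lemma specialP p a b c d : uniq [:: p; a; b; c; d] -> [/\
  special sg p b a c d = special sg p a b c d,
  special sg p a b d c = special sg p a b c d &
  special sg p c d a b = special sg p a b c d].
Proof.
move=> u; have := u; rewrite /= !inE !negb_or.
move=> /and5P[/and4P[pa pb pc pd] /and3P[ab ac ad] /andP[bc bd] cd _].
have U (q r s : I) : q != r -> q != s -> r != s -> uniq [:: q; r; s].
  by move=> h1 h2 h3; rewrite /= !inE negb_or h1 h2 h3.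
rewrite /special ?(sgp (U _ _ _ pa pb ab)) ?(sgp (U _ _ _ pa pc ac)) ?(sgp (U _ _ _ pa pd ad))
  ?(sgp (U _ _ _ pb pc bc)) ?(sgp (U _ _ _ pb pd bd)) ?(sgp (U _ _ _ pc pd cd)).
by case: (sg p a b); case: (sg p a c); case: (sg p a d); case: (sg p b c);
   case: (sg p b d); case: (sg p c d).
Qed.

Lemma special_ex p a b c d : uniq [:: p; a; b; c; d] ->
  [|| special sg p a b c d, special sg p a c b d | special sg p a d b c].
Proof.
move=> u; have X := @sg3 _ _ chi p a b c d u; have := u; rewrite /= !inE !negb_or.
move=> /and5P[/and4P[pa pb pc pd] /and3P[ab ac ad] /andP[bc bd] cd _].
have U (q r s : I) : q != r -> q != s -> r != s -> uniq [:: q; r; s].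
  by move=> h1 h2 h3; rewrite /= !inE negb_or h1 h2 h3.
move: X; rewrite /special ?(sgp (U _ _ _ pa pb ab)) ?(sgp (U _ _ _ pa pc ac)) ?(sgp (U _ _ _ pa pd ad))
  ?(sgp (U _ _ _ pb pc bc)) ?(sgp (U _ _ _ pb pd bd)) ?(sgp (U _ _ _ pc pd cd)).
by case: (sg p a b); case: (sg p a c); case: (sg p a d); case: (sg p b c);
   case: (sg p b d); case: (sg p c d) => //= X; case: X.
Qed.

Variables (V : {set I}).

Lemma special_lo e p b c d : distinct V [:: p; e; b; c; d] -> special sg p e b c d ->
  lo sg e p c b /\ lo sg e p b d \/ lo sg e p d b /\ lo sg e p b c.
Proof.
move=> h; dcase h; rewrite /special /lo.
have S1 := @sgp p b c ltac:(dsplit); have S2 := @sgp p b d ltac:(dsplit).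
rewrite !S1 !S2.
by case: (sg p e b); case: (sg p e c); case: (sg p e d); case: (sg p b c);
   case: (sg p b d); case: (sg p c d) => //= _; by [left | right].
Qed.

End FivePoints.

Section Moves.
Variables (R : realType) (I : finType) (sg : I -> I -> I -> bool).
Hypothesis chi : chirotope sg.
Variables (V : {set I}) (e : I) (x : I -> I -> I -> R).
Hypothesis eV : e \in V.
Hypothesis xTD : TD sg V x.
Local Notation dst := (distinct V).
Local Notation fib := (fib sg V e x).
Local Notation lo := (lo sg e).
Local Notation dl := (del e x).
Local Notation sb := (sb V e x).
Local Notation mv := (@emove R I e).

Lemma emove_sym w : sym2 w -> sym3 (mv w).
Proof.
by move=> ws; split=> a b c; rewrite /emove;
  have [?|?] := eqVneq a e; have [?|?] := eqVneq b e; have [?|?] := eqVneq c e;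
  subst => //; rewrite ws.
Qed.

Lemma emovel w b c : mv w e b c = w b c.
Proof. by rewrite /emove eqxx. Qed.

Lemma emovem w a c : a != e -> mv w a e c = w a c.
Proof. by rewrite /emove eqxx => /negPf ->. Qed.

Lemma emove0 w a b c : a != e -> b != e -> c != e -> mv w a b c = 0.
Proof. by rewrite /emove => /negPf -> /negPf -> /negPf ->. Qed.

Lemma fib_star w p b c d : fib w -> dst [:: p; e; b; c; d] -> special sg p e b c d ->
  smin (x p e c + x p b d) (x p e d + x p b c) (w p b) (w p c) (w p d).
Proof.
move=> [ws H] h sp; dcase h.
have K c' d' : dst [:: p; e; b; c'; d'] -> lo p c' b -> lo p b d' ->
    smin (x p e c' + x p b d') (x p e d' + x p b c') (w p b) (w p c') (w p d').
  move=> h' h1 h2; dcase h'; have h3 : dst [:: e; p; c'; b; d'] by dsplit.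
  have [k1 k2 k3] := H p c' b d' h3 h1 h2.
  move: k1 k2 k3; rewrite /del; case: xTD => xs _; symn x xs => k1 k2 k3.
  by split=> lt; [apply: k1 | apply: k2 | apply: k3]; lra.
have [[h1 h2]|[h1 h2]] := special_lo chi h sp; first exact: K.
by apply/sminC; apply: K => //; dsplit.
Qed.

(** In this relation [e] occurs in every factor, while [fib] only mentions the relations with
    another pivot. By [special5], four of the latter imply it linearly; the deduction is made at the
    points [x + t w] for small [t], where all relations are about minima of numbers. *)
Lemma emove_pivot w a b c d : fib w -> dst [:: e; a; b; c; d] -> special sg e a b c d ->
  smin (x e a c + x e b d) (x e a d + x e b c) (w a b + w c d) (w a c + w b d) (w a d + w b c).
Proof.
move=> fw h sp; dcase h; have [xs xr] := xTD; have [ws _] := fw.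
have u : uniq [:: e; a; b; c; d] by dsplit.
have K p q r s : dst [:: e; p; q; r; s] -> special sg p e q r s ->
    exists2 t0, 0 < t0 & forall t, 0 <= t -> t <= t0 ->
    ismin (x p e q + x p r s + t * w p q) (x p e r + x p q s + t * w p r)
      (x p e s + x p q r + t * w p s).
  move=> h' s'; have hd : dst [:: p; e; q; r; s] by dcase h'; dsplit.
  exact: smin_small (xr _ _ _ _ _ hd s') (fib_star fw hd s').
have K0 : ismin (x e a b + x e c d) (x e a c + x e b d) (x e a d + x e b c) by apply: xr.
case: (special5 chi u sp) => -[/K s1 /K s2 /K s3 /K s4].
all: have [t1 p1 {}s1] := s1 ltac:(dsplit).
all: have [t2 p2 {}s2] := s2 ltac:(dsplit).
all: have [t3 p3 {}s3] := s3 ltac:(dsplit).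
all: have [t4 p4 {}s4] := s4 ltac:(dsplit).
all: apply: (@small_smin R _ _ _ _ _ _ (Num.min (Num.min t1 t2) (Num.min t3 t4)) K0).
1,3,5,7: by rewrite !lt_min p1 p2 p3 p4.
all: move=> t t0; rewrite !le_min => /andP[/andP[l1 l2] /andP[l3 l4]].
all: move: (s1 t (ltW t0) l1) (s2 t (ltW t0) l2) (s3 t (ltW t0) l3) (s4 t (ltW t0) l4).
all: rewrite !(ws b a) ?(ws c a) ?(ws d a) ?(ws c b) ?(ws d b) ?(ws d c) !mulrDr.
all: symn x xs; rewrite /ismin; lra.
Qed.

Lemma fib_St w : fib w -> St sg V x (mv w).
Proof.
move=> fw; have [ws _] := fw; have is3 := emove_sym ws; have [xs xr] := xTD.
split=> // p a b c d h sp.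
have u : uniq [:: p; a; b; c; d] by case/andP: h.
(* The case of [e] in the first slot after the pivot; the other positions reduce to it by the
   symmetries in [specialP]. *)
have S a' b' c' d' : dst [:: p; e; b'; c'; d'] -> a' = e -> special sg p a' b' c' d' ->
   smin (x p a' c' + x p b' d') (x p a' d' + x p b' c') (mv w p a' b' + mv w p c' d')
     (mv w p a' c' + mv w p b' d') (mv w p a' d' + mv w p b' c').
  move=> h' -> sp'; dcase h'; rewrite !emovem; try (by dsplit).
  rewrite !emove0; try (by dsplit).
  rewrite !addr0.
  exact: fib_star.
have [ep|pe] := eqVneq e p.
  by subst p; rewrite !emovel; apply: emove_pivot.
dcase h; have [p1 p2 p3] := specialP chi u.
have [ea|ea] := eqVneq a e; first by apply: S => //; subst a; dsplit.
have [eb|eb] := eqVneq b e.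
  have F : dst [:: p; e; a; c; d] by subst b; dsplit.
  have := S b a c d F eb; rewrite p1 => /(_ sp) /sminC.
  by symn x xs; symn (mv w) is3 => H; apply: smin_eq H; rewrite // addrC.
have [ec|ec] := eqVneq c e.
  have F : dst [:: p; e; d; a; b] by subst c; dsplit.
  have := S c d a b F ec; rewrite p3 => /(_ sp).
  by symn x xs; symn (mv w) is3 => H; apply: smin_eq H; rewrite // addrC.
have [ed|ed] := eqVneq d e.
  have F : dst [:: p; e; c; a; b] by subst d; dsplit.
  have := S d c a b F ed.
  have -> : special sg p d c a b = special sg p a b c d.
    by rewrite -p3; have [-> _ _] := @specialP _ _ chi p c d a b ltac:(dsplit).
  move=> /(_ sp) /sminC.
  by symn x xs; symn (mv w) is3 => H; apply: smin_eq H; rewrite // addrC.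
rewrite !emove0; try (by dsplit).
by rewrite !addr0; split=> // _; left.
Qed.

Lemma St_fib w : sym2 w -> St sg V x (mv w) -> fib w.
Proof.
move=> ws [_ H]; split=> // a b c d h h1 h2.
have sp := lo_special chi h h1 h2; dcase h; have [xs _] := xTD.
have h3 : dst [:: a; e; c; b; d] by dsplit.
have [k1 k2 k3] := H a e c b d h3 sp.
move: k1 k2 k3; rewrite !emovem; try (by dsplit).
rewrite !emove0; try (by dsplit).
rewrite !addr0 /del.
by symn x xs => k1 k2 k3; split=> lt; [apply: k1|apply: k2|apply: k3]; lra.
Qed.

End Moves.

(** * Colours *)

Section LocalColouring.
Variables (I : finType) (C : eqType) (W : {set I}) (f : I -> I -> C).
Hypothesis fC : forall a b, f a b = f b a.
Hypothesis f2 : forall a b c d, distinct W [:: a; b; c; d] ->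
  [|| f a b == f a c, f a c == f a d | f a b == f a d].

Definition sees a k := exists2 b, distinct W [:: a; b] & f a b = k.

Lemma sees2 a k l m : sees a k -> sees a l -> sees a m -> [|| k == l, l == m | k == m].
Proof.
move=> [b hb <-] [c hc <-] [d hd <-]; dcase hb; dcase hc; dcase hd.
have [->|bc] := eqVneq b c; first by rewrite eqxx.
have [->|cd] := eqVneq c d; first by rewrite eqxx orbT.
have [->|bd] := eqVneq b d; first by rewrite eqxx !orbT.
by apply: f2; dsplit.
Qed.

Lemma sees_l a b : distinct W [:: a; b] -> sees a (f a b).
Proof. by move=> h; exists b. Qed.

Lemma sees_r a b : distinct W [:: a; b] -> sees b (f a b).
Proof. by move=> h; exists a; rewrite 1?fC //; dcase h; dsplit. Qed.

Definition few_colours := exists k1 k2 k3, forall a b, distinct W [:: a; b] ->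
  f a b \in [:: k1; k2; k3].

(** A structure theorem for local 2-colourings of complete graphs. Let [a] see [p, q], let [b] see
    [p, r], and let an edge at [d] have a fourth colour [s]. The edges from [d] to [a] and [b] force
    [d] to see [p] too. A vertex not seeing [p] would see [q], [r] and [s] on its edges to [a], [b]
    and [d]. *)
Lemma star_colour a0 : a0 \in W -> ~ few_colours ->
  exists k0, forall a, a \in W -> sees a k0.
Proof.
move=> a0W nf.
have N k1 k2 k3 : exists a b, distinct W [:: a; b] /\ f a b \notin [:: k1; k2; k3].
  apply: contrapT => H; apply: nf; exists k1, k2, k3 => a b h.
  by apply: contrapT => /negP h'; apply: H; exists a, b.
have [a [p [q [sp sq pq aW]]]] : exists a p q, [/\ sees a p, sees a q, p != q & a \in W].
  pose k := f a0 a0; have [a [b [hab _]]] := N k k k.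
  have [c [d [hcd]]] := N (f a b) (f a b) (f a b); rewrite !inE !orbb eq_sym => ne.
  have := hab; have := hcd; dcase hab; dcase hcd => _ _.
  have [ac|ac] := eqVneq a c.
    by exists a, (f a b), (f c d); split=> //; [exact: sees_l | rewrite ac; exact: sees_l].
  have hac : distinct W [:: a; c] by dsplit.
  have [ef|nf2] := eqVneq (f a c) (f a b).
    by exists c, (f a b), (f c d); split=> //; [rewrite -ef; exact: sees_r | exact: sees_l].
  by exists a, (f a c), (f a b); split=> //; exact: sees_l.
have main b p' q' r : [/\ sees a p', sees a q' & p' != q'] -> b \in W -> sees b p' -> sees b r ->
    r \notin [:: p'; q'] -> exists k0, forall a, a \in W -> sees a k0.
  move=> [{}sp {}sq {}pq] bW bp br; rewrite !inE negb_or => /andP[rp rq].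
  have [d [d' [hd]]] := N p' q' r; rewrite !inE !negb_or => /and3P[].
  set s := f d d' => np nq nr; have ds := sees_l hd; rewrite -/s in ds.
  have dW : d \in W by dcase hd.
  have ne2 x y k l m : sees x k -> sees x l -> sees x m -> x = y -> k != l -> l != m -> k != m -> False.
    by move=> h1 h2 h3 _ /negPf e1 /negPf e2 /negPf e3; have := sees2 h1 h2 h3; rewrite e1 e2 e3.
  have ad : a != d.
    by apply: contraT => /negPn/eqP ad; exfalso; apply: (ne2 _ _ _ _ _ sp sq _ (erefl a) pq); rewrite ?ad; first exact: ds; rewrite eq_sym.
  have bd : b != d.
    apply: contraT => /negPn/eqP bd; exfalso; apply: (ne2 _ _ _ _ _ bp br _ (erefl b)); rewrite ?bd; first exact: ds; by rewrite eq_sym.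
  have hbd : distinct W [:: b; d] by dsplit.
  have had : distinct W [:: a; d] by dsplit.
  have e1 : (f a d == p') || (f a d == q').
    have := sees2 sp sq (sees_l had); rewrite (negPf pq) /= (eq_sym q') (eq_sym p') orbC.
    by [].
  have e2 : (f b d == p') || (f b d == r).
    by have := sees2 bp br (sees_l hbd); rewrite eq_sym (negPf rp) /= (eq_sym r) (eq_sym p') orbC.
  have dp : sees d p'.
    case/orP: e1 => /eqP e1; first by rewrite -e1; exact: sees_r.
    case/orP: e2 => /eqP e2; first by rewrite -e2; exact: sees_r.
    exfalso; apply: (ne2 d d q' r s) => //; rewrite 1?eq_sym //.
      by rewrite -e1; exact: sees_r.
    by rewrite -e2; exact: sees_r.
  exists p' => v vW.
  have [<-//|av] := eqVneq a v; have [<-//|bv] := eqVneq b v; have [<-//|dv] := eqVneq d v.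
  have hav : distinct W [:: a; v] by dsplit.
  have hbv : distinct W [:: b; v] by dsplit.
  have hdv : distinct W [:: d; v] by dsplit.
  have := sees2 sp sq (sees_l hav); rewrite (negPf pq) /= => /orP[] /eqP e3; last first.
    by rewrite e3; exact: sees_r.
  have := sees2 bp br (sees_l hbv); rewrite eq_sym (negPf rp) /= => /orP[] /eqP e4; last first.
    by rewrite e4; exact: sees_r.
  have := sees2 dp ds (sees_l hdv); rewrite eq_sym (negPf np) /= => /orP[] /eqP e5; last first.
    by rewrite e5; exact: sees_r.
  exfalso; apply: (ne2 v v q' r s) => //; rewrite 1?eq_sym //.
  - by rewrite e3; exact: sees_r.
  - by rewrite e4; exact: sees_r.
  - by rewrite e5; exact: sees_r.
have [b [b' [hb nb]]] := N p q q; have ra := sees_l hb.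
have bW : b \in W by dcase hb.
have ab : a != b.
  apply: contraT => /negPn/eqP ab; move: nb; rewrite !inE -ab in ra *; rewrite !negb_or => /and3P[n1 n2 _].
  by have := sees2 sp sq ra; rewrite (negPf pq) (eq_sym q) (eq_sym p) (negPf n1) (negPf n2).
have hab : distinct W [:: a; b] by dsplit.
have := sees2 sp sq (sees_l hab); rewrite (negPf pq) /= => /orP[] /eqP e1.
  apply: (main b q p (f b b')) => //; first by split; rewrite // eq_sym.
    by rewrite e1; exact: sees_r.
  by move: nb; rewrite !inE orbb orbC.
apply: (main b p q (f b b')) => //.
  by rewrite e1; exact: sees_r.
by move: nb; rewrite !inE orbb.
Qed.

End LocalColouring.

Lemma distinctD1 (I : finType) (V : {set I}) e s : e \in V ->
  distinct (V :\ e) s = distinct V (e :: s).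
Proof.
move=> eV; rewrite /distinct /= eV /= (_ : all (fun a => a \in V :\ e) s =
  (e \notin s) && all (fun a => a \in V) s); last first.
  elim: s => //= a s ->; rewrite !inE negb_or eq_sym.
  by case: (e != a); case: (a \in V); case: (e \notin s).
by case: (uniq s); case: (e \notin s).
Qed.

Section Colours.
Variables (R : realType) (I : finType) (sg : I -> I -> I -> bool).
Hypothesis chi : chirotope sg.
Variables (V : {set I}) (e : I) (x : I -> I -> I -> R).
Hypothesis eV : e \in V.
Hypothesis xTD : TD sg V x.
Local Notation dst := (distinct V).
Local Notation fib := (fib sg V e x).
Local Notation lo := (lo sg e).
Local Notation sb := (sb V e x).
Implicit Types w : I -> I -> R.

(** The root of the tree seen from [a] has at least three branches. Then [fibb] for a function and
    for its negative leaves only one value at [a]; with two branches it leaves two. *)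
Definition act a := [exists b, exists c, exists d, [&& dst [:: e; a; b; c; d],
  ~~ sb a b c, ~~ sb a c d & ~~ sb a b d]].

Definition flat w := [/\ sym2 w,
  forall a b c, dst [:: e; a; b; c] -> sb a b c -> w a b = w a c &
  forall a b c, dst [:: e; a; b; c] -> act a -> w a b = w a c].

(* The class of [a b] under the equivalence generated by the equalities that
   [flat] imposes. *)
Definition col a b : {set I * I} :=
  [set p | `[< forall w, flat w -> w a b = w p.1 p.2 >]].

Lemma flat_col w a b c d : flat w -> col a b = col c d -> w a b = w c d.
Proof.
move=> fw /finset.setP/(_ (c, d)); rewrite !inE /=.
have -> : `[< forall w, flat w -> w c d = w c d >] by apply/asboolP.
by move=> /asboolP/(_ w fw).
Qed.

Lemma col_eq a b c d : (forall w, flat w -> w a b = w c d) -> col a b = col c d.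
Proof.
move=> H; apply/finset.setP => -[u v]; rewrite !inE /=; apply/asboolP/asboolP => h w fw.
  by rewrite -H // h.
by rewrite H // h.
Qed.

Lemma colC a b : col a b = col b a.
Proof. by apply: col_eq => w []. Qed.

Lemma col_sb a b c : dst [:: e; a; b; c] -> sb a b c -> col a b = col a c.
Proof. by move=> h h'; apply: col_eq => w [_ H _]; apply: H. Qed.

Lemma col_act a b c : dst [:: e; a; b; c] -> act a -> col a b = col a c.
Proof. by move=> h h'; apply: col_eq => w [_ _ H]; apply: H. Qed.

Lemma nsb_act a b c d : dst [:: e; a; b; c; d] -> lo a b c -> lo a c d ->
  ~~ sb a b c -> ~~ sb a c d -> act a.
Proof.
move=> h h1 h2 n1 n2; apply/existsP; exists b; apply/existsP; exists c.
apply/existsP; exists d; apply/and4P; split=> //.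
by apply: contra n1 => /(sb_interval chi xTD h h1 h2) /andP[].
Qed.

Lemma flat_fib w : flat w -> fib w.
Proof.
move=> [ws H1 H2]; apply: fibb_fib => //; split=> // a b c d h h1 h2 n1 n2.
have a_act := nsb_act h h1 h2 n1 n2; dcase h.
have e1 : w a c = w a b by apply: H2 => //; dsplit.
have e2 : w a c = w a d by apply: H2 => //; dsplit.
by left; split=> //; rewrite -e1 e2.
Qed.

Definition fib_linear := forall w, fib w -> fib (fun a b => - w a b).

Lemma fib_flat w : fib_linear -> fib w -> flat w.
Proof.
move=> L fw; have [ws H1 H2] := fib_fibb chi xTD fw.
have [_ _ H3] := fib_fibb chi xTD (L _ fw).
split=> // a b c h /existsP[b1 /existsP[c1 /existsP[d1 /and4P[h1 n1 n2 n3]]]].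
have K : forall b c d, dst [:: e; a; b; c; d] -> (~~ sb a b c -> ~~ sb a c d -> ~~ sb a b d ->
    w a b = w a c /\ w a c = w a d).
  have anti u v : dst [:: e; a; u; v] -> sb a u v = sb a v u by apply: (sbC chi xTD).
  suff K : forall b c d, dst [:: e; a; b; c; d] -> dst [:: e; a; b; c; d] /\
      (~~ sb a b c -> ~~ sb a c d -> ~~ sb a b d -> w a b = w a c /\ w a c = w a d).
    by move=> b' c' d' /K [].
  apply: (lo_cases chi) => [b' c' d' h' l1 l2|b' c' d' [h' P]|b' c' d' [h' P]].
  - split=> // m1 m2 _; move: (H2 _ _ _ _ h' l1 l2 m1 m2) (H3 _ _ _ _ h' l1 l2 m1 m2).
    by rewrite /ismin; lra.
  - dcase h'; split; first by dsplit.
    rewrite (anti c' b'); last by dsplit.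
    by move=> m1 m2 m3; have [-> ->] := P m1 m3 m2.
  - dcase h'; split; first by dsplit.
    rewrite (anti d' c'); last by dsplit.
    by move=> m1 m2 m3; have [-> ->] := P m3 m2 m1.
have [/H1-> //|nbc] := boolP (sb a b c).
(* A third branch: [b1], [c1], [d1] lie in three different branches, which cannot all be those of
   [b] and [c]. *)
have [d [hd m1 m2]] : exists d, [/\ dst [:: e; a; b; c; d], ~~ sb a b d & ~~ sb a c d].
  have T u v t : dst [:: e; a; u] -> dst [:: e; a; v] -> dst [:: e; a; t] ->
      sb a u v -> sb a v t -> sb a u t.
    move=> hu hv ht; have [->//|uv] := eqVneq u v; have [<-//|vt] := eqVneq v t.
    have [->|ut] := eqVneq u t; first by rewrite sb_refl.
    by apply: (sb_trans chi xTD); dcase hu; dcase hv; dcase ht; dsplit.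
  have C u v : dst [:: e; a; u] -> dst [:: e; a; v] -> sb a u v -> sb a v u.
    move=> hu hv; have [->//|uv] := eqVneq u v.
    by rewrite (sbC chi xTD) //; dcase hu; dcase hv; dsplit.
  dcase h; dcase h1.
  have hb : dst [:: e; a; b] by dsplit.
  have hc : dst [:: e; a; c] by dsplit.
  have hb1 : dst [:: e; a; b1] by dsplit.
  have hc1 : dst [:: e; a; c1] by dsplit.
  have hd1 : dst [:: e; a; d1] by dsplit.
  have F d : dst [:: e; a; d] -> ~~ sb a b d -> ~~ sb a c d ->
      exists d, [/\ dst [:: e; a; b; c; d], ~~ sb a b d & ~~ sb a c d].
    move=> hd m1 m2; exists d; split=> //; dcase hd.
    have bd : b != d by apply: contraNneq m1 => ->; rewrite sb_refl.
    have cd : c != d by apply: contraNneq m2 => ->; rewrite sb_refl.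
    by dsplit.
  apply: contrapT => nex.
  have G d : dst [:: e; a; d] -> sb a d b || sb a d c.
    move=> hd; apply: contraT; rewrite negb_or => /andP[m1 m2]; case: nex.
    by apply: (F d) => //; [apply: contra m1 | apply: contra m2]; apply: C.
  move: (G _ hb1) (G _ hc1) (G _ hd1).
  move=> /orP[]k1 /orP[]k2 /orP[]k3;
  first [ by move/negP: n1; apply; apply: (T _ _ _ hb1 _ hc1 k1); rewrite // ; apply: C
        | by move/negP: n2; apply; apply: (T _ _ _ hc1 _ hd1 k2); rewrite // ; apply: C
        | by move/negP: n3; apply; apply: (T _ _ _ hb1 _ hd1 k1); rewrite // ; apply: C ].
by have [e1 e2] := K b c d hd nbc m2 m1.
Qed.

Lemma col_two a b c d : distinct (V :\ e) [:: a; b; c; d] ->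
  [|| col a b == col a c, col a c == col a d | col a b == col a d].
Proof.
rewrite distinctD1 // => h; dcase h.
have [bc|nbc] := boolP (sb a b c); first by rewrite (col_sb _ bc) ?eqxx //; dsplit.
have [cd|ncd] := boolP (sb a c d); first by rewrite (col_sb _ cd) ?eqxx ?orbT //; dsplit.
have [bd|nbd] := boolP (sb a b d); first by rewrite (col_sb _ bd) ?eqxx ?orbT //; dsplit.
have a_act : act a.
  by apply/existsP; exists b; apply/existsP; exists c; apply/existsP; exists d; apply/and4P.
by rewrite (@col_act a b c) ?eqxx //; dsplit.
Qed.

End Colours.

(** * Approximate realisations *)

Section Approximation.
Variable R : realType.
Implicit Types L p q A B : R.

Definition ap L p A := expR (- A - L) <= p <= expR (- A + L).

Lemma ap_gt0 L p A : ap L p A -> 0 < p.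
Proof. by move=> /andP[h _]; apply: lt_le_trans h; exact: expR_gt0. Qed.

Lemma ap_le L L' p A : L <= L' -> ap L p A -> ap L' p A.
Proof.
move=> h /andP[h1 h2]; apply/andP; split.
  by apply: le_trans h1; rewrite ler_expR; lra.
by apply: le_trans h2 _; rewrite ler_expR; lra.
Qed.

Lemma ap_exp A : ap 0 (expR (- A)) A.
Proof. by rewrite /ap subr0 addr0 lexx. Qed.

Lemma ap_shift L p A B C : `|A - B| <= C -> ap L p A -> ap (L + C) p B.
Proof.
rewrite ler_norml => /andP[h1 h2] /andP[k1 k2]; apply/andP; split.
  by apply: le_trans k1; rewrite ler_expR; lra.
by apply: le_trans k2 _; rewrite ler_expR; lra.
Qed.

Lemma ap_mul L L' p q A B : ap L p A -> ap L' q B -> ap (L + L') (p * q) (A + B).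
Proof.
move=> hp hq; have p0 := ap_gt0 hp; have q0 := ap_gt0 hq.
move: hp hq => /andP[h1 h2] /andP[h3 h4]; apply/andP; split.
  have -> : - (A + B) - (L + L') = (- A - L) + (- B - L') by ring.
  by rewrite expRD; apply: ler_pM => //; apply: expR_ge0.
have -> : - (A + B) + (L + L') = (- A + L) + (- B + L') by ring.
by rewrite expRD; apply: ler_pM => //; apply: ltW.
Qed.

Lemma ap_inv L p A : ap L p A -> ap L p^-1 (- A).
Proof.
move=> hp; have p0 := ap_gt0 hp; move: hp => /andP[h1 h2]; apply/andP; split.
  by rewrite (_ : - - A - L = - (- A + L)); [rewrite expRN lef_pV2 // posrE expR_gt0 | ring].
by rewrite (_ : - - A + L = - (- A - L)); [rewrite expRN lef_pV2 // posrE expR_gt0 | ring].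
Qed.

Lemma ap_div L L' u p A B : ap L (u * p) A -> ap L' p B -> ap (L + L') u (A - B).
Proof.
move=> h h'; have := ap_mul h (ap_inv h'); rewrite mulfK //.
by rewrite gt_eqF // (ap_gt0 h').
Qed.

Let two : 2 <= expR 1 :> R.
Proof. by have := expR_ge1Dx (1 : R); lra. Qed.

(** The sum of two terms is at most twice the larger one, and [2 <= expR 1]. *)
Lemma ap_add L p q A B m : ap L p A -> ap L q B -> ismin m A B -> ap (L + 1) (p + q) m.
Proof.
move=> hp hq hm; have p0 := ap_gt0 hp; have q0 := ap_gt0 hq.
move: hp hq => /andP[h1 h2] /andP[h3 h4].
have e1 : expR (- m - (L + 1)) <= expR (- m - L) by rewrite ler_expR; lra.
have e2 : expR (- m + (L + 1)) = expR (- m + L) * expR 1 by rewrite -expRD; congr expR; ring.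
have e3 : expR (- m + L) * 2 <= expR (- m + (L + 1)).
  by rewrite e2 ler_wpM2l // expR_ge0.
have e4 : expR (- A + L) <= expR (- m + L) by rewrite ler_expR; move: hm; rewrite /ismin; lra.
have e5 : expR (- B + L) <= expR (- m + L) by rewrite ler_expR; move: hm; rewrite /ismin; lra.
apply/andP; split; last by lra.
case: hm => -[_ em]; rewrite -em in h1 h3 *; lra.
Qed.

(** The gap makes [q] at most half of the lower bound for [p], so half of that bound survives the
    subtraction. *)
Lemma ap_sub L p q A B : 0 <= L -> ap L p A -> ap L q B -> A + 2 * L + 1 <= B ->
  ap (L + 1) (p - q) A.
Proof.
move=> L0 hp hq hAB; have q0 := ap_gt0 hq.
move: hp hq => /andP[h1 h2] /andP[h3 h4].
have e2 : expR (- A - L) = expR (- A - (L + 1)) * expR 1 by rewrite -expRD; congr expR; ring.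
have e3 : expR (- A - (L + 1)) * 2 <= expR (- A - L).
  by rewrite e2 ler_wpM2l // expR_ge0.
have e4 : expR (- B + L) <= expR (- A - (L + 1)) by rewrite ler_expR; lra.
have e5 : expR (- A + L) <= expR (- A + (L + 1)) by rewrite ler_expR; lra.
by apply/andP; split; lra.
Qed.

Lemma ap_uniq L L' p A B : ap L p A -> ap L' p B -> `|A - B| <= L + L'.
Proof.
move=> /andP[h1 h2] /andP[h3 h4].
have := le_trans h1 h4; have := le_trans h3 h2; rewrite !ler_expR ler_norml.
by move=> ? ?; apply/andP; split; lra.
Qed.

End Approximation.

Lemma fin_bound (R : realType) (T : finType) (P : T -> R -> Prop) :
  (forall t r r', r <= r' -> P t r -> P t r') -> (forall t, exists r, P t r) ->
  exists r, forall t, P t r.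
Proof.
move=> mono H; suff: exists r, forall t, t \in enum T -> P t r.
  by move=> [r hr]; exists r => t; apply: hr; rewrite mem_enum.
elim: (enum T) => [|t s [r hr]]; first by exists 0.
have [r' hr'] := H t; exists (Num.max r r') => u; rewrite inE => /orP[/eqP ->|us].
  by apply: mono hr'; rewrite le_max lexx orbT.
by apply: mono (hr u us); rewrite le_max lexx.
Qed.

Section Realisations.
Variables (R : realType) (I : finType) (sg : I -> I -> I -> bool).
Hypothesis chi : chirotope sg.
Implicit Types (G : I -> pt R) (X : I -> I -> I -> R) (V : {set I}).

Definition sz b (r : R) := if b then r else - r.

Definition sdet G a b c := sz (sg a b c) (det3 (G a) (G b) (G c)).

Lemma szN b r : sz (~~ b) (- r) = sz b r.
Proof. by case: b; rewrite /= ?opprK. Qed.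

Lemma sdet_sym G : sym3 (sdet G).
Proof.
have d0 p q r : ~~ uniq [:: p; q; r] -> det3 (G p) (G q) (G r) = 0.
  rewrite /= !inE negb_and negb_or !negb_and !negbK orbF.
  by move=> /orP[/orP[]|] /eqP ->; rewrite /det3; ring.
have sz0 b : sz b 0 = 0 by case: b; rewrite /= ?oppr0.
split=> a b c; rewrite /sdet; have [u|u] := boolP (uniq [:: a; b; c]).
- by rewrite (sgl chi u) det3_swapl szN.
- by rewrite !d0 ?sz0 //; apply: contra u => u; dcase u; dsplit.
- by rewrite (sgr chi u) det3_swapr szN.
- by rewrite !d0 ?sz0 //; apply: contra u => u; dcase u; dsplit.
Qed.

Lemma sdet_special G p a b c d : uniq [:: p; a; b; c; d] -> special sg p a b c d ->
  sdet G p a b * sdet G p c d = sdet G p a c * sdet G p b d + sdet G p a d * sdet G p b c.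
Proof.
move=> u; have := sg3 chi u; rewrite /special /sdet.
rewrite (sgr chi (a := p) (b := b) (c := d)); last by dcase u; dsplit.
have := plucker3 (G p) (G a) (G b) (G c) (G d); rewrite (det3_swapr _ (G b) (G d)).
move: (det3 _ _ _) (det3 _ _ _) (det3 _ _ _) (det3 _ _ _) (det3 _ _ _) (det3 _ _ _).
move=> r1 r2 r3 r4 r5 r6 rel.
case: (sg p a b); case: (sg p a c); case: (sg p a d); case: (sg p b c);
   case: (sg p b d); case: (sg p c d) => //= h _; try (by case: h); rewrite ?mulrNN ?mulrN ?mulNr; lra.
Qed.

Definition realises V L X G :=
  forall a b c, distinct V [:: a; b; c] -> ap L (sdet G a b c) (X a b c).

(** One error bound for all points, so that it becomes negligible on large multiples of a point. *)
Definition realisable_TD V :=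
  exists2 L, 0 <= L & forall X, TD sg V X -> exists G, realises V L X G.

Lemma sdet_neq0 V L X G a b c : realises V L X G -> distinct V [:: a; b; c] ->
  det3 (G a) (G b) (G c) != 0.
Proof.
move=> H h; have := ap_gt0 (H a b c h); rewrite /sdet /sz.
by case: ifP => _ h'; apply/eqP => h0; rewrite h0 ?oppr0 ltxx in h'.
Qed.

(** With [v] a combination of [h1], [h2] and [g], the first two conditions fix the coefficients of
    [h2] and [h1] and do not see [g], whose coefficient then settles the third. *)
Lemma three_planes (g h1 h2 k1 k2 : pt R) t1 t2 t3 :
  det3 g h1 h2 != 0 -> det3 k1 k2 g != 0 ->
  exists v, [/\ det3 g h1 v = t1, det3 g h2 v = t2 & det3 k1 k2 v = t3].
Proof.
move=> n1 n2; pose m2 := t1 / det3 g h1 h2; pose m1 := - t2 / det3 g h1 h2.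
pose s := (t3 - m1 * det3 k1 k2 h1 - m2 * det3 k1 k2 h2) / det3 k1 k2 g.
pose v : pt R := (m1 * h1.1.1 + m2 * h2.1.1 + s * g.1.1, m1 * h1.1.2 + m2 * h2.1.2 + s * g.1.2,
  m1 * h1.2 + m2 * h2.2 + s * g.2).
have lin u w : det3 u w v = m1 * det3 u w h1 + m2 * det3 u w h2 + s * det3 u w g.
  by rewrite /det3 /v /=; ring.
have e1 : m2 * det3 g h1 h2 = t1 by rewrite divfK.
have e2 : m1 * det3 g h1 h2 = - t2 by rewrite divfK.
have e3 : s * det3 k1 k2 g = t3 - m1 * det3 k1 k2 h1 - m2 * det3 k1 k2 h2 by rewrite divfK.
exists v; rewrite !lin; split.
- rewrite (_ : det3 g h1 h1 = 0); last by rewrite /det3; ring.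
  by rewrite (_ : det3 g h1 g = 0) ?e1; [ring | rewrite /det3; ring].
- rewrite (_ : det3 g h2 h2 = 0); last by rewrite /det3; ring.
  rewrite (_ : det3 g h2 g = 0); last by rewrite /det3; ring.
  by rewrite det3_swapr mulrN e2; ring.
- by rewrite e3; ring.
Qed.

Definition upd G e v : I -> pt R := fun b => if b == e then v else G b.

Lemma upd_e G e v : upd G e v e = v.
Proof. by rewrite /upd eqxx. Qed.

Lemma upd_ne G e v b : b != e -> upd G e v b = G b.
Proof. by rewrite /upd => /negPf ->. Qed.

Lemma sz_ap b (A : R) : ap 0 (sz b (sz b (expR (- A)))) A.
Proof. by case: b; rewrite /= ?opprK; exact: ap_exp. Qed.

Variables (V : {set I}) (e : I).
Hypothesis eV : e \in V.
Local Notation dst := (distinct V).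

Lemma realises_upd L X G v : realises (V :\ e) L X G ->
  forall a b c, dst [:: e; a; b; c] -> ap L (sdet (upd G e v) a b c) (X a b c).
Proof.
move=> H a b c h; rewrite /sdet !upd_ne; try by dcase h; dsplit.
by apply: H; rewrite distinctD1.
Qed.

Lemma extend3 L X G a b1 b2 b c : realises (V :\ e) L X G ->
  dst [:: e; a; b1; b2] -> dst [:: e; a; b; c] -> exists v,
  [/\ ap 0 (sdet (upd G e v) a b1 e) (X a b1 e), ap 0 (sdet (upd G e v) a b2 e) (X a b2 e)
    & ap 0 (sdet (upd G e v) b c e) (X b c e)].
Proof.
move=> H h h'; have n1 : det3 (G a) (G b1) (G b2) != 0.
  by apply: (sdet_neq0 H); rewrite distinctD1.
have n2 : det3 (G b) (G c) (G a) != 0.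
  by apply: (sdet_neq0 H); rewrite distinctD1 //; dcase h'; dsplit.
have [v [e1 e2 e3]] := three_planes (sz (sg a b1 e) (expR (- X a b1 e)))
  (sz (sg a b2 e) (expR (- X a b2 e))) (sz (sg b c e) (expR (- X b c e))) n1 n2.
exists v; rewrite /sdet upd_e !upd_ne; try by dcase h; dcase h'; dsplit.
by rewrite e1 e2 e3; split; exact: sz_ap.
Qed.

(* The unknown factor of a three-term relation is controlled by the others,
   when it belongs to the special product, or when one product dominates. *)
Lemma step_special L G p a b c d Xab Xcd Xac Xbd Xad Xbc : dst [:: p; a; b; c; d] ->
  special sg p a b c d -> ismin (Xab + Xcd) (Xac + Xbd) (Xad + Xbc) ->
  ap L (sdet G p c d) Xcd -> ap L (sdet G p a c) Xac -> ap L (sdet G p b d) Xbd ->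
  ap L (sdet G p a d) Xad -> ap L (sdet G p b c) Xbc -> ap (3 * L + 1) (sdet G p a b) Xab.
Proof.
move=> /andP[u _] sp hm h1 h2 h3 h4 h5.
have e1 := sdet_special G u sp.
have := ap_add (ap_mul h2 h3) (ap_mul h4 h5) hm; rewrite -e1 => /ap_div/(_ h1).
by rewrite addrK; apply: ap_le; lra.
Qed.

Lemma step_dominated L G p a b c d Xab Xcd Xac Xbd Xad Xbc : 0 <= L -> dst [:: p; a; b; c; d] ->
  Xab + Xcd = Xac + Xbd -> Xab + Xcd + 4 * L + 1 <= Xad + Xbc ->
  ~~ special sg p a d b c ->
  ap L (sdet G p c d) Xcd -> ap L (sdet G p a c) Xac -> ap L (sdet G p b d) Xbd ->
  ap L (sdet G p a d) Xad -> ap L (sdet G p b c) Xbc -> ap (3 * L + 1) (sdet G p a b) Xab.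
Proof.
move=> L0 /andP[u _] eX gap nsp h1 h2 h3 h4 h5.
have LL : 0 <= L + L by lra.
have hB := ap_mul h2 h3; have hC := ap_mul h4 h5.
have := special_ex chi u; rewrite (negPf nsp) orbF => /orP[sp|sp].
  have := ap_add hB hC (m := Xab + Xcd); rewrite -(sdet_special G u sp).
  have mn : ismin (Xab + Xcd) (Xac + Xbd) (Xad + Xbc) by left; split; lra.
  by move=> /(_ mn)/ap_div/(_ h1); rewrite addrK; apply: ap_le; lra.
have u' : uniq [:: p; a; c; b; d] by dcase u; dsplit.
have := sdet_special G u' sp; have [s1 s2] := sdet_sym G; rewrite (s2 p b c) => e1.
have gap' : Xac + Xbd + 2 * (L + L) + 1 <= Xad + Xbc by lra.
have := ap_sub LL hB hC gap'; rewrite e1 addrK => /ap_div/(_ h1).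
by rewrite -eX addrK; apply: ap_le; lra.
Qed.

End Realisations.

Section PencilExtension.
Variables (R : realType) (I : finType) (sg : I -> I -> I -> bool).
Hypothesis chi : chirotope sg.
Variables (V : {set I}) (e : I).
Hypothesis eV : e \in V.
Local Notation dst := (distinct V).
Local Notation lw := (lo sg e).

Lemma lo_extremes a b c : dst [:: e; a; b; c] -> exists b0 d0, [/\ dst [:: e; a; b0; d0],
  forall c, dst [:: e; a; b0; c] -> lw a b0 c & forall c, dst [:: e; a; c; d0] -> lw a c d0].
Proof.
move=> h; pose P b := dst [:: e; a; b].
(* The first and the last element of the order have the most and the fewest successors. *)
pose cnt b := #|[set c | dst [:: e; a; b; c] && lw a b c]|.
have hb : P b by rewrite /P; dcase h; dsplit.
have lt u v : dst [:: e; a; u; v] -> lw a u v -> (cnt v < cnt u)%N.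
  move=> huv l; apply: proper_card; apply/properP; split.
    apply/fintype.subsetP => w; rewrite !inE => /andP[hw lw]; dcase huv; dcase hw.
    have uw : u != w.
      by apply/eqP => uw; subst w; have := lo_anti chi huv; rewrite lw l.
    by apply/andP; split; [dsplit | apply: (lo_trans chi _ l lw); dsplit].
  exists v; first by rewrite inE huv.
  by rewrite inE; apply/negP => /andP[hv _]; dcase hv; dsub.
have [b0 hb0 mx] := @arg_maxnP _ b P cnt hb.
have [d0 hd0 mn] := @arg_minnP _ b P cnt hb.
have H1 w : dst [:: e; a; b0; w] -> lw a b0 w.
  move=> hw; apply: contraT => nl.
  have hw' : dst [:: e; a; w; b0] by dcase hw; dsplit.
  have := lt w b0 hw'; rewrite (lo_anti chi hw) => /(_ nl).
  have hP : P w by rewrite /P; dcase hw; dsplit.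
  by move=> lt'; have := mx w hP; rewrite /= leqNgt lt'.
have H2 w : dst [:: e; a; w; d0] -> lw a w d0.
  move=> hw; apply: contraT => nl.
  have hw' : dst [:: e; a; d0; w] by dcase hw; dsplit.
  have := lt d0 w hw'; rewrite (lo_anti chi hw) => /(_ nl).
  have hP : P w by rewrite /P; dcase hw; dsplit.
  by move=> lt'; have := mn w hP; rewrite /= leqNgt lt'.
exists b0, d0; split=> //; rewrite /P in hb0 hd0; dcase hb0; dcase hd0; dcase h.
suff : b0 != d0 by move=> ?; dsplit.
apply/eqP => eb; subst d0.
have [eb|nb] := eqVneq b0 b.
  subst b; have k1 := H1 c h; have : dst [:: e; a; c; b0] by dsplit.
  by move=> /H2; rewrite (lo_anti chi h) k1.
have h' : dst [:: e; a; b0; b] by dsplit.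
have k1 := H1 b h'; have : dst [:: e; a; b; b0] by dsplit.
by move=> /H2; rewrite (lo_anti chi h') k1.
Qed.

(** The brackets with the two extreme elements of the pencil at [a] are prescribed. Any other [d]
    lies between these, so its bracket is a factor of the isolated product, which is a sum of two
    positive products. *)
Lemma pencil_extend L (X : I -> I -> I -> R) G a b c : 0 <= L -> TD sg V X ->
  realises sg (V :\ e) L X G -> dst [:: e; a; b; c] ->
  exists v, forall d, dst [:: e; a; d] -> ap (3 * L + 1) (sdet sg (upd G e v) a d e) (X a d e).
Proof.
move=> L0 xTD H h; have [b0 [d0 [h0 H1 H2]]] := lo_extremes h.
have h1 : dst [:: e; a; b0; d0] by [].
(* The third bracket is irrelevant: it only fixes the position of the new point on its line with
   [a]. *)
have [v [k1 k2 _]] := extend3 eV H h1 h1.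
exists v => d hd; have [Xs Xr] := xTD; have Ss := sdet_sym chi (upd G e v).
have [->|db] := eqVneq d b0; first by apply: ap_le k1; lra.
have [->|dd] := eqVneq d d0; first by apply: ap_le k2; lra.
dcase h0; dcase hd.
have l1 : lw a b0 d by apply: H1; dsplit.
have l2 : lw a d d0 by apply: H2; dsplit.
have h4 : dst [:: e; a; b0; d; d0] by dsplit.
have sp := lo_special chi h4 l1 l2.
have h5 : dst [:: a; e; d; b0; d0] by dsplit.
have K := realises_upd eV v H.
have g1 : ap L (sdet sg (upd G e v) a d d0) (X a d d0) by apply: K; dsplit.
have g2 : ap L (sdet sg (upd G e v) a b0 d0) (X a b0 d0) by apply: K; dsplit.
have g3 : ap L (sdet sg (upd G e v) a d b0) (X a d b0) by apply: K; dsplit.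
have g4 : ap L (sdet sg (upd G e v) a e b0) (X a e b0).
  by case: Xs Ss => _ -> [_ ->]; apply: ap_le k1.
have g5 : ap L (sdet sg (upd G e v) a e d0) (X a e d0).
  by case: Xs Ss => _ -> [_ ->]; apply: ap_le k2.
have := step_special chi h5 sp (Xr _ _ _ _ _ h5 sp) g2 g4 g1 g5 g3.
by case: Xs Ss => _ -> [_ ->].
Qed.

End PencilExtension.

(** * Sliding [e] along its line with [a] *)

Section Peak.
Variables (R : realType) (I : finType) (sg : I -> I -> I -> bool).
Hypothesis chi : chirotope sg.
Variables (V : {set I}) (e : I) (x : I -> I -> I -> R).
Hypothesis eV : e \in V.
Hypothesis xTD : TD sg V x.
Local Notation dst := (distinct V).
Local Notation fib := (fib sg V e x).
Local Notation lw := (lo sg e).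
Local Notation sb := (sb V e x).
Local Notation dl := (del e x).
Variables (a : I) (N : I -> I -> bool).
Hypothesis NC : forall b c, N b c -> N c b.
Hypothesis Nd : forall b c, N b c -> dst [:: e; a; b; c].
Hypothesis N_out : forall v b c, dst [:: e; v; a; b; c] ->
  N v b -> sb v a b -> ~~ sb v a c -> N v c.
Hypothesis N_sb : forall v b c, dst [:: e; v; a; b; c] ->
  N v b -> ~~ sb v a b -> sb v b c -> N v c.
Hypothesis N_lo : forall v c d, dst [:: e; v; a; c; d] ->
  N v c -> lw v a c = lw v c d -> lw v a c = lw v a d -> N v d.

(** The expected exponent of the displacement of [e] along its line with [a] that takes it to the
    line [v b]. Peaks have the largest exponent, hence belong to the closest lines; [N] selects the
    lines that are considered. *)
Definition tau v b := x v b e - x a v b.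

Definition peaks v b := N v b && [forall p, N p.1 p.2 ==> (tau p.1 p.2 <= tau v b)].

(** The sign which [sg] predicts for [H v b] in [peak_fib], that is, the direction of the
    displacement. *)
Definition side v b := lw v a b (+) sg v e a.

Lemma tauC v b : tau v b = tau b v.
Proof. by rewrite /tau; case: xTD => -[s1 s2] _; rewrite (s1 v b) (s2 a v b). Qed.

Lemma peaksC v b : peaks v b -> peaks b v.
Proof.
move=> /andP[h1 /forallP h2]; apply/andP; split; first exact: NC.
by apply/forallP => p; rewrite (tauC b v).
Qed.

Lemma peaks_le v b v' b' : peaks v b -> N v' b' -> tau v' b' <= tau v b.
Proof. by move=> /andP[_ /forallP /(_ (v', b'))] /= /implyP. Qed.

Lemma peaks_eq v b v' b' : peaks v b -> tau v' b' = tau v b -> N v' b' -> peaks v' b'.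
Proof. by move=> /andP[_ h] h' n; rewrite /peaks n h' h. Qed.

Lemma peaks_tau v b v' b' : peaks v b -> peaks v' b' -> tau v b = tau v' b'.
Proof.
move=> h h'; apply/eqP; rewrite eq_le; apply/andP; split.
  by apply: peaks_le h' _; case/andP: h.
by apply: peaks_le h _; case/andP: h'.
Qed.

Lemma del_tau v b : dl v a b = - tau v b - x v a e.
Proof. by rewrite /del /tau; case: xTD => -[s1 s2] _; rewrite (s1 v a); lra. Qed.

(** If [b] were in the branch of [a] at [v], an element of another branch would give a smaller
    [del], that is, a larger [tau], without leaving [N]. *)
Lemma peaks_nsb v b : peaks v b -> ~~ sb v a b.
Proof.
move=> hp; have /andP[n _] := hp; have h := Nd n; apply/negP => hs; dcase h.
have h1 : dst [:: e; v; a; b] by dsplit.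
have [c hc nc] := nsb_ex x h1; dcase hc.
have bc : b != c by apply: contraNneq nc => <-.
have h2 : dst [:: e; v; a; b; c] by dsplit.
have [lt _] := sb_lt chi xTD h2 hs nc.
have := peaks_le hp (N_out h2 n hs nc).
by move: lt; rewrite !del_tau; lra.
Qed.

Lemma sideC v b : dst [:: e; a; v; b] -> side v b = side b v.
Proof.
move=> h; dcase h; rewrite /side /lo.
have := @sgp _ _ chi a v b ltac:(dsplit); have := @sgp _ _ chi e a v ltac:(dsplit).
have := @sgp _ _ chi e a b ltac:(dsplit); have := @sgp _ _ chi e v b ltac:(dsplit).
move=> E1 E2 E3 E4; rewrite !E1 !E2 !E3 !E4.
by case: (sg a v b); case: (sg e a v); case: (sg e a b); case: (sg e v b).
Qed.

Lemma peaks_sb v b c : dst [:: e; v; b; c] -> peaks v b -> sb v b c ->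
  [/\ peaks v c, side v c = side v b & dst [:: e; v; a; b; c]].
Proof.
move=> h hp hs; have nsb := peaks_nsb hp; have /andP[n _] := hp.
have h1 := Nd n; dcase h; dcase h1.
have ac : a != c.
  apply: contraNneq nsb => ->; rewrite (sbC chi xTD) //; dsplit.
have h2 : dst [:: e; v; a; b; c] by dsplit.
have h3 : dst [:: e; v; b; c; a] by dsplit.
have nba : ~~ sb v b a by rewrite (sbC chi xTD) //; dsplit.
have [_ e1] := sb_lt chi xTD h3 hs nba.
have e2 : tau v c = tau v b.
  by move: e1; rewrite !(delC e xTD v _ a) !del_tau; lra.
split=> //; first by apply: (peaks_eq hp e2); apply: N_sb h2 n nsb hs.
rewrite /side; congr (_ (+) _).
have I1 u w : dst [:: e; v; u; a; w] -> lw v u a -> lw v a w -> sb v u w -> sb v u a.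
  by move=> hh l1 l2 /(sb_interval chi xTD hh l1 l2)/andP[].
have nca : ~~ sb v c a.
  by apply: contra nba => h4; apply: (sb_trans chi xTD h3).
have hsc : sb v c b by rewrite (sbC chi xTD) //; dsplit.
have d1 : dst [:: e; v; a; b] by dsplit.
have d2 : dst [:: e; v; a; c] by dsplit.
case lb: (lw v a b); case lc: (lw v a c) => //; exfalso.
  by move/negP: nca; apply; apply: I1 hsc; [dsplit | rewrite (lo_anti chi d2) lc | ].
by move/negP: nba; apply; apply: I1 hs; [dsplit | rewrite (lo_anti chi d1) lb | ].
Qed.

Lemma peaks_lo v c d : dst [:: e; v; a; c; d] -> peaks v c -> ~~ sb v c d ->
  lw v a c = lw v c d -> [/\ peaks v d, side v d = side v c & lw v a d = lw v a c].
Proof.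
move=> h hp nsb l1; have /andP[n _] := hp; have na := peaks_nsb hp; dcase h.
have d1 : dst [:: e; v; a; c] by dsplit.
have d2 : dst [:: e; v; c; d] by dsplit.
have d3 : dst [:: e; v; a; d] by dsplit.
have [l2 nd] : lw v a d = lw v a c /\ ~~ sb v a d.
  case l: (lw v a c) l1 => /esym l1.
    have l2 : lw v a d by apply: (lo_trans chi h l l1).
    by split=> //; apply: contra na => /(sb_interval chi xTD h l l1)/andP[].
  have h' : dst [:: e; v; d; c; a] by dsplit.
  have k1 : lw v d c by rewrite (lo_anti chi d2) l1.
  have k2 : lw v c a by rewrite (lo_anti chi d1) l.
  have k3 := lo_trans chi h' k1 k2.
  have l2 : lw v a d = false by rewrite (@lo_anti _ _ chi V e v d a) ?k3 //; dsplit.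
  split=> //; apply: contra na; rewrite (sbC chi xTD d3) (sbC chi xTD d1).
  by move=> /(sb_interval chi xTD h' k1 k2)/andP[].
have e1 := nsb_del chi xTD d1 d3 na nd.
split=> //; last by rewrite /side l2.
apply: (peaks_eq hp); last by apply: (N_lo h).
by move: e1; rewrite !del_tau; lra.
Qed.

Lemma del_gap : exists2 g, 0 < g & forall v b c f d, dl v b c < dl v f d ->
  g <= dl v f d - dl v b c.
Proof.
pose P (p : I * (I * I) * (I * I)) (r : R) := 0 < r /\
   (dl p.1.1 p.1.2.1 p.1.2.2 < dl p.1.1 p.2.1 p.2.2 ->
    r^-1 <= dl p.1.1 p.2.1 p.2.2 - dl p.1.1 p.1.2.1 p.1.2.2).
have P1 p r r' : r <= r' -> P p r -> P p r'.
  move=> le [r0 h]; have r'0 := lt_le_trans r0 le; split=> // /h; apply: le_trans.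
  by rewrite lef_pV2.
have P2 p : exists r, P p r.
  have [lt|le] := boolP (dl p.1.1 p.1.2.1 p.1.2.2 < dl p.1.1 p.2.1 p.2.2).
    exists (dl p.1.1 p.2.1 p.2.2 - dl p.1.1 p.1.2.1 p.1.2.2)^-1.
    by rewrite /P invr_gt0 subr_gt0 lt invrK.
  by exists 1; rewrite /P (negPf le).
have [r hr] := fin_bound P1 P2.
have [r0 _] := hr (a, (a, a), (a, a)); exists r^-1; first by rewrite invr_gt0.
by move=> v b c f d; have [_] := hr (v, (b, c), (f, d)).
Qed.

(** Realise a large multiple of [x] without [e], and put [e] back up to its position on a line with
    [a]. Among the peaks on side [th], [U] is the cluster of those whose lines are met first. Pairs
    sharing an element cross this line close together when their other elements are in one branch,
    and far apart otherwise; this makes the indicator of [U] satisfy [fibb]. *)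
Lemma peak_fib th v1 b1 : realisable_TD R sg (V :\ e) -> peaks v1 b1 -> side v1 b1 = th ->
  exists U : I -> I -> bool, [/\ forall v b, U v b -> peaks v b /\ side v b = th,
    exists v b, U v b & fib (fun v b => (U v b)%:R)].
Proof.
move=> [L L0 HL] pk1 sd1; have [g g0 Hg] := del_gap.
have [xs xr] := xTD.
(* [L2] is the error of [pencil_extend] for brackets with [a] and [e], and [L3] that of a quotient
   of one such bracket and three brackets without [e]. *)
pose L2 := 3 * L + 1; pose L3 := 3 * L + L2.
have L2_0 : 0 <= L2 by rewrite /L2; lra.
have L3_0 : 0 <= L3 by rewrite /L3; lra.
pose K : R := #|{: I * I}|%:R; have K0 : 0 <= K by rewrite ler0n.
(* With this [lam], [big] is [expR (K + 1)] times [tiny], so a chain of at most [K] tiny changes of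
   [z] stays below one big change. *)
pose sigma := tau v1 b1; pose lam := (2 * L3 + K + 1) / g.
have lamg : lam * g = 2 * L3 + K + 1 by rewrite divfK // gt_eqF.
have lam0 : 0 <= lam by rewrite divr_ge0 // ?ltW //; lra.
pose X p q r := lam * x p q r.
have XTD : TD sg V X.
  split; first by case: xs => s1 s2; split=> p q r; [rewrite /X s1 | rewrite /X s2].
  by move=> p q r s t h sp; rewrite /X -!mulrDr; apply: isminZ => //; apply: xr.
have XTD' : TD sg (V :\ e) X.
  case: XTD => Xs Xr; split=> // p q r s t; rewrite distinctD1 // => h; apply: Xr.
  by dcase h; dsplit.
have [G HG] := HL X XTD'.
have h1 : dst [:: e; a; v1; b1] by apply: Nd; case/andP: pk1.
have [nu Hnu] := pencil_extend chi eV L0 XTD HG h1.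
have := realises_upd eV nu HG; move: Hnu; rewrite -/L2; set G' := upd G e nu => Hnu HG'.
pose S := sdet sg G'; have Ss : sym3 S := sdet_sym chi G'.
(* Adding [s] times the vector of [a] to that of [e] adds [s] to all values of [H]. So [- H v b] is
   the parameter at which [e] reaches the line [v b]. *)
pose H v b := det3 (G' v) (G' b) (G' e) / det3 (G' a) (G' v) (G' b).
have HC v b : H v b = H b v.
  by rewrite /H det3_swapl (det3_swapr (G' a)) invrN mulrNN.
have nz v b c : dst [:: e; v; b; c] -> det3 (G' v) (G' b) (G' c) != 0.
  by move=> h; have := HG' v b c h => /ap_gt0; rewrite /sdet /sz; case: ifP => _ h';
    apply/eqP => h0; rewrite h0 ?oppr0 ltxx in h'.
(* The three-term relation at [v] eliminates the brackets of [e] without [a], which are not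
   controlled by the construction. *)
have Hdiff v b c : dst [:: e; v; a; b; c] -> H v c - H v b =
    det3 (G' v) (G' a) (G' e) * det3 (G' v) (G' b) (G' c) /
    (det3 (G' v) (G' a) (G' b) * det3 (G' v) (G' a) (G' c)).
  move=> h; dcase h; rewrite /H !(det3_swapl (G' v) (G' a)).
  have nb : det3 (G' v) (G' a) (G' b) != 0 by apply: nz; dsplit.
  have nc : det3 (G' v) (G' a) (G' c) != 0 by apply: nz; dsplit.
  have := plucker3 (G' v) (G' a) (G' b) (G' c) (G' e).
  rewrite (det3_swapr (G' v) (G' b) (G' e)) => rel.
  have -> : det3 (G' v) (G' a) (G' e) * det3 (G' v) (G' b) (G' c) =
    det3 (G' v) (G' a) (G' c) * det3 (G' v) (G' b) (G' e)
    - det3 (G' v) (G' a) (G' b) * det3 (G' v) (G' c) (G' e) by lra.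
  by field; rewrite nb nc.
pose bits v b c := ~~ (sg v a e (+) sg v b c (+) sg v a b (+) sg v a c).
have HS v b c : dst [:: e; v; a; b; c] -> sz (bits v b c) (H v c - H v b) =
    S v a e * S v b c / (S v a b * S v a c).
  move=> h; rewrite (Hdiff v b c h) /S /sdet /bits.
  by case: (sg v a e); case: (sg v b c); case: (sg v a b); case: (sg v a c);
    rewrite /= ?mulrNN ?mulrN ?mulNr ?invrN ?mulrNN ?mulrN ?mulNr ?opprK.
have Hap v b c : dst [:: e; v; a; b; c] -> peaks v b -> peaks v c ->
    ap L3 (S v a e * S v b c / (S v a b * S v a c)) (lam * (sigma + (dl v b c - dl v a b))).
  move=> h pb pc; dcase h.
  have k1 : ap L2 (S v a e) (X v a e).
    have := Hnu v ltac:(dsplit); rewrite -/S; case: Ss xs => s1 _ [s2 _].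
    by rewrite s1 /X s2.
  have k2 : ap L (S v b c) (X v b c) by apply: HG'; dsplit.
  have k3 : ap L (S v a b) (X v a b) by apply: HG'; dsplit.
  have k4 : ap L (S v a c) (X v a c) by apply: HG'; dsplit.
  have := ap_mul (ap_mul k1 k2) (ap_inv (ap_mul k3 k4)).
  have -> : L2 + L + (L + L) = L3 by rewrite /L3; ring.
  suff -> : X v a e + X v b c + - (X v a b + X v a c) = lam * (sigma + (dl v b c - dl v a b)) by [].
  rewrite /X /sigma (peaks_tau pk1 pc) /del /tau; case: xs => s1 s2.
  by rewrite (s1 v a c); ring.
(* The sign is chosen so that a larger [z] means that the line is met earlier. *)
pose z v b := sz (~~ th) (H v b).
have zC v b : z v b = z b v by rewrite /z HC.
have zdiff v b c : `|z v c - z v b| = `|sz (bits v b c) (H v c - H v b)|.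
  rewrite /z; case: (th); case: (bits _ _ _); rewrite /= ?opprB ?opprK //.
  - by rewrite addrC distrC.
  - by rewrite addrC.
  - by rewrite distrC.
pose big := expR (- (lam * sigma) - L3); pose tiny := expR (- (lam * sigma) - lam * g + L3).
have tiny0 : 0 < tiny by exact: expR_gt0.
have big0 : 0 < big by exact: expR_gt0.
have Kt : K * tiny < big.
  have -> : big = expR (K + 1) * tiny by rewrite -expRD lamg /big; congr expR; ring.
  by rewrite ltr_pM2r //; have := expR_ge1Dx (K + 1); lra.
have z_sb v b c : dst [:: e; v; b; c] -> peaks v b -> sb v b c -> `|z v c - z v b| <= tiny.
  move=> h pb hs; have [pc _ h2] := peaks_sb h pb hs; rewrite zdiff HS //.
  have := Hap v b c h2 pb pc; set q := _ / _ => hq; rewrite ger0_norm ?(ltW (ap_gt0 hq)) //.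
  have /andP[_] := hq => /le_trans; apply; rewrite ler_expR.
  have h3 : dst [:: e; v; b; c; a] by dcase h2; dsplit.
  have nba : ~~ sb v b a by rewrite (sbC chi xTD) ?(peaks_nsb pb) //; dcase h2; dsplit.
  have [lt _] := sb_lt chi xTD h3 hs nba; rewrite (delC e xTD) in lt.
  by have := ler_wpM2l lam0 (Hg _ _ _ _ _ lt); lra.
have z_nsb v b c : dst [:: e; v; a; b; c] -> peaks v b -> peaks v c -> ~~ sb v b c ->
    big <= `|z v c - z v b|.
  move=> h pb pc ns; rewrite zdiff HS //; have := Hap v b c h pb pc.
  rewrite (@nsb_del _ _ _ chi _ _ _ xTD v b c a b) ?peaks_nsb //; try by dcase h; dsplit.
  rewrite subrr addr0; set q := _ / _ => hq; rewrite ger0_norm ?(ltW (ap_gt0 hq)) //.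
  by case/andP: hq.
have z_up v c d : dst [:: e; v; a; c; d] -> peaks v c -> side v c = th -> ~~ sb v c d ->
    lw v a c = lw v c d -> [/\ peaks v d, side v d = th & z v c + big <= z v d].
  move=> h pc sc ns l1; have [pd sd l2] := peaks_lo h pc ns l1.
  split=> //; first by rewrite sd.
  have := z_nsb v c d h pc pd ns.
  suff : 0 < z v d - z v c by move=> h0; rewrite ger0_norm ?(ltW h0) //; lra.
  have -> : z v d - z v c = sz (bits v c d) (H v d - H v c); last first.
    by rewrite HS //; apply: ap_gt0 (Hap v c d h pc pd).
  rewrite /z /bits -sc /side; dcase h.
  have -> : sg v a e = ~~ sg v e a by apply: (sgr chi); dsplit.
  move: l1 l2; rewrite /lo; case: (sg v a c); case: (sg v e a); case: (sg v e c);
    case: (sg v e d); case: (sg v a d); case: (sg v c d) => //= _ _; by rewrite ?opprB ?opprK // addrC.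
pose P (p : I * I) := peaks p.1 p.2 && (side p.1 p.2 == th).
have P1 : P (v1, b1) by rewrite /P pk1 sd1 eqxx.
have [m Pm mx] := @arg_maxP _ R _ (v1, b1) P (fun p => z p.1 p.2) P1.
(* Exchanging the two elements, or replacing one inside its branch, changes [z] by at most [tiny];
   [U] is what such moves reach from the maximum of [z]. *)
pose r (p q : I * I) := (q == (p.2, p.1)) ||
  [&& p.1 == q.1, dst [:: e; p.1; p.2; q.2] & sb p.1 p.2 q.2].
pose U v b := connect r m (v, b).
have Pr p q : P p -> r p q -> P q /\ `|z q.1 q.2 - z p.1 p.2| <= tiny.
  case: p q => v b [v' c] /andP[/= pb /eqP sb'] /orP[/eqP [-> ->]|/and3P[/= /eqP <- h hs]].
    rewrite /P /= -(sideC (Nd _)); last by case/andP: pb.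
    by rewrite sb' eqxx peaksC // zC subrr normr0 ltW.
  have [pc sc _] := peaks_sb h pb hs; split; last exact: z_sb.
  by rewrite /P /= pc sc sb' eqxx.
have Ppath s p : P p -> path r p s -> P (last p s) /\
    `|z (last p s).1 (last p s).2 - z p.1 p.2| <= (size s)%:R * tiny.
  elim: s p => [|q s IH] p Pp /=; first by rewrite subrr normr0 mul0r.
  move=> /andP[pq hs]; have [Pq zq] := Pr _ _ Pp pq; have [Pl zl] := IH _ Pq hs.
  split=> //; rewrite -natr1 mulrDl mul1r.
  by have := ler_distD (z q.1 q.2) (z (last q s).1 (last q s).2) (z p.1 p.2); lra.
have UP v b : U v b -> [/\ peaks v b, side v b = th & z m.1 m.2 - z v b < big].
  move=> /connectP[s0 hs0 e0]; case/shortenP: hs0 e0 => s hs us _ es.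
  have [] := Ppath s m Pm hs; rewrite -es /= => /andP[p1 /eqP p2] hz; split=> //.
  have sK : (size s)%:R <= K.
    by rewrite ler_nat; have := max_card (mem (m :: s)); rewrite (card_uniqP us); apply: ltnW.
  have := ler_wpM2r (ltW tiny0) sK; have := ler_norm (- (z v b - z m.1 m.2)); rewrite normrN; lra.
have Us v b : U v b -> U b v.
  by move=> h; apply: connect_trans h _; apply: connect1; rewrite /r eqxx.
have Usb v b c : dst [:: e; v; b; c] -> sb v b c -> U v b -> U v c.
  by move=> h hs hU; apply: connect_trans hU _; apply: connect1; rewrite /r /= eqxx h hs orbT.
have Una v b : U v b -> dst [:: e; a; v; b] by move=> /UP[/andP[h _] _ _]; apply: Nd.
exists U; split.
- by move=> v b /UP[].
- by exists m.1, m.2; rewrite /U -surjective_pairing connect0.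
apply: (fibb_fib chi xTD); split.
- by move=> v b; congr (_%:R); congr nat_of_bool; apply/idP/idP; apply: Us.
- move=> v b c h hs; congr (_%:R); congr nat_of_bool; apply/idP/idP; apply: Usb => //.
    by dcase h; dsplit.
  by rewrite (sbC chi xTD) //; dcase h; dsplit.
- move=> v b c d h l1 l2 n1 n2.
  (* Otherwise one of the outer branches is further away from [a], and its [z] would exceed the
     maximum by [z_up]. *)
  have -> : U v c = false.
    apply/negP => hU; have [pc sc zc] := UP _ _ hU; have h' := Una _ _ hU; dcase h; dcase h'.
    have d1 : dst [:: e; v; a; c] by dsplit.
    have d2 : dst [:: e; v; b; c] by dsplit.
    have contra_up q : dst [:: e; v; a; c; q] -> ~~ sb v c q -> lw v a c = lw v c q -> False.
      move=> hq nq lq; have [pq sq zq] := z_up v c q hq pc sc nq lq.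
      by have := mx (v, q); rewrite /P /= pq sq eqxx => /(_ isT); lra.
    case l: (lw v a c).
      have ad : a != d.
        apply/eqP => ad; subst d; move: l; rewrite (@lo_anti _ _ chi V e v c a) ?l2 //; dsplit.
      by apply: (contra_up d) => //; [dsplit | rewrite l l2].
    have ab : a != b by apply/eqP => ab; subst b; rewrite l1 in l.
    apply: (contra_up b); [dsplit | by rewrite (sbC chi xTD) //; dsplit |].
    by rewrite l (lo_anti chi d2) l1.
  case Ub: (U v b); case Ud: (U v d); try by (left; split; rewrite ?lexx ?ler01).
    exfalso; have [pb sb' zb] := UP _ _ Ub; have [pd sd zd] := UP _ _ Ud.
    have h' := Una _ _ Ub; have h'' := Una _ _ Ud; dcase h; dcase h'; dcase h''.
    have nbd : ~~ sb v b d.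
      by apply: contra n1 => /(sb_interval chi xTD h l1 l2)/andP[].
    have hh : dst [:: e; v; a; b; d] by dsplit.
    have := z_nsb v b d hh pb pd nbd.
    have := mx (v, b); rewrite /P /= pb sb' eqxx => /(_ isT).
    have := mx (v, d); rewrite /P /= pd sd eqxx => /(_ isT) k1 k2.
    by rewrite ler_normr => /orP[]; lra.
  by right; split; rewrite ?lexx ?ler01.
Qed.

End Peak.

(** * Lines through [e] determined by three of them *)

Section Propagation.
Variables (R : realType) (I : finType) (sg : I -> I -> I -> bool).
Hypothesis chi : chirotope sg.
Variables (V : {set I}) (e : I) (x : I -> I -> I -> R).
Hypothesis eV : e \in V.
Hypothesis xTD : TD sg V x.
Hypothesis realV : realisable_TD R sg (V :\ e).
Local Notation dst := (distinct V).
Local Notation fib := (fib sg V e x).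
Local Notation flat := (flat V e x).
Local Notation lo := (lo sg e).
Local Notation sb := (sb V e x).
Local Notation col := (col V e x).
Local Notation fib_linear := (fib_linear sg V e x).

Lemma peaks_ex a (N : I -> I -> bool) p q : N p q -> exists v b, peaks e x a N v b.
Proof.
move=> h; pose P (p : I * I) := N p.1 p.2.
have [m Pm mx] := @arg_maxP _ R _ (p, q) P (fun p => tau e x a p.1 p.2) h.
exists m.1, m.2; rewrite /peaks; apply/andP; split=> //.
by apply/forallP => t; apply/implyP => /mx.
Qed.

(** Here [N] consists of all pairs avoiding [a]. If there are peaks on both sides, each side has its
    own cluster. If all are on one side, [e] can also recede from all of them at once, which
    decreases all their exponents equally. *)
Lemma vanishing_fib a p q : dst [:: e; a; p; q] -> exists U U' : I -> I -> bool,
  [/\ forall v b, U v b || U' v b -> dst [:: e; a; v; b],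
      (exists v b, U v b), (exists v b, U' v b), fib (fun v b => (U v b)%:R)
    & fib (fun v b => (U' v b)%:R) /\ (forall v b, ~~ (U v b && U' v b)) \/
      fib (fun v b => - (U' v b)%:R)].
Proof.
move=> h; pose N v b := dst [:: e; a; v; b].
have NC b c : N b c -> N c b by rewrite /N => h'; dcase h'; dsplit.
have Nd b c : N b c -> dst [:: e; a; b; c] by [].
have No v b c : dst [:: e; v; a; b; c] -> N v b -> sb v a b -> ~~ sb v a c -> N v c.
  by move=> h' *; rewrite /N; dcase h'; dsplit.
have Ns v b c : dst [:: e; v; a; b; c] -> N v b -> ~~ sb v a b -> sb v b c -> N v c.
  by move=> h' *; rewrite /N; dcase h'; dsplit.
have Nl v c d : dst [:: e; v; a; c; d] ->
  N v c -> lo v a c = lo v c d -> lo v a c = lo v a d -> N v d.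
  by move=> h' *; rewrite /N; dcase h'; dsplit.
have PF th v1 b1 := peak_fib chi eV xTD NC Nd No Ns Nl (th := th) (v1 := v1) (b1 := b1) realV.
have hN : N p q by [].
have [v1 [b1 pk1]] := peaks_ex a hN.
pose th := side sg e a v1 b1.
have [U [U1 U2 U3]] := PF th v1 b1 pk1 (erefl _).
have Ud v b : U v b -> dst [:: e; a; v; b] by move=> /U1[/andP[]].
have [[v2 [b2 [pk2 sd2]]]|all_th] := pselect (exists v b, peaks e x a N v b /\ side sg e a v b != th).
  have [U' [W1 W2 W3]] := PF _ v2 b2 pk2 (erefl _).
  exists U, U'; split=> //.
    by move=> v b /orP[/Ud//|/W1[/andP[]]].
  left; split=> // v b; apply/negP => /andP[/U1[_ s1] /W1[_ s2]].
  by rewrite -s1 -s2 eqxx in sd2.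
exists U, (peaks e x a N); split=> //.
- by move=> v b /orP[/Ud//|/andP[]].
- by exists v1, b1.
right; have {}all_th v b : peaks e x a N v b -> side sg e a v b = th.
  by move=> pk; have [//|ns] := eqVneq (side sg e a v b) th; case: all_th; exists v, b.
have pC v b : peaks e x a N v b = peaks e x a N b v.
  by apply/idP/idP; apply: (peaksC xTD).
have pNsb v b : peaks e x a N v b -> ~~ sb v a b by apply: (peaks_nsb chi xTD Nd).
have p_iff v b1' b2' : dst [:: e; v; a; b1'; b2'] -> peaks e x a N v b1' -> ~~ sb v a b2' ->
    peaks e x a N v b2'.
  move=> h' pk ns; apply: (peaks_eq pk); last by rewrite /N; dcase h'; dsplit.
  have := @nsb_del _ _ _ chi V e _ xTD v a b1' a b2'; rewrite !(del_tau _ xTD) => E.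
  have := E ltac:(dcase h'; dsplit) ltac:(dcase h'; dsplit) (pNsb _ _ pk) ns; lra.
apply: (fibb_fib chi xTD); split.
- by move=> v b; rewrite pC.
- move=> v b c h' hs; congr (- _%:R); congr nat_of_bool.
  have imp s t : dst [:: e; v; s; t] -> sb v s t -> peaks e x a N v s -> peaks e x a N v t.
    by move=> hd hst pk; have [] := peaks_sb chi xTD Nd No Ns hd pk hst.
  apply/idP/idP; apply: imp => //; first by dcase h'; dsplit.
  by rewrite (sbC chi xTD) //; dcase h'; dsplit.
- move=> v b c d h' l1 l2 n1 n2.
  have nbd : ~~ sb v b d by apply: contra n1 => /(sb_interval chi xTD h' l1 l2)/andP[].
  have [va|va] := eqVneq v a.
    have pa t : peaks e x a N v t = false.
      by apply/negP => /andP[]; rewrite /N va => ht _; dcase ht; dsub.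
    by rewrite !pa; left; split.
  dcase h'; pose A s := sb v a s; pose pk := peaks e x a N v.
  have AC s t : dst [:: e; v; s; t] -> ~~ sb v s t -> A s -> A t -> False.
    move=> hst ns; dcase hst; rewrite /A; have [as_|as_] := eqVneq a s.
      by rewrite as_ (negPf ns).
    have [at_|at_] := eqVneq a t.
      by rewrite at_ (sbC chi xTD) ?(negPf ns) //; dsplit.
    have aV : a \in V by dcase h.
    have ea : e != a by dcase h.
    rewrite (sbC chi xTD); last by dsplit.
    move=> s1 s2; move/negP: ns; apply; apply: (sb_trans chi xTD) s1 s2; dsplit.
  have pkA s : pk s -> ~~ A s by exact: pNsb.
  have iffA s t : dst [:: e; v; s; t] -> pk s -> pk t = ~~ A t.
    move=> hst ps; apply/idP/idP; first exact: pkA.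
    move=> nA; have ant : a != t by apply/eqP => ant; move: nA; rewrite -ant /A sb_refl.
    apply: (p_iff _ _ _ _ ps nA).
    by have := Nd _ _ (proj1 (andP ps)) => hps; dcase hps; dcase hst; dsplit.
  have all3 : pk b || pk c || pk d -> [/\ pk b = ~~ A b, pk c = ~~ A c & pk d = ~~ A d].
    have self s : pk s -> pk s = ~~ A s by move=> ps; rewrite ps (pkA _ ps).
    move=> /orP[/orP[]|] p0; split; try exact: self; by apply: iffA p0; dsplit.
  rewrite -/(pk b) -/(pk c) -/(pk d).
  have [/all3[pb pc pd]|] := boolP (pk b || pk c || pk d); last first.
    by rewrite !negb_or => /andP[/andP[/negPf -> /negPf ->] /negPf ->]; left; split.
  (* If the middle element were in the branch of [a], then [b] and [d] would be peaks before and
     after [a] in the order seen from [v], on different sides. *)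
  have key : A c -> False.
    move=> Ac.
    have nAb : ~~ A b by apply/negP => Ab; apply: (AC b c) => //; dsplit.
    have nAd : ~~ A d by apply/negP => Ad; apply: (AC c d) => //; dsplit.
    rewrite nAb in pb; rewrite nAd in pd.
    have aV : a \in V by dcase h.
    have ea : e != a by dcase h.
    have ab : a != b by apply/eqP => ab; move: nAb; rewrite -ab /A sb_refl.
    have ad : a != d by apply/eqP => ad; move: nAd; rewrite -ad /A sb_refl.
    have dab : dst [:: e; v; a; b] by dsplit.
    have dad : dst [:: e; v; a; d] by dsplit.
    have dbc : dst [:: e; v; b; c] by dsplit.
    have dcd : dst [:: e; v; c; d] by dsplit.
    have lb : lo v a b = false.
      have [ac|ac] := eqVneq a c.
        by subst c; rewrite (lo_anti chi dbc) l1.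
      case lab: (lo v a b) => //; have hh : dst [:: e; v; a; b; c] by dsplit.
      by have /andP[] := sb_interval chi xTD hh lab l1 Ac; rewrite -/(A b) (negPf nAb).
    have ld : lo v a d.
      have [ac|ac] := eqVneq a c; first by subst c.
      apply: contraT => lad; have hh : dst [:: e; v; c; d; a] by dsplit.
      have lda : lo v d a by rewrite (lo_anti chi dad) lad.
      have sca : sb v c a by rewrite (sbC chi xTD) //; dsplit.
      have /andP[_] := sb_interval chi xTD hh l2 lda sca.
      by rewrite (sbC chi xTD) -?/(A d) ?(negPf nAd) //; dsplit.
    have := all_th v b pb; have := all_th v d pd; rewrite /side lb ld.
    by move=> <-; case: (sg v e a).
  have nAbd : ~~ (A b && A d) by apply/negP => /andP[Ab Ad]; apply: (AC b d) => //; dsplit.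
  rewrite pb pc pd; case: (A c) key => [/(_ isT)//|_].
  by move: nAbd; case: (A b); case: (A d) => //= _; [right|left|left]; split=> //; rewrite ?oppr0 ?oppr_le0 ?ler01 ?lerN10.
Qed.

(* Lines through [e] to be known about a point in the position of [e] once
   the lines [a b1], [a b2] and [b c] are. *)
Inductive known a b1 b2 b c : I -> I -> Prop :=
| known1 : known a b1 b2 b c a b1
| known2 : known a b1 b2 b c a b2
| known3 : known a b1 b2 b c b c
| knownC p q : known a b1 b2 b c p q -> known a b1 b2 b c q p
| known_sb p q r s : dst [:: e; p; q; r; s] -> known a b1 b2 b c p q ->
    known a b1 b2 b c p s -> sb p q r -> ~~ sb p q s -> known a b1 b2 b c p r
| known_lo p q r s : dst [:: e; p; q; r; s] -> known a b1 b2 b c p q ->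
    known a b1 b2 b c p s -> lo p q r -> lo p r s -> known a b1 b2 b c p r.

Definition seeds a b1 b2 b c := [/\ dst [:: e; a; b1; b2], dst [:: e; a; b; c],
  col a b1 != col a b2, col b c != col a b1 & col b c != col a b2].

(** By [vanishing_fib], for each [a] some flat function vanishes on the pairs through [a] but not
    everywhere, so some colour is missing at [a]. Hence not every element sees a single colour,
    since then there would be only one; an element with two colours and a pair of a colour missing
    there are the seeds. *)
Lemma seeds_ex p q r : fib_linear -> dst [:: e; p; q; r] ->
  exists a b1 b2 b c, seeds a b1 b2 b c.
Proof.
move=> lin hpqr.
have peak0 a b c : dst [:: e; a; b; c] -> exists (U : I -> I -> bool) v t, [/\ dst [:: e; a; v; t],
    flat (fun v b => (U v b)%:R), U v t & forall b, U a b = false].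
  move=> h; have [U [U' [H1 [v [t hU]] _ H3 _]]] := vanishing_fib h.
  exists U, v, t; split=> //; first by apply: H1; rewrite hU.
    exact: (fib_flat chi xTD lin H3).
  move=> d; apply/negP => hd; have := H1 a d; rewrite hd => /(_ isT) h'; dcase h'; dsub.
have sepa (U : I -> I -> bool) v t a b : flat (fun v b => (U v b)%:R) -> U v t -> U a b = false ->
    col v t != col a b.
  move=> fU h1 h2; apply/eqP => /(flat_col fU) /eqP; rewrite h1 h2.
  by rewrite oner_eq0.
have [a [b1 [b2 [h12 n12]]]] : exists a b1 b2, dst [:: e; a; b1; b2] /\ col a b1 != col a b2.
  apply: contrapT => H.
  have mono a b c : dst [:: e; a; b; c] -> col a b = col a c.
    move=> h; apply/eqP; apply: contraT => n; case: H; exists a, b, c; by [].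
  have [U [v [t [hvt fU Uvt Up]]]] := peak0 p q r hpqr.
  have /eqP := sepa U v t p v fU Uvt (Up v); apply.
  by rewrite (mono v t p) 1?colC //; dcase hvt; dsplit.
have [U [b [c [hbc fU Ubc Ua]]]] := peak0 a b1 b2 h12.
by exists a, b1, b2, b, c; split=> //; apply: sepa Ubc _.
Qed.

Lemma seeds_cover a b1 b2 b c p q : seeds a b1 b2 b c -> few_colours (V :\ e) col ->
  dst [:: e; p; q] -> [|| col p q == col a b1, col p q == col a b2 | col p q == col b c].
Proof.
move=> [h12 hbc n12 n1 n2] [k1 [k2 [k3 hk]]].
rewrite -distinctD1 // => /hk.
  have := hk a b1; have := hk a b2; have := hk b c; rewrite !distinctD1 //.
  dcase h12; dcase hbc; move=> /(_ ltac:(dsplit)) + /(_ ltac:(dsplit)) + /(_ ltac:(dsplit)).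
  rewrite !inE => /or3P[]/eqP E1 /or3P[]/eqP E2 /or3P[]/eqP E3 /or3P[]/eqP E4;
  by move: n12 n1 n2; rewrite E1 E2 E3 E4 ?eqxx ?orbT.
Qed.

(** If pairs remained unknown, sliding [e] to the first lines among them would give a flat function
    supported on unknown pairs, hence a colour different from those of the three seeds. The rules
    [known_sb] and [known_lo] provide the closure properties of unknown pairs that [peak_fib]
    requires. *)
Lemma known_all a b1 b2 b c : fib_linear -> seeds a b1 b2 b c ->
  few_colours (V :\ e) col -> forall p q, dst [:: e; p; q] -> known a b1 b2 b c p q.
Proof.
move=> lin sds few; have [h12 hbc n12 n1 n2] := sds.
have in3 p q := @seeds_cover a b1 b2 b c p q sds few.
have nsb12 : ~~ sb a b1 b2 by apply: contra n12 => /(col_sb h12) ->.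
have nact : ~~ act V e x a by apply: contra n12 => /(col_act h12) ->.
(* Seeing two colours, [a] is not [act], so its only root branches are those of [b1] and [b2]. *)
have full q : dst [:: e; a; q] -> known a b1 b2 b c a q.
  move=> hq; dcase h12; dcase hq.
  have [->|q1] := eqVneq q b1; first exact: known1.
  have [->|q2] := eqVneq q b2; first exact: known2.
  have d1 : dst [:: e; a; b1; q; b2] by dsplit.
  have d2 : dst [:: e; a; b2; q; b1] by dsplit.
  have [s1|s1] := boolP (sb a b1 q).
    exact: (known_sb d1 (known1 _ _ _ _ _) (known2 _ _ _ _ _) s1 nsb12).
  have [s2|s2] := boolP (sb a b2 q).
    apply: (known_sb d2 (known2 _ _ _ _ _) (known1 _ _ _ _ _) s2).
    by rewrite (sbC chi xTD) //; dsplit.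
  case/negP: nact; apply/existsP; exists b1; apply/existsP; exists b2; apply/existsP; exists q.
  by apply/and4P; split=> //; dsplit.
pose kn := known a b1 b2 b c.
pose N p q := dst [:: e; a; p; q] && ~~ `[< kn p q >].
have NP p q : dst [:: e; a; p; q] -> ~ kn p q -> N p q.
  by move=> h k; rewrite /N h; apply/asboolPn.
have Nkn p q : N p q -> ~ kn p q by move=> /andP[_ /asboolPn].
have Nd p q : N p q -> dst [:: e; a; p; q] by move=> /andP[].
have NC p q : N p q -> N q p.
  move=> h; apply: NP => [|k]; first by have h' := Nd _ _ h; dcase h'; dsplit.
  by apply: (Nkn _ _ h); apply: knownC.
have fullC v p q : dst [:: e; v; a; p; q] -> kn v a.
  by move=> h; apply/knownC/full; dcase h; dsplit.
have No v p q : dst [:: e; v; a; p; q] -> N v p -> sb v a p -> ~~ sb v a q -> N v q.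
  move=> h n s1 s2; apply: NP => [|k]; first by dcase h; dsplit.
  apply: (Nkn _ _ n); apply: (known_sb h (fullC _ _ _ h) k s1 s2).
have Ns v p q : dst [:: e; v; a; p; q] -> N v p -> ~~ sb v a p -> sb v p q -> N v q.
  move=> h n s1 s2; dcase h; apply: NP => [|k]; first by dsplit.
  apply: (Nkn _ _ n); have h' : dst [:: e; v; q; p; a] by dsplit.
  apply: (known_sb h' k (fullC _ _ _ h)); first by rewrite (sbC chi xTD) //; dsplit.
  apply: contra s1 => s1; rewrite (sbC chi xTD); last by dsplit.
  by apply: (sb_trans chi xTD) s2 s1; dsplit.
have Nl v p q : dst [:: e; v; a; p; q] ->
  N v p -> lo v a p = lo v p q -> lo v a p = lo v a q -> N v q.
  move=> h n l1 _; dcase h; apply: NP => [|k]; first by dsplit.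
  apply: (Nkn _ _ n); case l: (lo v a p).
    by apply: (known_lo h (fullC _ _ _ h) k l); rewrite -l1.
  have h' : dst [:: e; v; q; p; a] by dsplit.
  apply: (known_lo h' k (fullC _ _ _ h)).
    by rewrite (@lo_anti _ _ chi V e v p q) -?l1 ?l //; dsplit.
  by rewrite (@lo_anti _ _ chi V e v a p) ?l //; dsplit.
have noN p q : N p q -> False.
  move=> h; have [v1 [t1 pk]] := peaks_ex a h.
  have [U [U1 [v [t Uvt]] U3]] := peak_fib chi eV xTD NC Nd No Ns Nl realV pk (erefl _).
  have fU := fib_flat chi xTD lin U3.
  have UN r s : U r s -> N r s by move=> /U1[/andP[]].
  have hvt : dst [:: e; v; t] by have h' := Nd _ _ (UN _ _ Uvt); dcase h'; dsplit.
  have tr r s : kn r s -> col v t != col r s.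
    move=> k; apply/eqP => /(flat_col fU)/eqP; rewrite Uvt.
    case Urs: (U r s); first by case: (Nkn _ _ (UN _ _ Urs)).
    by rewrite oner_eq0.
  have := in3 v t hvt; rewrite (negPf (tr _ _ (known1 _ _ _ _ _))).
  by rewrite (negPf (tr _ _ (known2 _ _ _ _ _))) (negPf (tr _ _ (known3 _ _ _ _ _))).
move=> p q h; have [ap_|ap_] := eqVneq a p; first by subst p; apply: full; dcase h; dsplit.
have [aq|aq] := eqVneq a q; first by subst q; apply: knownC; apply: full; dcase h; dsplit.
apply: contrapT => k; apply: (noN p q); apply: NP k; dcase h12; dcase h; dsplit.
Qed.

End Propagation.

(** * Blocks of colours on eight elements *)

Section Blocks.
Local Open Scope nat_scope.
Variables (I : finType) (V : {set I}).
Local Notation dst := (distinct V).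
Hypothesis V8 : #|V| <= 8.
(** To be instantiated with [cherry] and [blk]: [B e p q] means that, for [e], the pair [p q] has a
    colour other than the one seen by all elements. What follows is counting. *)
Variables (Ch B : I -> I -> I -> Prop).
Hypothesis ChC : forall p q r, Ch p q r -> Ch p r q.
Hypothesis Ch1 : forall p q r s, Ch p q r -> Ch p q s -> r = s.
Hypothesis Bd : forall e p q, B e p q -> dst [:: e; p; q].
Hypothesis BC : forall e p q, B e p q -> B e q p.
Hypothesis B1Ch : forall e p q, B e p q -> (forall r, B e p r -> r = q) -> Ch p q e.
Hypothesis B2Ch : forall e p q r, B e p q -> B e p r -> q != r -> Ch p q r.
Hypothesis ChB : forall e p q q', Ch p q e -> B e p q' -> B e p q /\ forall r, B e p r -> r = q.

Definition pr e p q := [/\ B e p q, forall r, B e p r -> r = q & forall r, B e q r -> r = p].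

(** Three disjoint blocks and [e] use up seven elements. The remaining one, [g], can only join [a]
    and [b]; it is a dummy when there is no eighth element. *)
Hypothesis frame : forall e, e \in V -> exists a b c d f h g,
  [/\ dst [:: e; a; b; c; d; f; h], forall p, p \in V -> p \in [:: e; a; b; c; d; f; h; g],
      [/\ B e a b, pr e c d & pr e f h] &
      [/\ forall p, B e a p -> p \in [:: b; g], forall p, B e b p -> p \in [:: a; g]
        & forall p, B e g p -> p \in [:: a; b]]].

Definition un e p := [/\ e \in V, p \in V, p != e & forall q, ~ B e p q].

Lemma unVcol e p : e \in V -> p \in V -> p != e -> un e p \/ exists q, B e p q.
Proof.
move=> eV pV pe; have [h|h] := pselect (exists q, B e p q); first by right.
by left; split=> // q hq; apply: h; exists q.
Qed.

Lemma prC e p q : pr e p q -> pr e q p.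
Proof. by move=> [h1 h2 h3]; split=> //; apply: BC. Qed.

Lemma pr_Ch e p q : pr e p q -> Ch p q e.
Proof. by move=> [h1 h2 h3]; apply: B1Ch. Qed.

Lemma Bneq e p q : B e p q -> [/\ p != e, q != e, p != q, p \in V & q \in V].
Proof. by move=> /Bd h; dcase h; split=> //; rewrite eq_sym. Qed.

Lemma un_uniq e p q : un e p -> un e q -> p = q.
Proof.
move=> [eV pV pe up] [_ qV qe uq].
have [a [b [c [d [f [h [g [_ cov [hab [hcd _ _] [hfh _ _]] _]]]]]]]] := frame eV.
have K t : t \in V -> t != e -> (forall q, ~ B e t q) -> t = g.
  move=> /cov; rewrite !inE => /orP[/eqP->|]; first by rewrite eqxx.
  move=> /orP[/eqP->|/orP[/eqP->|/orP[/eqP->|/orP[/eqP->|/orP[/eqP->|/orP[/eqP->|/eqP//]]]]]] _ K.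
  - by case: (K b).
  - by case: (K a); apply: BC.
  - by case: (K d).
  - by case: (K c); apply: BC.
  - by case: (K h).
  - by case: (K f); apply: BC.
by rewrite (K p) // (K q).
Qed.

Lemma block3 e m p q : B e m p -> B e m q -> p != q ->
  [/\ forall r, B e m r -> r \in [:: p; q], forall r, B e p r -> r \in [:: m; q] &
    forall r, r \in V -> r \notin [:: e; m; p; q] -> exists2 s, pr e r s & s \notin [:: e; m; p; q]].
Proof.
move=> mp mq pq; have [me pe n1 mV pV] := Bneq mp; have [_ qe n2 _ qV] := Bneq mq.
have eV : e \in V by have := Bd mp => h; dcase h.
have [a [b [c [d [f [h [g [hd cov [hab hcd hfh] [Na Nb Ng]]]]]]]]] := frame eV.
have [_ hc1 hc2] := hcd; have [_ hf1 hf2] := hfh.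
have m3 : m \in [:: a; b; g].
  have := cov m mV; rewrite !inE (negPf me) /=.
  move=> /orP[->//|/orP[->|/orP[/eqP em|/orP[/eqP em|/orP[/eqP em|/orP[/eqP em|->]]]]]]; rewrite ?orbT //;
  subst m; exfalso; move/eqP: pq; apply.
  - by rewrite (hc1 _ mp) (hc1 _ mq).
  - by rewrite (hc2 _ mp) (hc2 _ mq).
  - by rewrite (hf1 _ mp) (hf1 _ mq).
  - by rewrite (hf2 _ mp) (hf2 _ mq).
have in3 s t : s \in [:: a; b; g] -> B e s t -> t \in [:: a; b; g].
  rewrite !inE => /orP[/eqP->|/orP[/eqP->|/eqP->]].
  - by move=> /Na; rewrite !inE => /orP[->|->]; rewrite !orbT.
  - by move=> /Nb; rewrite !inE => /orP[->|->]; rewrite ?orbT.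
  - by move=> /Ng; rewrite !inE => /orP[->|->]; rewrite ?orbT.
have p3 := in3 _ _ m3 mp; have q3 := in3 _ _ m3 mq.
have [ag bg] : a != g /\ b != g.
  by move: m3 p3 q3 n1 n2 pq; rewrite !inE => /or3P[]/eqP-> /or3P[]/eqP-> /or3P[]/eqP->;
    rewrite ?eqxx // => *; split; rewrite // eq_sym.
have all3 t : t \in [:: a; b; g] -> t \in [:: m; p; q].
  by move: m3 p3 q3 n1 n2 pq; rewrite !inE => /or3P[]/eqP-> /or3P[]/eqP-> /or3P[]/eqP->;
    rewrite ?eqxx // => _ _ _ /or3P[]/eqP->; rewrite eqxx ?orbT.
split.
- move=> r hr; have := all3 _ (in3 _ _ m3 hr); have [_ _ mr _ _] := Bneq hr.
  by rewrite !inE eq_sym (negPf mr).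
- move=> r hr; have := all3 _ (in3 _ _ p3 hr); have [_ _ mr _ _] := Bneq hr.
  by rewrite !inE (eq_sym r p) (negPf mr).
move=> r rV; rewrite !inE !negb_or => /and4P[re rm rp rq].
have r3 : r \notin [:: a; b; g].
  by apply/negP => /all3; rewrite !inE (negPf rm) (negPf rp) (negPf rq).
have [t gt] : exists t, B e g t.
  have := all3 g; rewrite !inE eqxx !orbT => /(_ isT) /or3P[]/eqP->; first by exists p.
    by exists m; apply: BC.
  by exists m; apply: BC.
have tab := Ng t gt.
have three s : s \in [:: c; d; f; h] -> s \notin [:: e; m; p; q].
  move=> hs; dcase hd.
  have sa : s != a by move: hs; rewrite !inE => /or4P[]/eqP->; rewrite eq_sym.
  have sb : s != b by move: hs; rewrite !inE => /or4P[]/eqP->; rewrite eq_sym.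
  have se : s != e by move: hs; rewrite !inE => /or4P[]/eqP->; rewrite eq_sym.
  have sg : s != g.
    apply/eqP => sg; subst s; have [u hu ut] : exists2 u, u \in [:: c; d; f; h] & t = u.
      move: hs; rewrite !inE => /or4P[]/eqP eg; rewrite eg in gt.
      - by exists d; rewrite ?inE ?eqxx ?orbT //; apply: hc1.
      - by exists c; rewrite ?inE ?eqxx ?orbT //; apply: hc2.
      - by exists h; rewrite ?inE ?eqxx ?orbT //; apply: hf1.
      - by exists f; rewrite ?inE ?eqxx ?orbT //; apply: hf2.
    move: tab hu; rewrite ut !inE => /orP[]/eqP->; rewrite eq_sym => /or4P[]/eqP E; subst; dsub.
  have K u : u \in [:: a; b; g] -> s != u by rewrite !inE => /or3P[]/eqP->.
  by rewrite !inE !negb_or se !K.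
have := cov r rV; move: r3; rewrite !inE !negb_or (negPf re) /= => /and3P[/negPf-> /negPf-> /negPf->] /=.
rewrite orbF => /or4P[]/eqP->.
- by exists d => //; apply: three; rewrite !inE eqxx ?orbT.
- by exists c; [exact: prC | apply: three; rewrite !inE eqxx ?orbT].
- by exists h => //; apply: three; rewrite !inE eqxx ?orbT.
- by exists f; [exact: prC | apply: three; rewrite !inE eqxx ?orbT].
Qed.

Lemma Bpr e p q : B e p q ->
  (forall m r s, B e m r -> B e m s -> r = s) -> pr e p q.
Proof.
move=> h H; split=> // r hr; first exact: H hr h.
exact: H hr (BC h).
Qed.

Lemma un_pr e p q : un e p -> q \in V -> q != e -> q != p -> exists r, pr e q r.
Proof.
move=> up qV qe qp; have [eV pV pe K] := up.
have one m r s : B e m r -> B e m s -> r = s.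
  move=> h1 h2; have [//|rs] := eqVneq r s; have [_ _ H] := block3 h1 h2 rs.
  have [t [ht _ _] _] : exists2 t, pr e p t & t \notin [:: e; m; r; s].
    apply: H => //; rewrite !inE !negb_or pe /=; apply/and3P; split; apply/eqP => E; subst p.
    - exact: K h1.
    - exact: K (BC h1).
    - exact: K (BC h2).
  by case: (K t).
have [uq|[r hr]] := unVcol eV qV qe; first by rewrite (un_uniq uq up) eqxx in qp.
by exists r; apply: Bpr.
Qed.

Lemma distinct_card s : dst s -> size s <= #|V|.
Proof.
move=> /andP[us /allP sV]; rewrite -(card_uniqP us); apply: subset_leq_card.
by apply/fintype.subsetP => z; apply: sV.
Qed.

Lemma no_nine s : dst s -> size s = 9 -> False.
Proof. by move=> /distinct_card h e; rewrite e in h; have := leq_trans h V8. Qed.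

(** By [Ch1] the four elements [g] are different, and they avoid the other five: nine elements. *)
Lemma quad e a b c f : dst [:: e; a; b; c; f] ->
  (forall u, u \in [:: e; a; b; c] -> exists2 g, Ch f g u & dst [:: e; a; b; c; f; g]) -> False.
Proof.
move=> h H; have [g1 h1 d1] := H e ltac:(by rewrite !inE eqxx).
have [g2 h2 d2] := H a ltac:(by rewrite !inE eqxx ?orbT).
have [g3 h3 d3] := H b ltac:(by rewrite !inE eqxx ?orbT).
have [g4 h4 d4] := H c ltac:(by rewrite !inE eqxx ?orbT).
have K g u u' : Ch f g u -> Ch f g u' -> u != u' -> False by move=> k1 /(Ch1 k1) ->; rewrite eqxx.
dcase d1; dcase d2; dcase d3; dcase d4.
have n12 : g1 != g2 by apply/eqP => E; subst g2; apply: (K _ _ _ h1 h2).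
have n13 : g1 != g3 by apply/eqP => E; subst g3; apply: (K _ _ _ h1 h3).
have n14 : g1 != g4 by apply/eqP => E; subst g4; apply: (K _ _ _ h1 h4).
have n23 : g2 != g3 by apply/eqP => E; subst g3; apply: (K _ _ _ h2 h3).
have n24 : g2 != g4 by apply/eqP => E; subst g4; apply: (K _ _ _ h2 h4).
have n34 : g3 != g4 by apply/eqP => E; subst g4; apply: (K _ _ _ h3 h4).
by apply: (@no_nine [:: e; a; b; c; f; g1; g2; g3; g4]) => //; dsplit.
Qed.

Definition path_block e m p q := [/\ B e m p, B e m q, p != q & ~ B e p q].

(** The block at [e] forces cherries at [b] and [c], and these force a block of the same shape at
    [b]. Iterating makes each of [e], [a], [b], [c] carry a block formed by the other three, the
    situation excluded by [quad]. *)
Lemma path_block_move e a b c : path_block e a b c -> path_block b c a e.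
Proof.
move=> [ab ac bc nbc]; have [Na Nb out] := block3 ab ac bc.
have cb : c != b by rewrite eq_sym.
have [_ Nc _] := block3 ac ab cb.
have [ae be n1 aV bV] := Bneq ab; have [_ ce n2 _ cV] := Bneq ac.
have eV : e \in V by have := Bd ab => h; dcase h.
have Cba : Ch b a e.
  apply: B1Ch (BC ab) _ => r hr; have := Nb r hr; rewrite !inE => /orP[]/eqP// rc.
  by case: nbc; rewrite -rc.
have Cca : Ch c a e.
  apply: B1Ch (BC ac) _ => r hr; have := Nc r hr; rewrite !inE => /orP[]/eqP// rb.
  by case: nbc; apply: BC; rewrite -rb.
have Cabc := B2Ch ab ac bc.
have [ub|[t ht]] := unVcol bV aV n1.
  have eb : e != b by rewrite eq_sym.
  have ea : e != a by rewrite eq_sym.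
  have [y hy] := un_pr ub eV eb ea.
  have C1 := pr_Ch hy; have C2 := pr_Ch (prC hy).
  have [hy1 _ _] := hy; have [_ yb ey _ yV] := Bneq hy1.
  have ya : y != a.
    apply/eqP => ya; subst y; case: ub => _ _ _ /(_ e); apply; exact: BC.
  have yc : y != c.
    apply/eqP => yc; subst y; have := Ch1 C2 (ChC Cca) => E; by rewrite E eqxx in n1.
  have [y' hy' ny'] : exists2 s, pr e y s & s \notin [:: e; a; b; c].
    by apply: out => //; rewrite !inE !negb_or ya yb yc eq_sym ey.
  have := Ch1 C2 (ChC (pr_Ch hy')) => E; move: ny'; rewrite -E !inE eqxx ?orbT //.
have [bac Nba] := ChB (ChC Cabc) ht.
have [H|H] := pselect (forall r, B b c r -> r = a).
  have := Ch1 (B1Ch (BC bac) H) Cca => E; by rewrite E eqxx in be.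
have [q hq qa] : exists2 q, B b c q & q != a.
  apply: contrapT => H'; apply: H => r hr; apply/eqP; apply: contraT => ra.
  by case: H'; exists r.
have aq : a != q by rewrite eq_sym.
have E := Ch1 (B2Ch (BC bac) hq aq) Cca; subst q.
split=> //; first exact: BC.
by move=> /Nba E; rewrite E eqxx in ce.
Qed.

Lemma block_partner e m p q f : B e m p -> B e m q -> p != q -> dst [:: e; m; p; q; f] ->
  exists2 g, pr e f g & dst [:: e; m; p; q; f; g].
Proof.
move=> mp mq pq h; have [_ _ out] := block3 mp mq pq; dcase h.
have [g hg ng] : exists2 s, pr e f s & s \notin [:: e; m; p; q].
  by apply: out => //; rewrite !inE !negb_or; do ?[apply/andP; split]; rewrite eq_sym.
have [hg1 _ _] := hg; have := Bneq hg1 => -[_ ge fg _ gV].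
exists g => //.
by move: ng; rewrite !inE !negb_or => /and4P[? ? ? ?]; dsplit.
Qed.

Lemma fifth e a b c : dst [:: e; a; b; c] -> exists f, dst [:: e; a; b; c; f].
Proof.
move=> h; have eV : e \in V by dcase h.
have [a' [b' [c' [d [f [k [g [hd _ _ _]]]]]]]] := frame eV.
have [/existsP[z /andP[zV zn]]|/existsPn N] :=
  boolP [exists z, (z \in V) && (z \notin [:: e; a; b; c])].
  exists z; move: zn; rewrite !inE !negb_or => /and4P[? ? ? ?]; dcase h; dsplit.
have /subset_leq_card : V \subset [:: e; a; b; c].
  by apply/fintype.subsetP => z zV; have := N z; rewrite zV /= negbK.
move=> le; have := leq_trans (distinct_card hd) (leq_trans le (card_size _)).
by [].
Qed.

Lemma no_path_block e a b c : path_block e a b c -> False.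
Proof.
move=> p1; have p2 := path_block_move p1; have p3 := path_block_move p2.
have p4 := path_block_move p3.
have [h1 h2 h3 h4] := p1; have := Bd h1; have := Bd h2 => d1 d2; dcase d1; dcase d2.
have [f hf] := @fifth e a b c ltac:(dsplit); apply: (quad hf) => u.
dcase hf; rewrite !inE => /or4P[]/eqP->.
- by have [k1 k2 k3 _] := p1; have [g hg dg] := block_partner k1 k2 k3 hf; exists g => //; apply: pr_Ch.
- have [k1 k2 k3 _] := p3; have [g hg dg] := @block_partner a e c b f k1 k2 k3 ltac:(dsplit).
  by exists g; [exact: pr_Ch | dcase dg; dsplit].
- have [k1 k2 k3 _] := p2; have [g hg dg] := @block_partner b c a e f k1 k2 k3 ltac:(dsplit).
  by exists g; [exact: pr_Ch | dcase dg; dsplit].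
- have [k1 k2 k3 _] := p4; have [g hg dg] := @block_partner c b e a f k1 k2 k3 ltac:(dsplit).
  by exists g; [exact: pr_Ch | dcase dg; dsplit].
Qed.

Definition full_block e a b c := [/\ B e a b, B e a c & B e b c].

Lemma full_blockI e a b c : B e a b -> B e a c -> b != c -> full_block e a b c.
Proof.
move=> h1 h2 bc; split=> //; apply: contrapT => h3.
by apply: (@no_path_block e a b c).
Qed.

Lemma full_block_pr e a b c : full_block e a b c -> pr a b c.
Proof.
move=> [ab ac bc].
have [ae be n1 aV bV] := Bneq ab; have [_ ce n2 _ cV] := Bneq ac; have [_ _ n3 _ _] := Bneq bc.
have C1 : Ch b c a by apply/ChC/(B2Ch (BC ab) bc).
have C2 : Ch c b a by apply/ChC/(B2Ch (BC ac) (BC bc)).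
have ba : b != a by rewrite eq_sym.
have ca : c != a by rewrite eq_sym.
have [ub|[t /(ChB C1)[h1 h2]]] := unVcol aV bV ba.
  have [uc|[t /(ChB C2)[h1 h2]]] := unVcol aV cV ca.
    by rewrite (un_uniq ub uc) eqxx in n3.
  by have [_ h3] := ChB C1 (BC h1); split=> //; exact: BC.
by have [_ h3] := ChB C2 (BC h1); split.
Qed.

(** Otherwise [a] would carry a block [e x y] with [x y] a pair of [e]. A seventh element then has
    partners for [e] and for [a]; these are different and new, which makes nine elements. *)
Lemma full_block_un e a b c : full_block e a b c -> un a e.
Proof.
move=> F; have [ab ac bc] := F; have [hp1 hp2 hp3] := full_block_pr F.
have [ae be n1 aV bV] := Bneq ab; have [_ ce n2 _ cV] := Bneq ac; have [_ _ n3 _ _] := Bneq bc.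
have eV : e \in V by have := Bd ab => h; dcase h.
have ea : e != a by rewrite eq_sym.
have [//|[x hx]] := unVcol aV eV ea; exfalso.
have [_ _ out] := block3 ab ac n3.
have xF z : B a e z -> exists2 z', pr e z z' & z' \notin [:: e; a; b; c].
  move=> hz; have [_ za ez _ zV] := Bneq hz; have ze : z != e by rewrite eq_sym.
  apply: out => //; rewrite !inE !negb_or za ze /=.
  apply/andP; split; apply/eqP => E; subst z.
    by move: ce; rewrite (hp2 _ (BC hz)) eqxx.
  by move: be; rewrite (hp3 _ (BC hz)) eqxx.
have [x' hx' nx'] := xF x hx; have [_ xa ex _ xV] := Bneq hx.
have Cx := pr_Ch hx'.
have [H|H] := pselect (forall r, B a x r -> r = e).
  have C := B1Ch (BC hx) H; have E := Ch1 C (ChC Cx).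
  by move: nx'; rewrite -E !inE eqxx orbT.
have [y hy ye] : exists2 y, B a x y & y != e.
  apply: contrapT => H'; apply: H => r hr; apply/eqP; apply: contraT => ra.
  by case: H'; exists r.
have ey : e != y by rewrite eq_sym.
have [hxy _ hey] := full_blockI (BC hx) hy ey.
have C := B2Ch (BC hx) hy ey.
have E := Ch1 C (ChC Cx); subst x'.
have [_ ya xy _ yV] := Bneq hy; have [hx1 hx2 hx3] := hx'.
have xb : x != b by apply/eqP => E; subst x; move: ce; rewrite (hp2 _ (BC hx)) eqxx.
have xc : x != c by apply/eqP => E; subst x; move: be; rewrite (hp3 _ (BC hx)) eqxx.
move: nx'; rewrite !inE !negb_or => /and4P[_ _ yb yc].
have d6 : dst [:: e; a; b; c; x; y] by dsplit.
have [z hz] : exists z, dst [:: e; a; b; c; x; y; z].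
  have [a' [b' [c' [d [f [k [g [hd _ _ _]]]]]]]] := frame eV.
  have [/existsP[z /andP[zV zn]]|/existsPn N] :=
    boolP [exists z, (z \in V) && (z \notin [:: e; a; b; c; x; y])].
    exists z; move: zn; rewrite !inE !negb_or => /and5P[? ? ? ? /andP[? ?]]; dcase d6; dsplit.
  have /subset_leq_card : V \subset [:: e; a; b; c; x; y].
    by apply/fintype.subsetP => z zV; have := N z; rewrite zV /= negbK.
  by move=> le; have := leq_trans (distinct_card hd) (leq_trans le (card_size _)).
dcase hz.
have [z1 k1 dz1] := @block_partner e a b c z ab ac n3 ltac:(dsplit).
have [z2 k2 dz2] := @block_partner a x e y z (BC hx) hy ltac:(dsplit) ltac:(dsplit).
have [q1 _ _] := k1; have [q2 _ _] := k2.
dcase dz1; dcase dz2.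
have z1x : z1 != x.
  by apply/eqP => E; subst z1; have E := hx2 _ (BC q1); subst z; dsub.
have z1y : z1 != y.
  by apply/eqP => E; subst z1; have E := hx3 _ (BC q1); subst z; dsub.
have z2b : z2 != b.
  by apply/eqP => E; subst z2; have E := hp2 _ (BC q2); subst z; dsub.
have z2c : z2 != c.
  by apply/eqP => E; subst z2; have E := hp3 _ (BC q2); subst z; dsub.
have [E|n12] := eqVneq z1 z2.
  by subst z2; have E := Ch1 (pr_Ch k1) (pr_Ch k2); subst e; dsub.
by apply: (@no_nine [:: e; a; b; c; x; y; z; z1; z2]) => //; dsplit.
Qed.

(** Each of [a], [b], [c] misses [e] and so pairs off everything else; with the pairs of [e] outside
    the block, [quad] applies to a fifth element. *)
Lemma no_full_block e a b c : full_block e a b c -> False.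
Proof.
move=> F; have [ab ac bc] := F.
have [ae be n1 aV bV] := Bneq ab; have [_ ce n2 _ cV] := Bneq ac; have [_ _ n3 _ _] := Bneq bc.
have eV : e \in V by have := Bd ab => h; dcase h.
have F2 : full_block e b c a by split=> //; exact: BC.
have F3 : full_block e c a b by split=> //; exact: BC.
have [f hf] := @fifth e a b c ltac:(dsplit).
apply: (quad hf) => u; dcase hf.
have K p q r : full_block e p q r -> dst [:: e; p; q; r; f] ->
    exists2 g, Ch f g p & dst [:: e; p; q; r; f; g].
  move=> G hd; dcase hd; have [h1 h2 h3] := full_block_pr G.
  have upe := full_block_un G.
  have [g hg] := @un_pr p e f upe ltac:(by []) ltac:(by rewrite eq_sym) ltac:(by rewrite eq_sym).
  exists g; first exact: pr_Ch.
  have [hg1 _ _] := hg; have [_ gp fg _ gV] := Bneq hg1.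
  have ge : g != e.
    by apply/eqP => E; subst g; case: upe => _ _ _ /(_ f); apply; exact: BC.
  have gq : g != q.
    by apply/eqP => E; subst g; have E := h2 _ (BC hg1); subst f; dsub.
  have gr : g != r.
    by apply/eqP => E; subst g; have E := h3 _ (BC hg1); subst f; dsub.
  by dsplit.
rewrite !inE => /or4P[]/eqP->.
- have [g hg dg] := @block_partner e a b c f ab ac n3 ltac:(dsplit).
  by exists g; [exact: pr_Ch | dcase dg; dsplit].
- have [g hg dg] := K a b c F ltac:(dsplit).
  by exists g => //; dcase dg; dsplit.
- have [g hg dg] := K b c a F2 ltac:(dsplit).
  by exists g => //; dcase dg; dsplit.
- have [g hg dg] := K c a b F3 ltac:(dsplit).
  by exists g => //; dcase dg; dsplit.
Qed.

Lemma B_pr e p q : B e p q -> pr e p q.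
Proof.
move=> h; apply: Bpr h _ => m r s hr hs; have [//|rs] := eqVneq r s.
by case: (no_full_block (full_blockI hr hs rs)).
Qed.

(** Blocks being pairs now, the only alternative is that [q] and [r] miss each other. Both then lead
    to an element missed by [e]; this is the same element, and it would have the cherries [e q] and
    [e r]. *)
Lemma B_apex e q r : B e q r -> Ch e q r.
Proof.
have dich u p t : B u p t -> Ch u p t \/ (un t p /\ un p t).
  move=> h; have [_ h2 h3] := B_pr h; have [pu tu pt pV tV] := Bneq h.
  have tp : t != p by rewrite eq_sym.
  have C1 := pr_Ch (B_pr h); have C2 := pr_Ch (B_pr (BC h)).
  have [u1|[s hs]] := unVcol tV pV pt; last first.
    have [k _] := ChB (ChC C1) hs; left.
    exact: (pr_Ch (B_pr (BC k))).
  have [u2|[s hs]] := unVcol pV tV tp; first by right.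
  have [k _] := ChB (ChC C2) hs; left.
  exact: ChC (pr_Ch (B_pr (BC k))).
move=> h; have [//|[u1 u2]] := dich e q r h; exfalso.
have [qe re qr qV rV] := Bneq h; have eV : e \in V by have := Bd h => hd; dcase hd.
have C1 := pr_Ch (B_pr h); have C2 := pr_Ch (B_pr (BC h)).
have K p t : B e p t -> un p t -> exists h, [/\ un e h, Ch h e p & h != t].
  move=> hpt upt; have [pe te pt pV tV] := Bneq hpt.
  have ep : e != p by rewrite eq_sym.
  have [up|[s hs]] := unVcol pV eV ep.
    by move: te; rewrite (un_uniq upt up) eqxx.
  have st : s != t by apply/eqP => E; subst s; case: upt => _ _ _ /(_ e); apply; exact: BC.
  exists s; split=> //; last exact: (pr_Ch (B_pr (BC hs))).
  have [C|[]//] := dich p e s hs.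
  have E := Ch1 (ChC (pr_Ch (B_pr hpt))) C.
  by rewrite E eqxx in st.
have [s [us Cs sr]] := K q r h u2; have [t [ut Ct tq]] := K r q (BC h) u1.
have E := un_uniq us ut; subst t; have E := Ch1 Cs Ct; subst q; dsub.
Qed.

(** So [B] is invariant under permutations: its triples are the lines of a partial Steiner triple
    system in which an element misses at most one other. *)
Lemma B_rot e q r : B e q r -> B q e r.
Proof.
move=> h; have [qe re qr qV rV] := Bneq h; have eV : e \in V by have := Bd h => hd; dcase hd.
have C0 := B_apex h; have C1 := pr_Ch (B_pr h); have C2 := pr_Ch (B_pr (BC h)).
have eq_ : e != q by rewrite eq_sym.
have rq : r != q by rewrite eq_sym.
have [u1|[s hs]] := unVcol qV eV eq_; last by case: (ChB (ChC C0) hs).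
have [u2|[s hs]] := unVcol qV rV rq; first by rewrite (un_uniq u1 u2) eqxx in re.
by case: (ChB (ChC C2) hs) => /BC.
Qed.

Lemma B1 e p q r : B e p q -> B e p r -> q = r.
Proof. by move=> h h'; have [_ K _] := B_pr h'; exact: K. Qed.

Lemma Bperm e p q : B e p q ->
  [/\ B e q p, B p e q, B p q e, B q e p & B q p e].
Proof.
by move=> h; split; [exact: BC | exact: B_rot | exact/BC/B_rot | exact/B_rot/BC | exact/BC/B_rot/BC].
Qed.

Ltac bsat H := let h1 := fresh "b" in let h2 := fresh "b" in let h3 := fresh "b" in
  let h4 := fresh "b" in let h5 := fresh "b" in
  have [h1 h2 h3 h4 h5] := Bperm H.
Ltac bclash := exfalso; match goal with
  | H : B ?p ?q ?q |- _ => by case: (Bneq H); rewrite eqxx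
  | H : B ?p ?p ?q |- _ => by case: (Bneq H); rewrite eqxx
  | U : (forall q, ~ B ?e ?f q), H : B ?e ?f _ |- _ => exact: (U _ H)
  | H : B ?p ?q ?r, K : B ?p ?q ?s, D : is_true (?r != ?s) |- _ =>
      by move: D; rewrite (B1 H K) eqxx
  end.
Ltac bcases cov H x xV := have := cov x xV; rewrite !inE;
  let E := fresh "E" in
  repeat (case/orP; [move/eqP => E; subst x; bsat H; try bclash | ]);
  try (move/eqP => E; subst x; bsat H; try bclash).

(** The third element of each further pair is forced: the other candidates would put two lines
    through one pair. *)
Lemma fano7 e a a' b b' c c' : #|V| <= 7 -> dst [:: e; a; a'; b; b'; c; c'] ->
  (forall p, p \in V -> p \in [:: e; a; a'; b; b'; c; c']) ->
  (forall u p, u \in V -> p \in V -> p != u -> exists q, B u p q) ->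
  B e a a' -> B e b b' -> B e c c' -> B a b c -> [/\ B a b' c', B a' b c' & B a' b' c].
Proof.
move=> V7 hd cov col ha hb hc h1; dcase hd.
bsat ha; bsat hb; bsat hc; bsat h1.
have S u v : u != v -> v != u by rewrite eq_sym.
have nb'a : b' != a by apply: S.
have nba' : b != a' by apply: S.
have nb'a' : b' != a' by apply: S.
have [x hx] := col a b' ltac:(by []) ltac:(by []) nb'a; have [_ _ _ _ xV] := Bneq hx.
have h2 : B a b' c' by bcases cov hx x xV.
bsat h2.
have [y hy] := col a' b ltac:(by []) ltac:(by []) nba'; have [_ _ _ _ yV] := Bneq hy.
have h3 : B a' b c' by bcases cov hy y yV.
bsat h3.
have [z hz] := col a' b' ltac:(by []) ltac:(by []) nb'a'; have [_ _ _ _ zV] := Bneq hz.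
have h4 : B a' b' c by bcases cov hz z zV.
by [].
Qed.

(** An element misses at most one other. So if a wanted line were absent, a second pair through the
    same element would have a third element, and all candidates clash. *)
Lemma maclane8 e f a a' b b' c c' : dst [:: e; f; a; a'; b; b'; c; c'] ->
  (forall p, p \in V -> p \in [:: e; f; a; a'; b; b'; c; c']) ->
  un e f -> un f e -> B e a a' -> B e b b' -> B e c c' -> B f a b -> B f b' c ->
  [/\ B f c' a', B a b' c' & B b a' c].
Proof.
move=> hd cov uef ufe ha hb hc h1 h2; dcase hd.
have [_ _ _ U1] := uef; have [_ _ _ U2] := ufe.
bsat ha; bsat hb; bsat hc; bsat h1; bsat h2.
have S u v : u != v -> v != u by rewrite eq_sym.
have nc'f : c' != f by apply: S.
have nc'e : c' != e by apply: S.
have [x [hx _ _]] := @un_pr f e c' ufe ltac:(by []) nc'f nc'e.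
have [_ _ _ _ xV] := Bneq hx.
have h3 : B f c' a' by bcases cov hx x xV.
bsat h3.
have nb'a : b' != a by apply: S.
have nca : c != a by apply: S.
have h4 : B a b' c'.
  have [u1|[y hy]] := @unVcol a b' ltac:(by []) ltac:(by []) nb'a.
    have [u2|[y hy]] := @unVcol a c ltac:(by []) ltac:(by []) nca.
      by have E := un_uniq u1 u2; subst c; dsub.
    have [_ _ _ _ yV] := Bneq hy; have [_ _ _ U3] := u1.
    by bcases cov hy y yV; case: (U3 c).
  by have [_ _ _ _ yV] := Bneq hy; bcases cov hy y yV.
bsat h4.
have nba' : b != a' by apply: S.
have nb'a' : b' != a' by apply: S.
have h5 : B a' b c.
  have [u1|[y hy]] := @unVcol a' b ltac:(by []) ltac:(by []) nba'.
    have [u2|[y hy]] := @unVcol a' b' ltac:(by []) ltac:(by []) nb'a'.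
      by have E := un_uniq u1 u2; subst b'; dsub.
    by have [_ _ _ _ yV] := Bneq hy; bcases cov hy y yV.
  by have [_ _ _ _ yV] := Bneq hy; bcases cov hy y yV.
bsat h5.
by [].
Qed.

(* The incidences of the Moebius-Kantor configuration 8_3, which no real
   chirotope admits. *)
Definition maclane := exists e f a a' b b' c c', dst [:: e; f; a; a'; b; b'; c; c'] /\
    [/\ B e a a', B e b b', B e c c' & [/\ B f a b, B f b' c, B f c' a', B a b' c' & B b a' c]].

Lemma maclane_start e f a a' b b' c c' : dst [:: e; f; a; a'; b; b'; c; c'] ->
  (forall p, p \in V -> p \in [:: e; f; a; a'; b; b'; c; c']) ->
  un e f -> un f e -> B e a a' -> B e b b' -> B e c c' -> B f a b -> maclane.
Proof.
move=> hd cov uef ufe ha hb hc h1; have h8 := hd; dcase h8.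
have [_ _ _ U1] := uef; have [_ _ _ U2] := ufe.
bsat ha; bsat hb; bsat hc; bsat h1.
have S u v : u != v -> v != u by rewrite eq_sym.
have nb'f : b' != f by apply: S.
have nb'e : b' != e by apply: S.
have ncf : c != f by apply: S.
have nce : c != e by apply: S.
have [x [hx _ _]] := @un_pr f e b' ufe ltac:(by []) nb'f nb'e.
have [_ _ _ _ xV] := Bneq hx.
have [h2|[h2|h2]] : B f b' c \/ B f b' c' \/ B f b' a'.
  by bcases cov hx x xV; [right; right | left | right; left].
- have [k1 k2 k3] := maclane8 hd cov uef ufe ha hb hc h1 h2.
  by exists e, f, a, a', b, b', c, c'.
- have hp : perm_eq [:: e; f; a; a'; b; b'; c; c'] [:: e; f; a; a'; b; b'; c'; c].
    by rewrite !perm_cons (perm_catC [:: c] [:: c']).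
  have hd2 : dst [:: e; f; a; a'; b; b'; c'; c] by dsplit.
  have cov2 p : p \in V -> p \in [:: e; f; a; a'; b; b'; c'; c].
    by move=> /cov; rewrite (perm_mem hp).
  have [k1 k2 k3] := maclane8 hd2 cov2 uef ufe ha hb (BC hc) h1 h2.
  by exists e, f, a, a', b, b', c', c; split=> //; split=> //; exact: BC.
- bsat h2; have [y [hy _ _]] := @un_pr f e c ufe ltac:(by []) ncf nce.
  have [_ _ _ _ yV] := Bneq hy.
  by bcases cov hy y yV.
Qed.

Lemma fano_or_maclane : (exists e, e \in V) ->
  (exists e a a' b b' c c', dst [:: e; a; a'; b; b'; c; c'] /\
    [/\ B e a a', B e b b', B e c c' & [/\ B a b c, B a b' c', B a' b c' & B a' b' c]]) \/
  maclane.
Proof.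
move=> [e eV]; have [a [a' [b [b' [c [c' [g [hd cov [ha [hb _ _] [hc _ _]] _]]]]]]]] := frame eV.
have S u v : u != v -> v != u by rewrite eq_sym.
have D s s' : perm_eq s s' -> dst s -> dst s'.
  by move=> ps; rewrite /distinct (perm_uniq ps) (perm_all _ ps).
(* Either [g] is a dummy and any two of the seven elements are on a line, or [e] and [g] miss each
   other. *)
have [gl|] := boolP ((g \in [:: e; a; a'; b; b'; c; c']) || (g \notin V)).
  left; have cov7 p : p \in V -> p \in [:: e; a; a'; b; b'; c; c'].
    move=> pV; have := cov p pV.
    rewrite (_ : [:: e; a; a'; b; b'; c; c'; g] = rcons [:: e; a; a'; b; b'; c; c'] g) //.
    rewrite mem_rcons in_cons => /orP[/eqP pg|//]; rewrite -pg in gl.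
    by case/orP: gl => //; rewrite pV.
  have V7 : #|V| <= 7.
    have /subset_leq_card h : V \subset [:: e; a; a'; b; b'; c; c'] by apply/fintype.subsetP.
    exact: leq_trans h (card_size _).
  have col u p : u \in V -> p \in V -> p != u -> exists q, B u p q.
    move=> uV pV pu.
    have [a1 [a2 [b1 [b2 [c1 [c2 [g' [hd' cov' [ha' [hb' _ _] [hc' _ _]] _]]]]]]]] := frame uV.
    have : p \in [:: u; a1; a2; b1; b2; c1; c2].
      apply: contraT => np; have : dst [:: p; u; a1; a2; b1; b2; c1; c2].
        by rewrite /distinct /= np pV; move: hd'; rewrite /distinct /= => ->.
      by move=> /distinct_card /leq_trans/(_ V7).
    rewrite !inE (negPf pu) /= => /orP[/eqP->|/orP[/eqP->|/orP[/eqP->|/orP[/eqP->|/orP[/eqP->|/eqP->]]]]].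
    - by exists a2.
    - by exists a1; apply: BC.
    - by exists b2.
    - by exists b1; apply: BC.
    - by exists c2.
    - by exists c1; apply: BC.
  dcase hd; have nba : b != a by apply: S.
  have [x hx] := col a b ltac:(by []) ltac:(by []) nba; have [_ _ _ _ xV] := Bneq hx.
  bsat ha; bsat hb; bsat hc.
  have [h1|h1] : B a b c \/ B a b c'.
    by bcases cov7 hx x xV; [left|right].
  - exists e, a, a', b, b', c, c'; split=> //.
    by have [] := fano7 V7 hd cov7 col ha hb hc h1; split.
  - have hd2 : dst [:: e; a; a'; b; b'; c'; c] by dsplit.
    have cov2 p : p \in V -> p \in [:: e; a; a'; b; b'; c'; c].
      move=> /cov7; rewrite !inE.
      by do 6 (case/orP; [by move=> ->; rewrite ?orbT|]); move=> ->; rewrite ?orbT.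
    have [k1 k2 k3] := fano7 V7 hd2 cov2 col ha hb (BC hc) h1.
    by exists e, a, a', b, b', c', c; split=> //; split=> //; exact: BC.
rewrite negb_or negbK => /andP[gl gV]; right.
have hd8 : dst [:: e; g; a; a'; b; b'; c; c'].
  dcase hd; move: gl; rewrite !inE !negb_or => /and5P[? ? ? ? /and3P[? ? ?]]; dsplit.
have cov8 p : p \in V -> p \in [:: e; g; a; a'; b; b'; c; c'].
  move=> /cov; rewrite !inE.
  by do 7 (case/orP; [by move=> ->; rewrite ?orbT|]); move=> ->; rewrite ?orbT.
have h8 := hd8; dcase h8.
bsat ha; bsat hb; bsat hc.
have ge : g != e by apply: S.
have uge : un e g.
  have [//|[x hx]] := unVcol eV gV ge.
  by have [_ _ _ _ xV] := Bneq hx; bcases cov8 hx x xV.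
have ueg : un g e.
  split=> // q hq; have [k1 k2 k3 k4 k5] := Bperm hq; case: uge => _ _ _ /(_ q); exact.
have [_ _ _ U1] := uge; have [_ _ _ U2] := ueg.
have ag : a != g by apply: S.
have ae : a != e by apply: S.
have [x [hx _ _]] := @un_pr g e a ueg ltac:(by []) ag ae.
have [_ _ _ _ xV] := Bneq hx.
have covS s : perm_eq [:: e; g; a; a'; b; b'; c; c'] s -> forall p, p \in V -> p \in s.
  by move=> /perm_mem E p /cov8; rewrite E.
have [h|[h|[h|h]]] : B g a b \/ B g a b' \/ B g a c \/ B g a c'.
  by bcases cov8 hx x xV; [left | right; left | right; right; left | right; right; right].
- exact: (maclane_start hd8 cov8 uge ueg ha hb hc h).
- have hp : perm_eq [:: e; g; a; a'; b; b'; c; c'] [:: e; g; a; a'; b'; b; c; c'].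
    rewrite !perm_cons; change (perm_eq ([:: b; b'] ++ [:: c; c']) ([:: b'; b] ++ [:: c; c'])).
    by rewrite perm_cat2r (perm_catC [:: b] [:: b']).
  exact: (maclane_start (D _ _ hp hd8) (covS _ hp) uge ueg ha (BC hb) hc h).
- have hp : perm_eq [:: e; g; a; a'; b; b'; c; c'] [:: e; g; a; a'; c; c'; b; b'].
    by rewrite !perm_cons (perm_catC [:: b; b'] [:: c; c']).
  exact: (maclane_start (D _ _ hp hd8) (covS _ hp) uge ueg ha hc hb h).
- have hp : perm_eq [:: e; g; a; a'; b; b'; c; c'] [:: e; g; a; a'; c'; c; b; b'].
    rewrite !perm_cons; apply: (@perm_trans _ ([:: b; b'] ++ [:: c'; c])).
      by rewrite (perm_cat2l [:: b; b'] [:: c; c']) (perm_catC [:: c] [:: c']).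
    by rewrite (perm_catC [:: b; b'] [:: c'; c]).
  exact: (maclane_start (D _ _ hp hd8) (covS _ hp) uge ueg ha (BC hc) hb h).
Qed.

End Blocks.

(** * Nonrealisability of two configurations by parity of signs *)

Section SignCertificates.
Variables (I : finType) (sg : I -> I -> I -> bool).
Hypothesis chi : chirotope sg.
Variables (V : {set I}) (pts : seq I) (x0 : I).
Hypothesis ptsV : distinct V pts.
Local Notation pt i := (nth x0 pts i).
Local Notation tri := (nat * nat * nat)%type.

Definition val3 (t : tri) := sg (pt t.1.1) (pt t.1.2) (pt t.2).

(** The boolean is the parity of the sorting permutation, by which [sg] changes. *)
Definition sort3 (t : tri) : tri * bool := let: (i, j, k) := t in
  (if i < j then if j < k then ((i, j, k), false)
    else if i < k then ((i, k, j), true) else ((k, i, j), false)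
  else if i < k then ((j, i, k), true)
    else if j < k then ((j, k, i), false) else ((k, j, i), true))%N.

Definition valid3 (t : tri) := uniq [:: t.1.1; t.1.2; t.2] &&
  all (fun i => i < size pts)%N [:: t.1.1; t.1.2; t.2].

Lemma pt_neq i j : (i < size pts)%N -> (j < size pts)%N -> i != j -> pt i != pt j.
Proof. by move=> hi hj; have /andP[u _] := ptsV; rewrite nth_uniq. Qed.

Lemma val3_sort t : valid3 t -> val3 t = val3 (sort3 t).1 (+) (sort3 t).2.
Proof.
case: t => [[i j] k] /andP[/= u /and4P[hi hj hk _]].
move: u; rewrite !inE negb_or andbT => /andP[/andP[ij ik] jk]; rewrite /val3 /sort3.
have E := sgp chi (p := pt i) (q := pt j) (r := pt k).
have {}E : _ := E ltac:(by rewrite /= !inE negb_or !pt_neq).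
by do ![case: ifP => _]; rewrite /= ?E ?addbT ?addbF ?negbK.
Qed.

Definition balanced (s : seq tri) := all (fun t => ~~ odd (count_mem t s)) s.

Lemma xor_balanced (v : tri -> bool) s : balanced s -> \big[addb/false]_(t <- s) v t = false.
Proof.
move=> /allP b; rewrite -big_undup_iterop_count big_seq big1 // => t.
rewrite mem_undup => /b; move: (count_mem t s) => n; rewrite Monoid.iteropE.
suff -> : iter n (addb (v t)) false = odd n && v t by case: (odd n).
by elim: n => //= n ->; case: (odd n); case: (v t).
Qed.

(** When every sorted triple occurs an even number of times, the unknown signs cancel and only the
    computable sorting parities remain. *)
Lemma xor_sorted s : all valid3 s -> balanced [seq (sort3 t).1 | t <- s] ->
  \big[addb/false]_(t <- s) val3 t = \big[addb/false]_(t <- s) (sort3 t).2.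
Proof.
move=> /allP hv hb.
rewrite (eq_big_seq (fun t => val3 (sort3 t).1 (+) (sort3 t).2)); last first.
  by move=> t ht; apply: val3_sort; apply: hv.
rewrite big_split /=.
by have := xor_balanced val3 hb; rewrite big_map => ->.
Qed.

(** Seen from [p], no other element separates [q] from [r]: the sign of the product of the brackets
    [p q s] and [p r s] does not depend on [s]. *)
Definition flat_line p q r := forall s t, distinct V [:: p; q; r; s; t] ->
  sg p q s (+) sg p r s (+) sg p q t (+) sg p r t = false.

Definition check_line (lines : seq (seq nat)) (u : tri * (nat * nat)) :=
  let: ((i, j, k), (l, m)) := u in
  [&& uniq [:: i; j; k; l; m], all (fun i => i < size pts)%N [:: i; j; k; l; m] &
    has (perm_eq [:: i; j; k]) lines].

Definition line_terms (u : tri * (nat * nat)) :=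
  let: ((i, j, k), (l, m)) := u in [:: (i, j, l); (i, k, l); (i, j, m); (i, k, m)].

Lemma xor_lines lines cert :
  (forall i j k, has (perm_eq [:: i; j; k]) lines -> flat_line (pt i) (pt j) (pt k)) ->
  all (check_line lines) cert ->
  \big[addb/false]_(t <- flatten (map line_terms cert)) val3 t = false.
Proof.
move=> HL; elim: cert => [|[[[i j] k] [l m]] cert IH]; first by rewrite big_nil.
move=> /andP[/and3P[u b h] /IH E]; rewrite /= !big_cons E addbF /val3 /=.
have := HL i j k h (pt l) (pt m); rewrite -!addbA; apply.
have -> : [:: pt i; pt j; pt k; pt l; pt m] = map (nth x0 pts) [:: i; j; k; l; m] by [].
rewrite /distinct all_map map_inj_in_uniq; last first.
  move=> a c ha hc /eqP; rewrite nth_uniq; first by move/eqP.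
  - by move/allP: b; apply.
  - by move/allP: b; apply.
  - by case/andP: ptsV.
apply/andP; split=> //; apply/allP => a ha /=; case/andP: ptsV => _ /allP; apply.
by apply: mem_nth; move/allP: b; apply.
Qed.

End SignCertificates.

Section Configurations.
Variables (I : finType) (sg : I -> I -> I -> bool).
Hypothesis chi : chirotope sg.
Variables (V : {set I}).
Local Notation flat := (flat_line sg V).

Definition flat3 p q r := [/\ flat p q r, flat p r q & [/\ flat q p r, flat q r p, flat r p q & flat r q p]].

Lemma flat3_has (p : nat -> I) i j k l m n : flat3 (p l) (p m) (p n) ->
  perm_eq [:: i; j; k] [:: l; m; n] -> uniq [:: l; m; n] -> flat (p i) (p j) (p k).
Proof.
move=> [h1 h2 [h3 h4 h5 h6]] hp; rewrite -(perm_uniq hp) => u.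
have := perm_mem hp i; have := perm_mem hp j; have := perm_mem hp k.
rewrite !inE !eqxx ?orbT /= => /esym K /esym J /esym I'.
move: u; rewrite /= !inE negb_or andbT => /andP[/andP[]].
by case/or3P: I' => /eqP->; case/or3P: J => /eqP->; case/or3P: K => /eqP->; rewrite ?eqxx.
Qed.

(** The certificate solves a linear system over the field with two elements: its triples cancel in
    pairs, but the total sorting parity is odd. *)
Lemma no_fano e a a' b b' c c' : distinct V [:: e; a; a'; b; b'; c; c'] ->
  flat3 e a a' -> flat3 e b b' -> flat3 e c c' -> flat3 a b c -> flat3 a b' c' ->
  flat3 a' b c' -> flat3 a' b' c -> False.
Proof.
move=> hd h1 h2 h3 h4 h5 h6 h7; pose pts := [:: e; a; a'; b; b'; c; c'].
pose lines := [:: [:: 0; 1; 2]; [:: 0; 3; 4]; [:: 0; 5; 6]; [:: 1; 3; 5]; [:: 1; 4; 6];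
  [:: 2; 3; 6]; [:: 2; 4; 5]]%N.
have HL i j k : has (perm_eq [:: i; j; k]) lines ->
    flat (nth e pts i) (nth e pts j) (nth e pts k).
  rewrite /= orbF => /or4P[||| /or4P[]] H; by apply: flat3_has (nth e pts) _ _ _ _ _ _ _ H _.
pose cert := [:: ((0, 3, 4), (1, 6)); ((1, 4, 6), (2, 5)); ((1, 3, 5), (0, 6)); ((1, 0, 2), (4, 5));
  ((6, 2, 3), (1, 5)); ((5, 2, 4), (1, 6)); ((6, 0, 5), (3, 4))]%N.
have := xor_lines hd HL (cert := cert) isT.
rewrite (xor_sorted chi e hd) //; by rewrite unlock.
Qed.

(** No parity contradiction is used here; instead, two certificates show that the three products of
    the relation at [b'] among [e], [f], [a'], [c'] have the same sign, against [sg3]. *)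
Lemma no_maclane e f a a' b b' c c' : distinct V [:: e; f; a; a'; b; b'; c; c'] ->
  flat3 e a a' -> flat3 e b b' -> flat3 e c c' -> flat3 f a b -> flat3 f b' c ->
  flat3 f c' a' -> flat3 a b' c' -> flat3 b a' c -> False.
Proof.
move=> hd h1 h2 h3 h4 h5 h6 h7 h8; pose pts := [:: e; f; a; a'; b; b'; c; c'].
pose lines := [:: [:: 0; 2; 3]; [:: 0; 4; 5]; [:: 0; 6; 7]; [:: 1; 2; 4]; [:: 1; 5; 6];
  [:: 1; 7; 3]; [:: 2; 5; 7]; [:: 4; 3; 6]]%N.
have HL i j k : has (perm_eq [:: i; j; k]) lines ->
    flat (nth e pts i) (nth e pts j) (nth e pts k).
  rewrite /= orbF => /or4P[||| /or4P[|||/orP[]]] H; by apply: flat3_has (nth e pts) _ _ _ _ _ _ _ H _.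
pose cert1 := [:: ((3, 1, 7), (2, 5)); ((3, 4, 6), (0, 1)); ((7, 2, 5), (0, 3));
  ((1, 5, 6), (0, 2)); ((1, 7, 3), (0, 5)); ((1, 5, 6), (2, 3)); ((0, 6, 7), (1, 3));
  ((1, 2, 4), (0, 3)); ((0, 2, 3), (1, 7)); ((0, 4, 5), (1, 3))]%N.
pose cert2 := [:: ((4, 3, 6), (2, 5)); ((4, 3, 6), (0, 5)); ((4, 0, 5), (2, 7));
  ((1, 5, 6), (0, 2)); ((2, 0, 3), (4, 5)); ((5, 0, 4), (2, 7)); ((0, 2, 3), (1, 4));
  ((0, 6, 7), (1, 3)); ((2, 1, 4), (0, 6)); ((0, 6, 7), (3, 4)); ((5, 2, 7), (1, 3));
  ((1, 7, 3), (0, 5))]%N.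
pose X := [:: (5, 0, 1); (5, 3, 7)]%N; pose Y := [:: (5, 0, 3); (5, 7, 1)]%N.
pose Z := [:: (5, 0, 7); (5, 1, 3)]%N.
have K cert s : all (check_line pts lines) cert ->
    all (valid3 pts) (s ++ flatten (map line_terms cert)) ->
    balanced [seq (sort3 t).1 | t <- s ++ flatten (map line_terms cert)] ->
    \big[addb/false]_(t <- s) val3 sg pts e t =
    \big[addb/false]_(t <- s ++ flatten (map line_terms cert)) (sort3 t).2.
  move=> k1 k2 k3; rewrite -(xor_sorted chi e hd) // big_cat /=.
  by rewrite (xor_lines hd HL k1) addbF.
have E1 := K cert1 (Y ++ Z) isT isT isT.
have E2 := K cert2 (X ++ Z) isT isT isT.
have u : uniq [:: b'; e; f; a'; c'] by dcase hd; dsplit.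
apply: (sg3 chi u); move: E1 E2; rewrite !big_cat !big_cons !big_nil /val3 /= !addbF.
set r1 := sg _ _ _; set r2 := sg _ _ _; set r3 := sg _ _ _; set r4 := sg _ _ _;
set r5 := sg _ _ _; set r6 := sg _ _ _; rewrite /=.
by case: r1; case: r2; case: r3; case: r4; case: r5; case: r6.
Qed.

End Configurations.

(** * Blocks arising from more than three colours at every element *)

Section FewColours.
Variables (R : realType) (I : finType) (sg : I -> I -> I -> bool).
Hypothesis chi : chirotope sg.
Variables (V : {set I}) (x : I -> I -> I -> R).
Hypothesis V8 : (#|V| <= 8)%N.
Hypothesis xTD : TD sg V x.
Local Notation dst := (distinct V).
Local Notation sb e := (sb V e x).
Local Notation col e := (col V e x).
Local Notation dl e := (del e x).

(* In the tree of the contraction by [p], [q] and [r] are the leaves of a cherry. *)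
Definition cherry p q r := dst [:: p; q; r] /\ forall s t, dst [:: p; q; r; s; t] ->
  x p q s + x p r t < x p q r + x p s t.

Lemma cherryC p q r : cherry p q r -> cherry p r q.
Proof.
move=> [h H]; split; first by dcase h; dsplit.
move=> s t h'; have := H t s; case: xTD => -[_ s2] _.
rewrite (s2 p r q) (s2 p t s) => /(_ ltac:(dcase h'; dsplit)); lra.
Qed.

Lemma cherry_uniq p q r s t : cherry p q r -> cherry p q s -> dst [:: p; q; r; s; t] -> False.
Proof.
move=> [_ H] [_ K] h; have := H s t h.
have := K r t ltac:(dcase h; dsplit); case: xTD => -[_ s2] _; lra.
Qed.

(** The sum containing [x p q r] is strictly larger than the other two, so its product cannot be the
    isolated one, and the other two products have opposite signs. *)
Lemma cherry_flat p q r : cherry p q r -> flat_line sg V p q r.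
Proof.
move=> [_ H] s t h; have /andP[u _] := h.
have nsp : special sg p q r s t = false.
  apply/negP => sp; have [_ xr] := xTD; have := xr p q r s t h sp.
  have := H s t h; have := H t s ltac:(dcase h; dsplit); case: xTD => -[_ s2] _.
  by rewrite (s2 p t s) /ismin; lra.
move: nsp; rewrite /special (sgr chi (a := p) (b := r) (c := t)); last by dcase h; dsplit.
by case: (sg p q s); case: (sg p r s); case: (sg p q t); case: (sg p r t).
Qed.

Hypothesis many : forall e, e \in V -> ~ few_colours (V :\ e) (col e).

Lemma fresh_edge e k1 k2 k3 : e \in V ->
  exists a b, dst [:: e; a; b] /\ [/\ col e a b != k1, col e a b != k2 & col e a b != k3].
Proof.
move=> eV; apply: contrapT => H; apply: (many eV); exists k1, k2, k3 => a b.
rewrite distinctD1 // => h; rewrite !inE; apply: contraT; rewrite !negb_or => /and3P[h1 h2 h3].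
by case: H; exists a, b.
Qed.

Definition sees' e := sees (V :\ e) (col e).

Lemma common_colour : exists k0, forall e a, dst [:: e; a] -> sees' e a (k0 e).
Proof.
have K e : exists k0, forall a, dst [:: e; a] -> sees' e a k0.
  have [eV|eV] := boolP (e \in V); last first.
    by exists finset.set0 => a h; dcase h; case/negP: eV.
  have [a [b [h _]]] := fresh_edge finset.set0 finset.set0 finset.set0 eV.
  have aV : a \in V :\ e by dcase h; rewrite !inE eq_sym; apply/andP.
  have f2 a1 b1 c1 d1 : distinct (V :\ e) [:: a1; b1; c1; d1] ->
    [|| col e a1 b1 == col e a1 c1, col e a1 c1 == col e a1 d1 | col e a1 b1 == col e a1 d1].
    exact: col_two.
  have [k0 hk] := star_colour (@colC _ _ V e x) f2 aV (many eV).
  exists k0 => a' h'; apply: hk; dcase h'; rewrite !inE eq_sym; exact/andP.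
by have [k0 hk] := choice K; exists k0 => e a; apply: hk.
Qed.

Variable k0 : I -> {set I * I}.
Hypothesis k0P : forall e a, dst [:: e; a] -> sees' e a (k0 e).

Definition blk e p q := dst [:: e; p; q] /\ col e p q != k0 e.

Lemma blkC e p q : blk e p q -> blk e q p.
Proof. by move=> [h n]; split; [dcase h; dsplit | rewrite colC]. Qed.

Lemma sees_col e p q : dst [:: e; p; q] -> sees' e p (col e p q).
Proof. by move=> h; exists q => //; rewrite distinctD1 //; dcase h. Qed.

Lemma sees_two e p k l : dst [:: e; p] -> sees' e p k -> sees' e p l ->
  k != k0 e -> l != k0 e -> k = l.
Proof.
move=> hp h1 h2 nk nl; have eV : e \in V by dcase hp.
have f2 a1 b1 c1 d1 : distinct (V :\ e) [:: a1; b1; c1; d1] ->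
    [|| col e a1 b1 == col e a1 c1, col e a1 c1 == col e a1 d1 | col e a1 b1 == col e a1 d1].
  exact: col_two.
have := sees2 f2 h1 h2 (k0P hp); rewrite (negPf nk) (negPf nl) !orbF.
by move/eqP.
Qed.

Lemma blk_sees e p q : blk e p q -> sees' e p (col e p q) /\ sees' e q (col e p q).
Proof.
by move=> [h _]; split; [|rewrite colC]; apply: sees_col; dcase h; dsplit.
Qed.

Lemma sees_neq e u v k l : dst [:: e; u] -> sees' e u k -> sees' e v l ->
  k != k0 e -> l != k0 e -> k != l -> u != v.
Proof.
move=> h hu hv nk nl; apply: contraNneq => E; subst v; apply/eqP.
exact: sees_two h hu hv nk nl.
Qed.

Lemma blk_col e p q r : blk e p q -> dst [:: e; p; r] ->
  col e p r = k0 e \/ col e p r = col e p q.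
Proof.
move=> hb h; have [E|n] := eqVneq (col e p r) (k0 e); first by left.
right; have [h1 h2] := hb; have [s1 _] := blk_sees hb.
by apply: (@sees_two e p) => //; [dcase h; dsplit | exact: sees_col].
Qed.

Lemma blk_k0 e p q : blk e p q -> exists q0, [/\ dst [:: e; p; q; q0], col e p q0 = k0 e &
  ~~ act V e x p].
Proof.
move=> [h n]; have hp : dst [:: e; p] by dcase h; dsplit.
have [q0] := k0P hp; rewrite distinctD1; last by dcase h.
move=> hq E; have qq : q != q0 by apply: contraNneq n => ->; rewrite E.
have hd : dst [:: e; p; q; q0] by dcase h; dcase hq; dsplit.
by exists q0; split=> //; apply: contra n => /(col_act hd) ->; rewrite E.
Qed.

(** An element of a block sees two colours, so it is not [act]: its two root branches are told apart
    by colour. *)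
Lemma blk_sb e p q r s : blk e p q -> dst [:: e; p; r; s] -> col e p r = col e p s -> sb e p r s.
Proof.
move=> hb h E; have [q0 [hq E0 na]] := blk_k0 hb; have [hq1 nq] := hb.
apply: contraT => nrs.
have [t ht nt] : exists2 t, dst [:: e; p; t] & col e p t != col e p r.
  have [E1|n1] := eqVneq (col e p r) (k0 e); first by exists q => //; rewrite E1.
  by exists q0; [dcase hq; dsplit | rewrite E0 eq_sym].
have tr : r != t by apply: contraNneq nt => ->.
have ts : s != t by apply: contraNneq nt => <-; rewrite E.
dcase h; dcase ht.
have n1 : ~~ sb e p s t.
  by apply: contra nt => H; rewrite E (col_sb _ H) //; dsplit.
have n2 : ~~ sb e p r t.
  by apply: contra nt => H; rewrite (col_sb _ H) //; dsplit.
case/negP: na; apply/existsP; exists r; apply/existsP; exists s; apply/existsP; exists t.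
by apply/and4P; split=> //; dsplit.
Qed.

Lemma col_nsb e p r s : dst [:: e; p; r; s] -> col e p r != col e p s -> ~~ sb e p r s.
Proof. by move=> h; apply: contra => H; rewrite (col_sb h H). Qed.

Lemma three_edges e : e \in V -> exists a b c d f h, [/\ blk e a b, blk e c d, blk e f h &
  [/\ col e a b != col e c d, col e a b != col e f h & col e c d != col e f h]].
Proof.
move=> eV; have [a [b [h1 [n1 _ _]]]] := fresh_edge (k0 e) (k0 e) (k0 e) eV.
have [c [d [h2 [n2 m2 _]]]] := fresh_edge (k0 e) (col e a b) (col e a b) eV.
have [f [h [h3 [n3 m3 l3]]]] := fresh_edge (k0 e) (col e a b) (col e c d) eV.
by exists a, b, c, d, f, h; split; split=> //; rewrite eq_sym.
Qed.

Lemma other_edges e k : e \in V -> exists a b c d, [/\ blk e a b, blk e c d &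
  [/\ col e a b != k, col e c d != k & col e a b != col e c d]].
Proof.
move=> eV; have [a [b [c [d [f [h [h1 h2 h3 [n12 n13 n23]]]]]]]] := three_edges eV.
have [E|n] := eqVneq (col e a b) k.
  by exists c, d, f, h; split=> //; rewrite -E !(eq_sym _ (col e a b)).
have [E|n'] := eqVneq (col e c d) k.
  by exists a, b, f, h; split=> //; split=> //; rewrite -E eq_sym.
by exists a, b, c, d.
Qed.

(** Elements of blocks of different colours are different. A block with [p, q, r, s], two more pairs
    of other colours, and [e] would be nine elements. *)
Lemma blk_two e p q r s : blk e p q -> blk e p r -> blk e p s -> uniq [:: q; r; s] -> False.
Proof.
move=> hq hr hs uq; have [d1 nq] := hq; have [d2 _] := hr; have [d3 _] := hs.
have eV : e \in V by dcase d1.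
have [E|Er] := blk_col hq d2; first by case: hr => _; rewrite E eqxx.
have [E|Es] := blk_col hq d3; first by case: hs => _; rewrite E eqxx.
have [a [b [c [d [ha hc [na nc nac]]]]]] := other_edges (col e p q) eV.
have [sp sq] := blk_sees hq; have [_ sr] := blk_sees hr; have [_ ss] := blk_sees hs.
rewrite Er in sr; rewrite Es in ss.
have [sa sb'] := blk_sees ha; have [sc sd] := blk_sees hc.
have [da ka] := ha; have [dc kc] := hc.
have K u v : dst [:: e; u] -> sees' e u (col e p q) -> sees' e v (col e a b) -> u != v.
  by move=> h1 h2 h3; apply: (sees_neq h1 h2 h3) => //; rewrite eq_sym.
have L u v : dst [:: e; u] -> sees' e u (col e p q) -> sees' e v (col e c d) -> u != v.
  by move=> h1 h2 h3; apply: (sees_neq h1 h2 h3) => //; rewrite eq_sym.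
have M u v : dst [:: e; u] -> sees' e u (col e a b) -> sees' e v (col e c d) -> u != v.
  by move=> h1 h2 h3; apply: (sees_neq h1 h2 h3).
dcase d1; dcase d2; dcase d3; dcase da; dcase dc; dcase uq.
have ep : dst [:: e; p] by dsplit.
have eq_ : dst [:: e; q] by dsplit.
have er : dst [:: e; r] by dsplit.
have es : dst [:: e; s] by dsplit.
have ea : dst [:: e; a] by dsplit.
have eb : dst [:: e; b] by dsplit.
have := K _ _ ep sp sa; have := K _ _ ep sp sb'; have := K _ _ eq_ sq sa; have := K _ _ eq_ sq sb'.
have := K _ _ er sr sa; have := K _ _ er sr sb'; have := K _ _ es ss sa; have := K _ _ es ss sb'.
have := L _ _ ep sp sc; have := L _ _ ep sp sd; have := L _ _ eq_ sq sc; have := L _ _ eq_ sq sd.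
have := L _ _ er sr sc; have := L _ _ er sr sd; have := L _ _ es ss sc; have := L _ _ es ss sd.
have := M _ _ ea sa sc; have := M _ _ ea sa sd; have := M _ _ eb sb' sc; have := M _ _ eb sb' sd.
do 20 (let h := fresh "m" in move=> h).
by apply: (@no_nine _ _ V8 [:: e; p; q; r; s; a; b; c; d]) => //; dsplit.
Qed.

(** At [p] the element [q] is a whole root branch, and all others form the second one. As [e] sits
    at the root, [q] and [e] form a cherry. *)
Lemma blk1_cherry e p q : blk e p q -> (forall r, blk e p r -> r = q) -> cherry p q e.
Proof.
move=> hb H; have [h n] := hb; split; first by dcase h; dsplit.
move=> s t h'; dcase h'.
have K u : dst [:: e; p; u] -> q != u -> col e p u = k0 e.
  move=> hu qu; apply/eqP; apply: contraT => nu.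
  by move: qu; rewrite (H u) ?eqxx.
have sk : col e p s = k0 e by apply: K; dsplit.
have tk : col e p t = k0 e by apply: K; dsplit.
have d1 : dst [:: e; p; s; t; q] by dsplit.
have s1 : sb e p s t by apply: blk_sb hb _ _; [dsplit | rewrite sk tk].
have n1 : ~~ sb e p s q by apply: col_nsb; [dsplit | rewrite sk eq_sym].
have [lt _] := sb_lt chi xTD d1 s1 n1; move: lt; rewrite /del.
case: xTD => -[_ s2] _; rewrite (s2 p s q) (s2 p e t); lra.
Qed.

(** By [blk_two] one of the two root branches at [p] consists of [q] and [r] only. *)
Lemma blk2_cherry e p q r : blk e p q -> blk e p r -> q != r -> cherry p q r.
Proof.
move=> hq hr qr; have [d1 nq] := hq; have [d2 nr] := hr.
have hd : dst [:: e; p; q; r] by dcase d1; dcase d2; dsplit.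
have E : col e p r = col e p q.
  by have [E|//] := blk_col hq d2; move: nr; rewrite E eqxx.
have s0 : sb e p q r by apply: blk_sb hq hd _.
split; first by dcase hd; dsplit.
move=> s t h'; dcase h'; dcase hd.
have K u : dst [:: e; p; u] -> q != u -> r != u -> col e p u = k0 e.
  move=> hu qu ru; apply/eqP; apply: contraT => nu.
  by case: (@blk_two e p q r u hq hr) => //; dsplit.
have n1 u : e != u -> p != u -> q != u -> r != u -> u \in V -> ~~ sb e p q u.
  by move=> ? ? ? ? ?; apply: col_nsb; [dsplit | rewrite (K u) //; dsplit].
case: (xTD) => -[_ s2] _.
have L u : e != u -> p != u -> q != u -> r != u -> u \in V ->
    dl e p q u < dl e p q r /\ dl e p r u = dl e p q u.
  move=> h1 h2 h3 h4 h5; apply: (sb_lt chi xTD) => //; [dsplit | exact: n1].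
have [es|es] := eqVneq e s.
  subst s; have [l1 l2] := L t ltac:(by []) ltac:(by []) ltac:(by []) ltac:(by []) ltac:(by []).
  by move: l1; rewrite -l2 /del (s2 p e t); lra.
have [et|et] := eqVneq e t.
  subst t; have [l1 l2] := L s ltac:(by rewrite eq_sym) ltac:(by []) ltac:(by []) ltac:(by []) ltac:(by []).
  by move: l1; rewrite /del; lra.
have [l1 l2] := L s ltac:(by []) ltac:(by []) ltac:(by []) ltac:(by []) ltac:(by []).
have [l3 l4] := L t ltac:(by []) ltac:(by []) ltac:(by []) ltac:(by []) ltac:(by []).
have st : sb e p s t by apply: blk_sb hq _ _; [dsplit | rewrite !K //; dsplit].
have d5 : dst [:: e; p; s; t; q] by dsplit.
have n5 : ~~ sb e p s q by rewrite (sbC chi xTD) ?n1 //; dsplit.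
have [l5 l6] := sb_lt chi xTD d5 st n5.
move: l1 l2 l3 l4 l5 l6; rewrite /del (s2 p s q) (s2 p t q); lra.
Qed.

(** All elements but [q] are in one branch at [p]. If [q'] were among them, [q] would carry the
    common colour, and both elements of a block of another colour would have to be [q]. *)
Lemma cherry_blk e p q q' : cherry p q e -> blk e p q' ->
  blk e p q /\ forall r, blk e p r -> r = q.
Proof.
move=> [hd H] hb; have [h' n'] := hb; have eV : e \in V by dcase h'.
have S s t : dst [:: e; p; s; t] -> q != s -> q != t -> sb e p s t.
  move=> h qs qt; dcase h; dcase hd; apply/orP; right; apply/existsP; exists q.
  apply/andP; split; first by dsplit.
  have := H s t ltac:(dsplit); rewrite /del; case: xTD => -[_ s2] _.
  by rewrite (s2 p s q) (s2 p e t); lra.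
have only q0 r : dst [:: e; p; q0] -> col e p q0 = k0 e -> blk e p r -> q != r -> q0 = q.
  move=> h0 E [hr nr] qr; apply/eqP; apply: contraT; rewrite eq_sym => n.
  have q0r : q0 != r by apply: contraNneq nr => <-; rewrite E.
  have h : dst [:: e; p; q0; r] by dcase h0; dcase hr; dsplit.
  by move: nr; rewrite -(col_sb h (S _ _ h n qr)) E eqxx.
have Eq : q' = q.
  apply/eqP; apply: contraT; rewrite eq_sym => nqq.
  have [a [b [_ [_ [ha _ [na _ _]]]]]] := other_edges (col e p q') eV.
  have [sp sq] := blk_sees hb; have [sa sb'] := blk_sees ha; have [da ka] := ha.
  have ep : dst [:: e; p] by dcase h'; dsplit.
  have K u : dst [:: e; u] -> sees' e u (col e a b) -> u = q.
    move=> eu su; have pu : p != u.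
      by apply: (sees_neq ep sp su) => //; rewrite eq_sym.
    have hpu : dst [:: e; p; u] by dcase ep; dcase eu; dsplit.
    apply: (only u q') => //; have [//|E] := blk_col hb hpu.
    have su' : sees' e u (col e p q').
      by rewrite -E colC; apply: sees_col; dcase hpu; dsplit.
    by have E2 := sees_two eu su su' ka n'; rewrite E2 eqxx in na.
  have Ea : a = q by apply: K => //; dcase da; dsplit.
  have Eb : b = q by apply: K => //; dcase da; dsplit.
  by subst a b; dcase da; dsub.
subst q'; split=> // r hr; apply/eqP; apply: contraT; rewrite eq_sym => qr.
have [q0 [h0 E _]] := blk_k0 hb.
have E0 : q0 = q by apply: (only q0 r) => //; dcase h0; dsplit.
by subst q0; dcase h0; dsub.
Qed.

Lemma edges_distinct e a b c d f h : blk e a b -> blk e c d -> blk e f h ->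
  [/\ col e a b != col e c d, col e a b != col e f h & col e c d != col e f h] ->
  dst [:: e; a; b; c; d; f; h].
Proof.
move=> ha hc hf [n1 n2 n3].
have [sa sb'] := blk_sees ha; have [sc sd] := blk_sees hc; have [sf sh] := blk_sees hf.
have [da ka] := ha; have [dc kc] := hc; have [df kf] := hf.
have D v w : dst [:: e; v; w] -> dst [:: e; v] /\ dst [:: e; w] by move=> hd; dcase hd; split; dsplit.
have [ea eb] := D _ _ da; have [ec ed] := D _ _ dc; have [ef eh] := D _ _ df.
have X1 := sees_neq ea sa sc ka kc n1; have X2 := sees_neq ea sa sd ka kc n1.
have X3 := sees_neq ea sa sf ka kf n2; have X4 := sees_neq ea sa sh ka kf n2.
have Y1 := sees_neq eb sb' sc ka kc n1; have Y2 := sees_neq eb sb' sd ka kc n1.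
have Y3 := sees_neq eb sb' sf ka kf n2; have Y4 := sees_neq eb sb' sh ka kf n2.
have Z1 := sees_neq ec sc sf kc kf n3; have Z2 := sees_neq ec sc sh kc kf n3.
have Z3 := sees_neq ed sd sf kc kf n3; have Z4 := sees_neq ed sd sh kc kf n3.
by dcase da; dcase dc; dcase df; dsplit.
Qed.

(** Besides the common colour an element sees at most one, so blocks of different colours are
    disjoint; the last premise keeps the eighth element out of two of them. *)
Lemma frame_from e a b c d f h g : e \in V ->
  blk e a b -> blk e c d -> blk e f h ->
  [/\ col e a b != col e c d, col e a b != col e f h & col e c d != col e f h] ->
  (forall p, p \in V -> p \in [:: e; a; b; c; d; f; h; g]) ->
  (g != e -> [/\ g \in V, ~ sees' e g (col e c d) & ~ sees' e g (col e f h)]) ->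
  [/\ dst [:: e; a; b; c; d; f; h],
      [/\ blk e a b, pr blk e c d & pr blk e f h] &
      [/\ forall p, blk e a p -> p \in [:: b; g], forall p, blk e b p -> p \in [:: a; g]
        & forall p, blk e g p -> p \in [:: a; b]]].
Proof.
move=> eV ha hc hf [n1 n2 n3] cov hg.
have [sa sb'] := blk_sees ha; have [sc sd] := blk_sees hc; have [sf sh] := blk_sees hf.
have [da ka] := ha; have [dc kc] := hc; have [df kf] := hf.
set k1 := col e a b in ka n1 n2 sa sb'; set k2 := col e c d in kc n1 n3 sc sd hg.
set k3 := col e f h in kf n2 n3 sf sh hg.
have n21 : k2 != k1 by rewrite eq_sym.
have n31 : k3 != k1 by rewrite eq_sym.
have n32 : k3 != k2 by rewrite eq_sym.
have D v w : dst [:: e; v; w] -> dst [:: e; v] /\ dst [:: e; w] by move=> hd; dcase hd; split; dsplit.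
have [ea eb] := D _ _ da; have [ec ed] := D _ _ dc; have [ef eh] := D _ _ df.
have hd7 := edges_distinct ha hc hf (And3 n1 n2 n3).

have nb u k p : dst [:: e; u] -> sees' e u k -> k != k0 e -> blk e u p -> sees' e p k.
  move=> hu su nk hb; have [s1 s2] := blk_sees hb; have [_ n] := hb.
  by rewrite (sees_two hu su s1 nk n).
have ng p k : k \in [:: k2; k3] -> p = g -> p != e -> sees' e p k -> False.
  by move=> hk -> /hg[_ h1 h2]; move: hk; rewrite !inE => /orP[]/eqP->.
have cls p k : k \in [:: k1; k2; k3] -> dst [:: e; p] -> sees' e p k -> k != k0 e ->
   [|| (k == k1) && (p \in [:: a; b; g]), (k == k2) && (p \in [:: c; d]) |
       (k == k3) && (p \in [:: f; h])].
  move=> hk hp sp nk; have pV : p \in V by dcase hp.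
  have pe : p != e by dcase hp; rewrite eq_sym.
  have N u l : dst [:: e; u] -> sees' e u l -> l != k0 e -> k != l -> (p == u) = false.
    by move=> hu su nl kl; apply/negbTE; rewrite eq_sym; apply: (sees_neq hu su sp) => //; rewrite eq_sym.
  have Na := N a k1 ea sa ka; have Nb := N b k1 eb sb' ka.
  have Nc := N c k2 ec sc kc; have Nd := N d k2 ed sd kc.
  have Nf := N f k3 ef sf kf; have Nh := N h k3 eh sh kf.
  have Ng : k != k1 -> (p == g) = false.
    move=> nk1; apply/negbTE/eqP => E; apply: (ng p k) => //.
    by move: hk; rewrite !inE (negPf nk1).
  have := cov p pV; rewrite !inE (negPf pe) /=.
  move: hk; rewrite !inE => /or3P[]/eqP E; rewrite E in Na Nb Nc Nd Nf Nh Ng *.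
  - by rewrite Nc // Nd // Nf // Nh //= eqxx (negPf n1) (negPf n2) /= !orbF.
  - by rewrite Na // Nb // Nf // Nh // Ng //= eqxx (negPf n21) (negPf n3) /= !orbF.
  - by rewrite Na // Nb // Nc // Nd // Ng //= eqxx (negPf n31) (negPf n32) /= !orbF.
have B u k p : k \in [:: k1; k2; k3] -> dst [:: e; u] -> sees' e u k -> k != k0 e -> blk e u p ->
   p != u /\ [|| (k == k1) && (p \in [:: a; b; g]), (k == k2) && (p \in [:: c; d]) |
       (k == k3) && (p \in [:: f; h])].
  move=> hk hu su nk hb; have [hd _] := hb; split; first by dcase hd; rewrite eq_sym.
  apply: cls => //; first by dcase hd; dsplit.
  exact: nb hu su nk hb.
have i1 : k1 \in [:: k1; k2; k3] by rewrite !inE eqxx.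
have i2 : k2 \in [:: k1; k2; k3] by rewrite !inE eqxx orbT.
have i3 : k3 \in [:: k1; k2; k3] by rewrite !inE eqxx !orbT.
split=> //; split=> //.
- split=> // r hr.
    have [n] := B c k2 r i2 ec sc kc hr; rewrite !inE eqxx (negPf n21) (negPf n3) (negPf n) /= orbF.
    by move/eqP.
  have [n] := B d k2 r i2 ed sd kc hr; rewrite !inE eqxx (negPf n21) (negPf n3) (negPf n) /= !orbF.
  by move/eqP.
- split=> // r hr.
    have [n] := B f k3 r i3 ef sf kf hr; rewrite !inE eqxx (negPf n31) (negPf n32) (negPf n) /=.
    by move/eqP.
  have [n] := B h k3 r i3 eh sh kf hr; rewrite !inE eqxx (negPf n31) (negPf n32) (negPf n) /= !orbF.
  by move/eqP.
- move=> r hr; have [n] := B a k1 r i1 ea sa ka hr.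
  by rewrite !inE eqxx (negPf n1) (negPf n2) (negPf n) /= !orbF.
- move=> r hr; have [n] := B b k1 r i1 eb sb' ka hr.
  by rewrite !inE eqxx (negPf n1) (negPf n2) (negPf n) /= !orbF.
- move=> r hr; have [hd _] := hr; have [E|ge] := eqVneq g e; first by subst g; dcase hd; dsub.
  have [_ g2 g3] := hg ge; have rV : r \in V by dcase hd.
  have re : r != e by dcase hd; rewrite eq_sym.
  have rg : r != g by dcase hd; rewrite eq_sym.
  have := cov r rV; rewrite !inE (negPf re) (negPf rg) /= orbF.
  have G u k : dst [:: e; u] -> sees' e u k -> k != k0 e -> ~ sees' e g k -> (r == u) = false.
    move=> hu su nk hgk; apply/negbTE/eqP => E; subst r; apply: hgk.
    exact: nb hu su nk (blkC hr).
  by rewrite (G c k2) // (G d k2) // (G f k3) // (G h k3) //= !orbF.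
Qed.

Lemma blk_frame e : e \in V -> exists a b c d f h g,
  [/\ dst [:: e; a; b; c; d; f; h], forall p, p \in V -> p \in [:: e; a; b; c; d; f; h; g],
      [/\ blk e a b, pr blk e c d & pr blk e f h] &
      [/\ forall p, blk e a p -> p \in [:: b; g], forall p, blk e b p -> p \in [:: a; g]
        & forall p, blk e g p -> p \in [:: a; b]]].
Proof.
move=> eV; have [a [b [c [d [f [h [ha hc hf [n1 n2 n3]]]]]]]] := three_edges eV.
have hd7 := edges_distinct ha hc hf (And3 n1 n2 n3).
have [g [cov hg]] : exists g, (forall p, p \in V -> p \in [:: e; a; b; c; d; f; h; g]) /\
    (g != e -> g \in V).
  have [/existsP[g /andP[gV gL]]|/existsPn N] :=
    boolP [exists g, (g \in V) && (g \notin [:: e; a; b; c; d; f; h])].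
    exists g; split=> // p pV; apply: contraT => np.
    case: (@no_nine _ _ V8 [:: p; g; e; a; b; c; d; f; h]) => //.
    have pg : p \notin [:: g; e; a; b; c; d; f; h].
      apply: contra np; rewrite !inE; do 7 (case/orP; [by move=> ->; rewrite ?orbT|]).
      by move=> ->; rewrite ?orbT.
    by case/andP: hd7 => u7 v7; rewrite /distinct (cons_uniq p) pg (cons_uniq g) gL u7 /= pV gV.
  exists e; split=> [p pV|]; last by rewrite eqxx.
  have := N p; rewrite pV negbK /= !inE.
  by do 6 (case/orP; [by move=> ->; rewrite ?orbT|]); move=> ->; rewrite ?orbT.
have two k l : g != e -> sees' e g k -> sees' e g l -> k != k0 e -> l != k0 e -> k != l -> False.
  move=> ge h1 h2 nk nl /eqP; apply; apply: (@sees_two e g) => //.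
  by have := hg ge => gV; rewrite eq_sym in ge; dsplit.
have [_ ka] := ha; have [_ kc] := hc; have [_ kf] := hf.
have covS s : perm_eq [:: e; a; b; c; d; f; h; g] s -> forall p, p \in V -> p \in s.
  by move=> /perm_mem E p /cov; rewrite E.
(* The blocks are relabelled so that the one which the eighth element may join comes first. *)
have [s2|ns2] := pselect (g != e /\ sees' e g (col e c d)).
  have [ge s2'] := s2.
  have hp : perm_eq [:: e; a; b; c; d; f; h; g] [:: e; c; d; a; b; f; h; g].
    rewrite perm_cons; change (perm_eq (([:: a; b] ++ [:: c; d]) ++ [:: f; h; g]) (([:: c; d] ++ [:: a; b]) ++ [:: f; h; g])).
    by rewrite perm_cat2r perm_catC.
  have hn : [/\ col e c d != col e a b, col e c d != col e f h & col e a b != col e f h].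
    by rewrite eq_sym.
  have F := @frame_from e c d a b f h g eV hc ha hf hn (covS _ hp).
  exists c, d, a, b, f, h, g; have [] := F; last by move=> F1 F2 F3; split=> //; apply: covS.
  by move=> _; split; [exact: hg | move=> t; apply: (two _ _ ge t s2') | move=> t; apply: (two _ _ ge s2' t)].
have [s3|ns3] := pselect (g != e /\ sees' e g (col e f h)).
  have [ge s3'] := s3.
  have hp : perm_eq [:: e; a; b; c; d; f; h; g] [:: e; f; h; a; b; c; d; g].
    rewrite perm_cons; change (perm_eq (([:: a; b; c; d] ++ [:: f; h]) ++ [:: g]) (([:: f; h] ++ [:: a; b; c; d]) ++ [:: g])).
    by rewrite perm_cat2r perm_catC.
  have hn : [/\ col e f h != col e a b, col e f h != col e c d & col e a b != col e c d].
    by rewrite eq_sym n2 eq_sym n3.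
  have F := @frame_from e f h a b c d g eV hf ha hc hn (covS _ hp).
  exists f, h, a, b, c, d, g; have [] := F; last by move=> F1 F2 F3; split=> //; apply: covS.
  by move=> _; split; [exact: hg | move=> t; apply: (two _ _ ge t s3') | move=> t; apply: (two _ _ ge t s3')].
exists a, b, c, d, f, h, g; have [] := @frame_from e a b c d f h g eV ha hc hf (And3 n1 n2 n3) cov.
  by move=> ge; split; [exact: hg | move=> t; apply: ns2 | move=> t; apply: ns3].
by move=> F1 F2 F3; split.
Qed.

Lemma no_star : (exists e, e \in V) -> False.
Proof.
move=> [e0 e0V].
have [? [? [? [? [? [? [? [hd1 _ _ _]]]]]]]] := blk_frame e0V.
have C1 p q r s : cherry p q r -> cherry p q s -> r = s.
  move=> h h'; have [//|rs] := eqVneq r s; exfalso; have [dr _] := h; have [ds _] := h'.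
  have [t [tV tn]] : exists t, t \in V /\ t \notin [:: p; q; r; s].
    have [/existsP[t /andP[tV tn]]|/existsPn N] :=
      boolP [exists t, (t \in V) && (t \notin [:: p; q; r; s])]; first by exists t.
    have /subset_leq_card : V \subset [:: p; q; r; s].
      by apply/fintype.subsetP => z zV; have := N z; rewrite zV /= negbK.
    by move=> le; have := leq_trans (distinct_card hd1) (leq_trans le (card_size _)).
  apply: (cherry_uniq h h' (t := t)).
  by dcase dr; dcase ds; move: tn; rewrite !inE !negb_or => /and4P[? ? ? ?]; dsplit.
have Bd e p q : blk e p q -> dst [:: e; p; q] by case.
have F3 p q r : cherry p q r -> cherry q p r -> cherry r p q -> flat3 sg V p q r.
  move=> h1 h2 h3; split; [exact: cherry_flat | exact/cherry_flat/cherryC |].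
  split; [exact: cherry_flat | exact/cherry_flat/cherryC | exact: cherry_flat | exact/cherry_flat/cherryC].
have K := B_pr V8 cherryC C1 Bd blkC blk1_cherry blk2_cherry cherry_blk blk_frame.
have A := B_apex V8 cherryC C1 Bd blkC blk1_cherry blk2_cherry cherry_blk blk_frame.
have P e p q : blk e p q -> flat3 sg V e p q.
  move=> h; apply: F3; first exact: A.
    by apply/cherryC/(pr_Ch blk1_cherry (K _ _ _ h)).
  by apply/cherryC/(pr_Ch blk1_cherry)/K/blkC.
have := fano_or_maclane V8 cherryC C1 Bd blkC blk1_cherry blk2_cherry cherry_blk blk_frame.
case; first by exists e0.
- move=> [e [a [a' [b [b' [c [c' [hd [k1 k2 k3 [k4 k5 k6 k7]]]]]]]]]].
  by apply: (no_fano chi hd); apply: P.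
- move=> [e [f [a [a' [b [b' [c [c' [hd [k1 k2 k3 [k4 k5 k6 k7 k8]]]]]]]]]]].
  by apply: (no_maclane chi hd); apply: P.
Qed.

End FewColours.

Lemma few_colours_ex (R : realType) (I : finType) (sg : I -> I -> I -> bool) (V : {set I})
    (x : I -> I -> I -> R) e0 :
  chirotope sg -> (#|V| <= 8)%N -> TD sg V x -> e0 \in V ->
  exists2 e, e \in V & few_colours (V :\ e) (col V e x).
Proof.
move=> chi V8 xTD e0V; apply: contrapT => H.
have many e : e \in V -> ~ few_colours (V :\ e) (col V e x).
  by move=> eV h; apply: H; exists e.
have [k0 hk] := common_colour many.
by apply: (no_star chi V8 xTD many hk); exists e0.
Qed.

(** * Stars and generic points *)

Lemma fin_small (R : realType) (T : finType) (P : T -> R -> Prop) :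
  (forall t, exists2 e, 0 < e & forall s, 0 <= s -> s <= e -> P t s) ->
  exists2 e, 0 < e & forall s, 0 <= s -> s <= e -> forall t, P t s.
Proof.
move=> H; pose Q t (r : R) := forall s, 0 <= s -> s * Num.max r 1 <= 1 -> P t s.
have [r hr] : exists r, forall t, Q t r.
  apply: fin_bound => [t r r' le h s s0 hs|t].
    apply: h => //; apply: le_trans hs; apply: ler_wpM2l => //.
    by rewrite ge_max !le_max le lexx orbT.
  have [e e0 he] := H t; exists e^-1 => s s0 hs; apply: he => //.
  have : s * e^-1 <= 1.
    by apply: le_trans hs; apply: ler_wpM2l => //; rewrite le_max lexx.
  by rewrite ler_pdivrMr // mul1r.
have m0 : 0 < Num.max r 1 by rewrite lt_max ltr01 orbT.
exists (Num.max r 1)^-1; first by rewrite invr_gt0.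
by move=> s s0 hs t; apply: hr => //; rewrite -ler_pdivlMr // div1r.
Qed.

Lemma lt_small (R : realType) (a b a' b' : R) : a < b ->
  exists2 e, 0 < e & forall t, 0 <= t -> t <= e -> a + t * a' < b + t * b'.
Proof.
move=> ab; pose N := `|a'| + `|b'| + 1.
have N0 : 0 < N by rewrite ltr_wpDl // addr_ge0.
exists ((b - a) / 2 / N); first by rewrite !divr_gt0 ?subr_gt0.
move=> t t0; rewrite ler_pdivlMr // => ht.
have := ler_norm a'; have := ler_norm (- b'); rewrite normrN => hb ha.
have : t * (a' - b') <= t * N by apply: ler_wpM2l => //; rewrite /N; lra.
lra.
Qed.

Section Stars.
Variables (R : realType) (I : finType) (sg : I -> I -> I -> bool).
Variables (V : {set I}).
Local Notation dst := (distinct V).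
Implicit Types x w v : I -> I -> I -> R.

Definition agree V x y := forall a b c, distinct V [:: a; b; c] -> x a b c = y a b c.

Lemma St_agree x w w' : sym3 w' -> agree V w w' -> St sg V x w -> St sg V x w'.
Proof.
move=> s' ag [_ H]; split=> // p a b c d h sp; have := H p a b c d h sp.
by apply: smin_eq => //; rewrite !ag //; dcase h; dsplit.
Qed.

Lemma Lin_agree x w w' : sym3 w' -> agree V w w' -> Lin sg V x w -> Lin sg V x w'.
Proof.
move=> s' ag [_ H]; split=> // p a b c d h sp; have := H p a b c d h sp.
by rewrite !ag //; dcase h; dsplit.
Qed.

Lemma sym3_tadd x w t : sym3 x -> sym3 w -> sym3 (tadd x w t).
Proof. by move=> [a1 a2] [b1 b2]; split=> a b c; rewrite /tadd ?(a1 a) ?(b1 a) // a2 b2. Qed.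

Lemma sym3Z c w : sym3 w -> sym3 (fun p q r => c * w p q r).
Proof. by move=> [b1 b2]; split=> p q r; [rewrite b1 | rewrite b2]. Qed.

Lemma Lin_add x w w' c : Lin sg V x w -> Lin sg V x w' -> Lin sg V x (tadd w w' c).
Proof.
move=> [s1 H1] [s2 H2]; split; first exact: sym3_tadd.
move=> p a b d f h sp; have [k1 k2 k3] := H1 p a b d f h sp; have [l1 l2 l3] := H2 p a b d f h sp.
rewrite /tadd; split=> lt.
- by have := k1 lt; have := l1 lt; move=> e1 e2; rewrite addrACA -mulrDr e1 e2; ring.
- by have := k2 lt; have := l2 lt; move=> e1 e2; rewrite addrACA -mulrDr e1 e2; ring.
- have [e1 e2] := k3 lt; have [e3 e4] := l3 lt; rewrite addrACA -mulrDr.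
  by split; rewrite addrACA -mulrDr; congr (_ + _ * _).
Qed.

Lemma Lin_scale x w c : Lin sg V x w -> Lin sg V x (fun p q r => c * w p q r).
Proof.
move=> [s1 H1]; split; first exact: sym3Z.
move=> p a b d f h sp; have [k1 k2 k3] := H1 p a b d f h sp.
rewrite -!mulrDr; split=> lt; first by rewrite k1.
  by rewrite k2.
by have [<- <-] := k3 lt.
Qed.

Lemma St_Lin_add x w w' c : St sg V x w -> Lin sg V x w' -> St sg V x (tadd w w' c).
Proof.
move=> [s1 H1] [s2 H2]; split; first exact: sym3_tadd.
move=> p a b d f h sp; have [k1 k2 k3] := H1 p a b d f h sp; have [l1 l2 l3] := H2 p a b d f h sp.
rewrite /tadd; split=> lt.
- by have := k1 lt; have := l1 lt; move=> e1 e2; rewrite addrACA -mulrDr e1 e2; ring.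
- by have := k2 lt; have := l2 lt; move=> e1 e2; rewrite addrACA -mulrDr e1 e2; ring.
- have [e3 e4] := l3 lt; rewrite addrACA -mulrDr (addrACA (w p a d)) -mulrDr (addrACA (w p a f)) -mulrDr.
  rewrite -e3 -e4; move: (k3 lt); rewrite /ismin; lra.
Qed.

Lemma St_scale x w c : 0 <= c -> St sg V x w -> St sg V x (fun p q r => c * w p q r).
Proof.
move=> c0 [s1 H1]; split; first exact: sym3Z.
move=> p a b d f h sp; have [k1 k2 k3] := H1 p a b d f h sp.
rewrite -!mulrDr; split=> lt; first by rewrite k1.
  by rewrite k2.
by apply: isminZ => //; apply: k3.
Qed.

Lemma LinP x w : Lin sg V x w <-> St sg V x w /\ St sg V x (fun p q r => - w p q r).
Proof.
split=> [[s H]|[[s H] [_ K]]].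
  split; first by split=> // p a b c d h sp; apply: slinW; apply: H.
  split; first by case: s => s1 s2; split=> p q r; [rewrite s1 | rewrite s2].
  by move=> p a b c d h sp; have /slinP[_] := H p a b c d h sp; rewrite !opprD.
split=> // p a b c d h sp; apply/slinP; split; first exact: H.
by rewrite !opprD; apply: K.
Qed.

Lemma Lin_St x w : Lin sg V x w -> St sg V x w.
Proof. by move/LinP => []. Qed.

Lemma St_TD x w : TD sg V x -> St sg V x w ->
  exists2 e, 0 < e & forall t, 0 <= t -> t <= e -> TD sg V (tadd x w t).
Proof.
move=> [xs xr] [ws wr]; pose T := (I * I * I * I * I)%type.
pose P (u : T) t := let: (p, a, b, c, d) := u in dst [:: p; a; b; c; d] -> special sg p a b c d ->
  ismin (tadd x w t p a b + tadd x w t p c d) (tadd x w t p a c + tadd x w t p b d)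
        (tadd x w t p a d + tadd x w t p b c).
have [e e0 he] : exists2 e, 0 < e & forall t, 0 <= t -> t <= e -> forall u, P u t.
  apply: fin_small => -[[[[p a] b] c] d].
  have [h|h] := boolP (dst [:: p; a; b; c; d]); last by exists 1 => // s _ _ /=; rewrite (negPf h).
  have [sp|sp] := boolP (special sg p a b c d); last by exists 1 => // s _ _ /=; rewrite (negPf sp).
  have [e e0 he] := smin_small (xr _ _ _ _ _ h sp) (wr _ _ _ _ _ h sp).
  exists e => // s s0 se _ _; have := he s s0 se.
  by rewrite /tadd !mulrDr /ismin; lra.
exists e => // t t0 te; split; first exact: sym3_tadd.
by move=> p a b c d; exact: (he t t0 te (p, a, b, c, d)).
Qed.

Lemma TD_St x w e : TD sg V x -> sym3 w -> 0 < e ->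
  (forall t, 0 < t -> t <= e -> TD sg V (tadd x w t)) -> St sg V x w.
Proof.
move=> [xs xr] ws e0 H; split=> // p a b c d h sp.
apply: (small_smin (xr _ _ _ _ _ h sp) e0) => t t0 te.
have [_ /(_ _ _ _ _ _ h sp)] := H t t0 te.
by rewrite /tadd !mulrDr /ismin; lra.
Qed.

(** [y] lies in the closed cell of [x]. *)
Definition compat (x y : I -> I -> I -> R) := forall p a b c d, dst [:: p; a; b; c; d] ->
  (x p a b + x p c d < x p a c + x p b d -> y p a b + y p c d <= y p a c + y p b d) /\
  (x p a b + x p c d = x p a c + x p b d -> y p a b + y p c d = y p a c + y p b d).

Lemma compat_refl x : compat x x.
Proof. by move=> p a b c d h; split=> // /ltW. Qed.

Definition pat x : {set I * I * I * I * I} :=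
  [set u | let: (p, a, b, c, d) := u in
    dst [:: p; a; b; c; d] && (x p a b + x p c d < x p a c + x p b d)].

Lemma pat_lt x p a b c d : ((p, a, b, c, d) \in pat x) =
  dst [:: p; a; b; c; d] && (x p a b + x p c d < x p a c + x p b d).
Proof. by rewrite inE. Qed.

Lemma compat_pat x y z : pat x = pat y -> compat x z -> compat y z.
Proof.
move=> E H p a b c d h; have [H1 H2] := H p a b c d h.
have h' : dst [:: p; a; c; b; d] by dcase h; dsplit.
have := pat_lt x p a b c d; have := pat_lt x p a c b d.
rewrite E !pat_lt h h' /= => e1 e2; split.
  by rewrite e2 => /H1.
move=> e3; apply: H2; rewrite e3 ltxx in e1 e2.
by apply/eqP; rewrite eq_le !leNgt -e1 -e2.
Qed.

Definition generic x := forall w, St sg V x w -> Lin sg V x w.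

Lemma strict_small x w : exists2 e, 0 < e & forall t, 0 <= t -> t <= e ->
  forall p a b c d, x p a b + x p c d < x p a c + x p b d ->
  tadd x w t p a b + tadd x w t p c d < tadd x w t p a c + tadd x w t p b d.
Proof.
pose P (u : I * I * I * I * I) t := let: (p, a, b, c, d) := u in
  x p a b + x p c d < x p a c + x p b d ->
  tadd x w t p a b + tadd x w t p c d < tadd x w t p a c + tadd x w t p b d.
have [e e0 he] : exists2 e, 0 < e & forall t, 0 <= t -> t <= e -> forall u, P u t.
  apply: fin_small => -[[[[p a] b] c] d] /=.
  have [lt|lt] := boolP (x p a b + x p c d < x p a c + x p b d); last by exists 1.
  have [e e0 he] := lt_small (w p a b + w p c d) (w p a c + w p b d) lt.
  by exists e => // t t0 te _; have := he t t0 te; rewrite /tadd; lra.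
by exists e => // t t0 te p a b c d; exact: (he t t0 te (p, a, b, c, d)).
Qed.

(** Take [x] with as many strict inequalities as possible. A direction of its star that is not
    lineal would break a tie while keeping all strict inequalities. *)
Lemma generic_ex X : TD sg V X -> exists x, [/\ TD sg V x, compat x X & generic x].
Proof.
move=> XTD; pose P n := `[< exists x, [/\ TD sg V x, compat x X & #|pat x| = n] >].
have P0 : exists n, P n by exists #|pat X|; apply/asboolP; exists X; split=> //; exact: compat_refl.
have Pm n : P n -> (n <= #|{: I * I * I * I * I}|)%N.
  by move=> /asboolP[x [_ _ <-]]; exact: max_card.
case: (ex_maxnP P0 Pm) => n /asboolP[x [xTD xX xn]] mx.
exists x; split=> // w hw; apply: contrapT => nL; have [ws wr] := hw; have [xs _] := xTD.
have [p [a [b [c [d [h [e1 n1]]]]]]] : exists p a b c d, dst [:: p; a; b; c; d] /\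
    (x p a c + x p b d = x p a d + x p b c /\ w p a c + w p b d <> w p a d + w p b c).
  apply: contrapT => H; apply: nL; split=> // p a b c d h sp.
  have [k1 k2 k3] := wr p a b c d h sp; split=> // lt.
  have [e2|n2] := pselect (w p a c + w p b d = w p a d + w p b c).
    by case: (k3 lt) => -[_ ->]; rewrite e2.
  by case: H; exists p, a, b, c, d.
have [t1 p1 H1] := St_TD xTD hw; have [t2 p2 H2] := strict_small x w.
pose t := Num.min t1 t2; have t0 : 0 < t by rewrite lt_min p1.
have x'TD : TD sg V (tadd x w t) by apply: H1; rewrite ?ge_min ?lexx // ltW.
have {}H2 := H2 t (ltW t0) ltac:(by rewrite ge_min lexx orbT).
have [ys _] := x'TD; have [_ ys2] := ys; have [_ xs2] := xs; have [_ ws2] := ws.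
have cX : compat (tadd x w t) X.
  move=> q f g r s hq; have [K1 K2] := xX q f g r s hq.
  have := H2 q f g r s; have := H2 q f r g s.
  have [lt|lt|E] := ltgtP (x q f g + x q r s) (x q f r + x q g s).
  - by move=> _ /(_ isT) h2; split=> [_|h3]; [exact: K1 | rewrite h3 ltxx in h2].
  - by move=> /(_ isT) h2 _; split=> h3; [have := lt_trans h2 h3; rewrite ltxx | rewrite h3 ltxx in h2].
  - by move=> _ _; split=> _; rewrite K2.
have sub : pat x \proper pat (tadd x w t).
  apply/properP; split.
    apply/fintype.subsetP => -[[[[q f] g] r] s]; rewrite !pat_lt => /andP[-> lt] /=.
    exact: H2 lt.
  have h1 : dst [:: p; a; c; d; b] by dcase h; dsplit.
  have h2 : dst [:: p; a; d; c; b] by dcase h; dsplit.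
  have [lt|] := boolP (tadd x w t p a c + tadd x w t p d b < tadd x w t p a d + tadd x w t p c b).
    exists (p, a, c, d, b); rewrite pat_lt h1 /=; first exact: lt.
    by rewrite (xs2 p b d) (xs2 p b c) e1 ltxx.
  rewrite -leNgt => le; exists (p, a, d, c, b); rewrite pat_lt h2 /=; last first.
    by rewrite (xs2 p b c) (xs2 p b d) e1 ltxx.
  rewrite lt_neqAle le andbT; apply/eqP; rewrite /tadd (xs2 p b c) (ws2 p b c) (xs2 p b d) (ws2 p b d).
  move=> E; apply: n1; apply: (mulfI (lt0r_neq0 t0)); lra.
have : P #|pat (tadd x w t)| by apply/asboolP; exists (tadd x w t).
by move/mx; rewrite -xn leqNgt proper_card.
Qed.

End Stars.

(** * Realising points of the prevariety *)

Section Realisation.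
Variables (R : realType) (I : finType) (sg : I -> I -> I -> bool).
Hypothesis chi : chirotope sg.
Implicit Types (V : {set I}) (x X w : I -> I -> I -> R).

Lemma TD_sub V (U : {set I}) X : U \subset V -> TD sg V X -> TD sg U X.
Proof.
move=> /fintype.subsetP UV [s H]; split=> // p a b c d /andP[u /allP h]; apply: H.
by rewrite /distinct u; apply/allP => z /h; apply: UV.
Qed.

Lemma realises_le V L L' X G : L <= L' -> realises sg V L X G -> realises sg V L' X G.
Proof. by move=> le H a b c h; apply: ap_le le (H a b c h). Qed.

Lemma TD_tadd V x X C : 0 <= C -> TD sg V x -> TD sg V X -> compat V x X ->
  TD sg V (tadd X x C).
Proof.
move=> C0 [xs xr] [Xs Xr] H; split; first exact: sym3_tadd.
move=> p a b c d h sp; have h1 := xr p a b c d h sp; have h2 := Xr p a b c d h sp.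
have [H1 H2] := H p a c b d ltac:(dcase h; dsplit); have [H3 H4] := H p a c d b ltac:(dcase h; dsplit).
have [H5 _] := H p a d c b ltac:(dcase h; dsplit).
have [_ xs2] := xs; have [_ Xs2] := Xs.
rewrite (xs2 p b d) (xs2 p b c) (Xs2 p b d) (Xs2 p b c) in H3 H4 H5.
have M u v : u <= v -> C * u <= C * v by apply: ler_wpM2l.
have Q u v : u = v -> C * u = C * v by move->.
rewrite /tadd; have [lt|lt|E] := ltgtP (x p a c + x p b d) (x p a d + x p b c).
- have e1 : x p a b + x p c d = x p a c + x p b d by move: h1; rewrite /ismin; lra.
  by have := H3 lt; have := M _ _ (ltW lt); have := Q _ _ e1; move: h2; rewrite /ismin; lra.
- have e1 : x p a b + x p c d = x p a d + x p b c by move: h1; rewrite /ismin; lra.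
  by have := H5 lt; have := M _ _ (ltW lt); have := Q _ _ e1; move: h2; rewrite /ismin; lra.
- have e1 : x p a b + x p c d = x p a c + x p b d by move: h1; rewrite /ismin; lra.
  by have := H4 E; have := Q _ _ E; have := Q _ _ e1; move: h2; rewrite /ismin; lra.
Qed.

Lemma fib_linear_generic V e x : e \in V -> TD sg V x -> generic sg V x -> fib_linear sg V e x.
Proof.
move=> eV xTD gx w fw; have [ws _] := fw; apply: (St_fib chi xTD).
  by move=> a b; rewrite ws.
have /LinP[_] := gx _ (fib_St chi xTD fw).
apply: St_agree; first by apply: emove_sym => a b; rewrite ws.
move=> a b c h; rewrite /emove; case: ifP => // _; case: ifP => // _; case: ifP => // _.
by rewrite oppr0.
Qed.

Lemma realises_ext V e L X G v : e \in V -> 0 <= L -> sym3 X -> realises sg (V :\ e) L X G ->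
  (forall p q, distinct V [:: e; p; q] -> ap L (sdet sg (upd G e v) p q e) (X p q e)) ->
  realises sg V L X (upd G e v).
Proof.
move=> eV L0 Xs H K a b c h; have [S1 S2] := sdet_sym chi (upd G e v); have [X1 X2] := Xs.
have [ea|ea] := eqVneq a e.
  subst a; rewrite (S1 b e c) (S2 b c e) (X1 b e c) (X2 b c e); apply: K; dcase h; dsplit.
have [eb|eb] := eqVneq b e.
  by subst b; rewrite (S2 a c e) (X2 a c e); apply: K; dcase h; dsplit.
have [ec|ec] := eqVneq c e.
  by subst c; apply: K; dcase h; dsplit.
by apply: (realises_upd eV v H); dcase h; dsplit.
Qed.

Section Step.
Variables (V : {set I}) (e : I) (x : I -> I -> I -> R).
Hypothesis eV : e \in V.
Hypothesis xTD : TD sg V x.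
Local Notation dst := (distinct V).
Local Notation lo := (lo sg e).
Local Notation sb := (sb V e x).

(** [X] may be on the boundary of the cell of [x], where [known_sb] has no strict inequality to rely
    on. Adding [C] times [x] provides a gap of [C] times that of [x], which is enough for
    [step_dominated] when [C] is large. *)
Lemma known_compat L0 a b1 b2 b c p q : 0 <= L0 -> known sg V e x a b1 b2 b c p q ->
  distinct V [:: e; p; q] ->
  exists2 r, 0 <= r & forall C, r <= C -> forall X G v, TD sg V X -> compat V x X ->
    let X' := tadd X x C in realises sg (V :\ e) L0 X' G ->
    ap 0 (sdet sg (upd G e v) a b1 e) (X' a b1 e) ->
    ap 0 (sdet sg (upd G e v) a b2 e) (X' a b2 e) ->
    ap 0 (sdet sg (upd G e v) b c e) (X' b c e) ->
    ap r (sdet sg (upd G e v) p q e) (X' p q e).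
Proof.
move=> L00 hk _; have [xs xr] := xTD; elim: hk => {p q} [|||p q _ [r r0 IH]|p q r s h _ [r1 r10 IH1] _ [r2 r20 IH2] hs ns|p q r s h _ [r1 r10 IH1] _ [r2 r20 IH2] l1 l2].
- by exists 0.
- by exists 0.
- by exists 0.
- exists r => // C hC X G v XT cX X' hG h1 h2 h3; have := IH C hC X G v XT cX hG h1 h2 h3.
  have [S1 _] := sdet_sym chi (upd G e v); rewrite (S1 q p e) /X' /tadd.
  by case: xs => s1 _; case: XT => -[s2 _] _; rewrite (s1 q p) (s2 q p).
- pose L := Num.max L0 (Num.max r1 r2).
  have L_0 : L0 <= L by rewrite le_max lexx.
  have L_1 : r1 <= L by rewrite !le_max lexx orbT.
  have L_2 : r2 <= L by rewrite !le_max lexx !orbT.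
  have [lt e1] := sb_lt chi xTD h hs ns.
  pose g := (x p e s + x p r q) - (x p e r + x p q s).
  have g0 : 0 < g.
    rewrite subr_gt0; move: lt; rewrite /del; case: xs => _ s2.
    by rewrite (s2 p r e) (s2 p s e) (s2 p q r); lra.
  have e2 : x p e r + x p q s = x p e q + x p r s.
    move: e1; rewrite /del; case: xs => _ s2.
    by rewrite (s2 p r e) (s2 p q e); lra.
  have hp : dst [:: p; e; r; q; s] by dcase h; dsplit.
  have hp2 : dst [:: p; e; r; s; q] by dcase h; dsplit.
  (* [4 * L + 1] is the gap asked for by [step_dominated], and [g] is the gap at [x]. *)
  pose C0 := (4 * L + 1) / g; have C00 : 0 <= C0 by rewrite divr_ge0 // ?ltW //; lra.
  exists (Num.max (3 * L + 1) C0); first by rewrite le_max C00 orbT.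
  move=> C; rewrite ge_max => /andP[hC1 hC2] X G v XT cX X' hG h1 h2 h3.
  have C_r1 : r1 <= C by lra.
  have C_r2 : r2 <= C by lra.
  have k1 := IH1 C C_r1 X G v XT cX hG h1 h2 h3.
  have k2 := IH2 C C_r2 X G v XT cX hG h1 h2 h3.
  have [Xs Xr] := XT.
  have X's : sym3 X' by exact: sym3_tadd.
  have [T1 T2] := X's; have [S1 S2] := sdet_sym chi (upd G e v).
  have K (u y t : I) : dst [:: e; u; y; t] -> ap L (sdet sg (upd G e v) u y t) (X' u y t).
    by move=> hh; apply: ap_le L_0 _; apply: (realises_upd eV v hG).
  have [cc1 _] := cX p e r s q hp2; have [_ cc2] := cX p e r q s hp.
  have e3 : X' p e r + X' p q s = X' p e q + X' p r s.
    by have := cc2 e2; have := congr1 ( *%R C) e2; rewrite /X' /tadd !mulrDr; lra.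
  have gap : X' p e r + X' p q s + 4 * L + 1 <= X' p e s + X' p r q.
    have : 4 * L + 1 <= C * g by rewrite -ler_pdivrMr.
    rewrite /g mulrBr !mulrDr; have := cc1; rewrite /X' /tadd; case: (xs) => _ s2; case: (Xs) => _ s3.
    rewrite (s2 p q s) (s3 p q s) => h4; have := h4 ltac:(by move: g0; rewrite subr_gt0).
    lra.
  have nsp : ~~ special sg p e s r q.
    apply/negP => sp; have := xr p e s r q ltac:(dcase h; dsplit) sp.
    have := g0; rewrite /g; case: (xs) => _ s2; rewrite /ismin (s2 p q s) (s2 p r s); lra.
  have le3 : 3 * L + 1 <= Num.max (3 * L + 1) C0 by rewrite le_max lexx.
  apply: (ap_le le3); rewrite (S2 p e r) (T2 p e r).
  apply: (step_dominated chi _ hp e3 gap nsp); first by lra.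
  + by apply: K; dcase h; dsplit.
  + by rewrite (S2 p q e) (T2 p q e); apply: ap_le k1.
  + by apply: K; dcase h; dsplit.
  + by rewrite (S2 p s e) (T2 p s e); apply: ap_le k2.
  + by apply: K; dcase h; dsplit.
- pose L := Num.max L0 (Num.max r1 r2).
  have L_0 : L0 <= L by rewrite le_max lexx.
  have L_1 : r1 <= L by rewrite !le_max lexx orbT.
  have L_2 : r2 <= L by rewrite !le_max lexx !orbT.
  have hp : dst [:: p; e; r; q; s] by dcase h; dsplit.
  have sp := lo_special chi h l1 l2.
  exists (3 * L + 1); first by lra.
  move=> C hC X G v XT cX X' hG h1 h2 h3.
  have C_r1 : r1 <= C by lra.
  have C_r2 : r2 <= C by lra.
  have C0 : 0 <= C by lra.
  have k1 := IH1 C C_r1 X G v XT cX hG h1 h2 h3.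
  have k2 := IH2 C C_r2 X G v XT cX hG h1 h2 h3.
  have [X's Xr] : TD sg V X' by exact: TD_tadd.
  have [T1 T2] := X's; have [S1 S2] := sdet_sym chi (upd G e v).
  have K (u y t : I) : dst [:: e; u; y; t] -> ap L (sdet sg (upd G e v) u y t) (X' u y t).
    by move=> hh; apply: ap_le L_0 _; apply: (realises_upd eV v hG).
  rewrite (S2 p e r) (T2 p e r).
  apply: (step_special chi hp sp (Xr _ _ _ _ _ hp sp)).
  + by apply: K; dcase h; dsplit.
  + by rewrite (S2 p q e) (T2 p q e); apply: ap_le k1.
  + by apply: K; dcase h; dsplit.
  + by rewrite (S2 p s e) (T2 p s e); apply: ap_le k2.
  + by apply: K; dcase h; dsplit.
Qed.

End Step.

Lemma bounded (x : I -> I -> I -> R) : exists B, forall a b c, `|x a b c| <= B.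
Proof.
pose P (t : I * I * I) r := `|x t.1.1 t.1.2 t.2| <= r.
have P1 t r r' : r <= r' -> P t r -> P t r' by move=> le h; exact: le_trans h le.
have P2 t : exists r, P t r by exists `|x t.1.1 t.1.2 t.2|; exact: lexx.
by have [B hB] := fin_bound P1 P2; exists B => a b c; exact: (hB (a, b, c)).
Qed.

Lemma realise_compat V x e0 p0 q0 r0 : (#|V| <= 8)%N -> distinct V [:: e0; p0; q0; r0] ->
  (forall e, e \in V -> realisable_TD R sg (V :\ e)) -> TD sg V x -> generic sg V x ->
  exists L, forall X, TD sg V X -> compat V x X -> exists G, realises sg V L X G.
Proof.
move=> V8 h0 IH xTD gx; have e0V : e0 \in V by dcase h0.
have [e eV few] := few_colours_ex chi V8 xTD e0V.
have lin := fib_linear_generic eV xTD gx.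
have RV := IH e eV; have [L0 L00 HL] := RV.
have [p [q [r hpqr]]] : exists p q r, distinct V [:: e; p; q; r].
  dcase h0; have [E|n1] := eqVneq e e0; first by exists p0, q0, r0; subst e; dsplit.
  have [E|n2] := eqVneq e p0; first by exists e0, q0, r0; subst e; dsplit.
  have [E|n3] := eqVneq e q0; first by exists e0, p0, r0; subst e; dsplit.
  by exists e0, p0, q0; dsplit.
have [a [b1 [b2 [b [c sd]]]]] := seeds_ex chi eV xTD RV lin hpqr.
have kn := known_all chi eV xTD RV lin sd few.
have [hd1 hd2 _ _ _] := sd.
pose P (t : I * I) (r : R) := distinct V [:: e; t.1; t.2] -> 0 <= r /\
  forall C, r <= C -> forall X G v, TD sg V X -> compat V x X ->
    let X' := tadd X x C in realises sg (V :\ e) L0 X' G ->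
    ap 0 (sdet sg (upd G e v) a b1 e) (X' a b1 e) ->
    ap 0 (sdet sg (upd G e v) a b2 e) (X' a b2 e) ->
    ap 0 (sdet sg (upd G e v) b c e) (X' b c e) ->
    ap r (sdet sg (upd G e v) t.1 t.2 e) (X' t.1 t.2 e).
have P1 t s s' : s <= s' -> P t s -> P t s'.
  move=> le H /H[s0 K]; split=> [|C hC X G v XT cX X' hG h1 h2 h3]; first exact: le_trans s0 le.
  by apply: (ap_le le); apply: K => //; exact: le_trans le hC.
have P2 t : exists s, P t s.
  have [h|h] := boolP (distinct V [:: e; t.1; t.2]); last by exists 0; rewrite /P (negPf h).
  by have [s s0 hs] := known_compat eV xTD L00 (kn _ _ h) h; exists s.
have [s hs] := fin_bound P1 P2.
have [B hB] := bounded x.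
have s0 : 0 <= s by have [] := hs (p, q) ltac:(dcase hpqr; dsplit).
(* [X + s x] is realised in place of [X]; as [x] is bounded by [B], this costs [s * B]. *)
pose L := Num.max L0 s; exists (L + s * B) => X XT cX.
pose X' := tadd X x s; have X'T : TD sg V X' by exact: TD_tadd.
have [G hG] := HL X' (TD_sub (subD1set V e) X'T).
have [v [k1 k2 k3]] := extend3 eV hG hd1 hd2.
exists (upd G e v); have [X's _] := X'T.
have real : realises sg V L X' (upd G e v).
  apply: realises_ext => //; first by rewrite le_max L00.
    by apply: realises_le hG; rewrite le_max lexx.
  move=> p' q' h; have [_ K] := hs (p', q') h.
  by apply: (@ap_le _ s); [rewrite le_max lexx orbT | apply: K].
move=> a' b' c' h; apply: (ap_shift _ (real a' b' c' h)).
rewrite /X' /tadd addrC addKr normrM ger0_norm //.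
exact: ler_wpM2l.
Qed.

End Realisation.

Section RealisationInduction.
Variables (R : realType) (I : finType) (sg : I -> I -> I -> bool).
Hypothesis chi : chirotope sg.
Implicit Types (V : {set I}) (x X w : I -> I -> I -> R).

(** The bound of [realise_compat] can be chosen by the pattern of the generic point alone, and there
    are finitely many patterns. *)
Lemma realisable_step V e p q r : (#|V| <= 8)%N -> distinct V [:: e; p; q; r] ->
  (forall e, e \in V -> realisable_TD R sg (V :\ e)) -> realisable_TD R sg V.
Proof.
move=> V8 h0 IH.
pose P (pi : {set I * I * I * I * I}) (L : R) := forall x, TD sg V x -> generic sg V x ->
  pat V x = pi -> forall X, TD sg V X -> compat V x X -> exists G, realises sg V L X G.
have P1 t (L L' : R) : L <= L' -> P t L -> P t L'.
  move=> le H x xT gx ex X XT cX; have [G hG] := H x xT gx ex X XT cX.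
  by exists G; exact: realises_le hG.
have P2 t : exists L, P t L.
  have [[x [xT gx ex]]|N] := pselect (exists x, [/\ TD sg V x, generic sg V x & pat V x = t]).
    have [L hL] := realise_compat chi V8 h0 IH xT gx; exists L => y yT gy ey X XT cX.
    by apply: hL => //; apply: compat_pat cX; rewrite ey.
  by exists 0 => x xT gx ex; case: N; exists x.
have [L hL] := fin_bound P1 P2; exists (Num.max L 0); first by rewrite le_max lexx orbT.
move=> X XT; have [x [xT cX gx]] := generic_ex XT.
have [G hG] := hL _ x xT gx (erefl _) X XT cX; exists G.
by apply: realises_le hG; rewrite le_max lexx.
Qed.

Lemma realisable_small V : (#|V| <= 3)%N -> realisable_TD R sg V.
Proof.
move=> V3; exists 0 => // X XT; have [Xs _] := XT.
have [[a [b [c h]]]|N] := pselect (exists a b c, distinct V [:: a; b; c]); last first.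
  by exists (fun _ => (0, 0, 0)) => a b c h; case: N; exists a, b, c.
pose t := sz (sg a b c) (expR (- X a b c)).
pose G i : pt R := if i == a then (t, 0, 0) else if i == b then (0, 1, 0) else (0, 0, 1).
exists G; have [S1 S2] := sdet_sym chi G; have [X1 X2] := Xs.
have habc : ap 0 (sdet sg G a b c) (X a b c).
  rewrite /sdet (_ : det3 (G a) (G b) (G c) = t); first exact: sz_ap.
  dcase h; rewrite /G !eqxx.
  have -> : (b == a) = false by apply/negbTE; rewrite eq_sym.
  have -> : (c == a) = false by apply/negbTE; rewrite eq_sym.
  have -> : (c == b) = false by apply/negbTE; rewrite eq_sym.
  by rewrite /det3 /=; ring.
have mem3 u : u \in V -> u \in [:: a; b; c].
  move=> uV; apply: contraT => nu.
  have : distinct V [:: u; a; b; c] by case/andP: h => h1 h2; rewrite /distinct cons_uniq nu h1 /= uV.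
  by move=> /distinct_card/leq_trans/(_ V3).
move=> u v w huv; dcase huv.
have := mem3 u ltac:(by []); have := mem3 v ltac:(by []); have := mem3 w ltac:(by []).
rewrite !inE => /or3P[]/eqP E1 /or3P[]/eqP E2 /or3P[]/eqP E3; subst u v w; try dsub.
- by rewrite (S1 b c a) (S2 b a c) (S1 a b c) (X1 b c a) (X2 b a c) (X1 a b c).
- by rewrite (S2 b a c) (S1 a b c) (X2 b a c) (X1 a b c).
- by rewrite (S1 a c b) (S2 a b c) (X1 a c b) (X2 a b c).
- by rewrite (S2 a b c) (X2 a b c).
- by rewrite (S1 a b c) (X1 a b c).
- exact: habc.
Qed.

Lemma realisable_le8 V : (#|V| <= 8)%N -> realisable_TD R sg V.
Proof.
move: {2}#|V| (leqnn #|V|) => n; elim: n V => [|n IH] V Vn V8.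
  by apply: realisable_small; exact: leq_trans Vn _.
have [V3|V4] := leqP #|V| 3; first exact: realisable_small.
have [s hs] : exists s, distinct V s /\ size s = #|V|.
  by exists (enum V); rewrite /distinct enum_uniq -cardE; split=> //; apply/allP => z; rewrite mem_enum.
move: hs; case: s => [|e [|p [|q [|r s]]]] [] // h e1; try by rewrite -e1 in V4.
have h4 : distinct V [:: e; p; q; r] by dcase h; dsplit.
apply: (realisable_step V8 h4) => f fV.
have := cardsD1 f V; rewrite fV add1n => eV; apply: IH; first by rewrite -ltnS -eV.
by apply: ltnW; rewrite -eV.
Qed.

(* Three-term relations between exponentially large real numbers pass to
   their logarithms in the limit. *)
Lemma TD_asymptotic V (Y : I -> I -> I -> R) s l0 : sym3 Y ->
  (forall l, l0 <= l -> exists G, realises sg V s (fun a b c => l * Y a b c) G) -> TD sg V Y.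
Proof.
move=> Ys H; split=> // p a b c d h sp; apply/ismin_min.
set m := Num.min _ _; set u := Y p a b + Y p c d.
have mm : ismin m (Y p a c + Y p b d) (Y p a d + Y p b c) by apply/ismin_min.
(* Four units of [s] come from the two products compared, and [1] from the sum. *)
have K l : l0 <= l -> 0 <= l -> l * `|u - m| <= 4 * s + 1.
  move=> hl l0'; have [G hG] := H l hl.
  have D q f g : distinct V [:: q; f; g] -> ap s (sdet sg G q f g) (l * Y q f g) by apply: hG.
  have h1 := ap_mul (D p a b ltac:(dcase h; dsplit)) (D p c d ltac:(dcase h; dsplit)).
  have h2 := ap_mul (D p a c ltac:(dcase h; dsplit)) (D p b d ltac:(dcase h; dsplit)).
  have h3 := ap_mul (D p a d ltac:(dcase h; dsplit)) (D p b c ltac:(dcase h; dsplit)).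
  have lm : ismin (l * m) (l * Y p a c + l * Y p b d) (l * Y p a d + l * Y p b c).
    by rewrite -!mulrDr; apply: isminZ.
  have := ap_add h2 h3 lm; rewrite -sdet_special //; last by case/andP: h.
  move=> /(ap_uniq h1); rewrite -mulrDr -/u -mulrBr normrM (ger0_norm l0'); lra.
apply/eqP; rewrite -subr_eq0 -normr_eq0; apply: contraT => n0.
have d0 : 0 < `|u - m| by rewrite lt_neqAle eq_sym n0 normr_ge0.
pose l := Num.max (Num.max l0 0) ((4 * s + 2) / `|u - m|).
have l1 : l0 <= l by rewrite !le_max lexx.
have l2 : 0 <= l by rewrite !le_max lexx orbT.
have := K l l1 l2; have : 4 * s + 2 <= l * `|u - m|.
  by rewrite -ler_pdivrMr // le_max lexx orbT.
lra.
Qed.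

End RealisationInduction.

(** * Stars are not one-sided *)

Lemma smin_ex (R : realType) (v w v' w' : R) : exists u', smin v w u' v' w'.
Proof.
have [lt|lt|E] := ltgtP v w.
- by exists v'; split=> // h; [have := lt_trans lt h; rewrite ltxx | rewrite h ltxx in lt].
- by exists w'; split=> // h; [have := lt_trans lt h; rewrite ltxx | rewrite h ltxx in lt].
- by exists (Num.min v' w'); split=> h; rewrite ?E ?ltxx // in h *; apply/ismin_min.
Qed.

(** * Lifting directions of the star from [V :\ e] to [V] *)

Section Lift.
Variables (R : realType) (I : finType) (sg : I -> I -> I -> bool).
Hypothesis chi : chirotope sg.
Variables (V : {set I}) (e : I) (x u : I -> I -> I -> R).
Hypothesis eV : e \in V.
Hypothesis xTD : TD sg V x.
Hypothesis realV : realisable_TD R sg (V :\ e).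
Hypothesis uSt : St sg (V :\ e) x u.
Local Notation dst := (distinct V).
Local Notation lo := (lo sg e).
Local Notation sb := (sb V e x).

(** [z] is the rate at which the exponent of the bracket [p q e] changes when the other elements
    follow [u] and the seeds stay fixed. It is computed by the same two rules, and [r] keeps the
    inequalities at [x] that they use. *)
Lemma known_lift L0 a b1 b2 b c p q : 0 <= L0 -> known sg V e x a b1 b2 b c p q ->
  exists z r, 0 < r /\ forall t, 0 < t -> t <= r -> exists s, 0 <= s /\
    forall l, s <= l -> forall G v,
    realises sg (V :\ e) L0 (fun a b c => l * tadd x u t a b c) G ->
    ap 0 (sdet sg (upd G e v) a b1 e) (l * x a b1 e) ->
    ap 0 (sdet sg (upd G e v) a b2 e) (l * x a b2 e) ->
    ap 0 (sdet sg (upd G e v) b c e) (l * x b c e) ->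
    ap s (sdet sg (upd G e v) p q e) (l * (x p q e + t * z)).
Proof.
move=> L00 hk; have [xs xr] := xTD; have [us _] := uSt.
have [_ x2] := xs; have [_ u2] := us.
have zero f g : exists (z : R) r, 0 < r /\ forall t, 0 < t -> t <= r -> exists s, 0 <= s /\
    forall l, s <= l -> forall G v, realises sg (V :\ e) L0 (fun a b c => l * tadd x u t a b c) G ->
    ap 0 (sdet sg (upd G e v) f g e) (l * x f g e) ->
    ap s (sdet sg (upd G e v) f g e) (l * (x f g e + t * z)).
  by exists 0, 1; split=> // t _ _; exists 0; split=> // l _ G v _ h; rewrite mulr0 addr0.
have K (L : R) (l t : R) G v (f g h : I) : L0 <= L ->
    realises sg (V :\ e) L0 (fun a b c => l * tadd x u t a b c) G -> dst [:: e; f; g; h] ->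
    ap L (sdet sg (upd G e v) f g h) (l * (x f g h + t * u f g h)).
  by move=> le hG hd; apply: ap_le le _; apply: (realises_upd eV v hG).
elim: hk => {p q} [|||p q _ [z [r [r0 IH]]]|p q r s h _ [z1 [r1 [r10 IH1]]] _ [z2 [r2 [r20 IH2]]] hs ns|p q r s h _ [z1 [r1 [r10 IH1]]] _ [z2 [r2 [r20 IH2]]] l1 l2].
- have [z [r [r0 H]]] := zero a b1; exists z, r; split=> // t t0 tr; have [s [s0 hs]] := H t t0 tr.
  by exists s; split=> // l hl G v hG h1 h2 h3; apply: hs.
- have [z [r [r0 H]]] := zero a b2; exists z, r; split=> // t t0 tr; have [s [s0 hs]] := H t t0 tr.
  by exists s; split=> // l hl G v hG h1 h2 h3; apply: hs.
- have [z [r [r0 H]]] := zero b c; exists z, r; split=> // t t0 tr; have [s [s0 hs]] := H t t0 tr.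
  by exists s; split=> // l hl G v hG h1 h2 h3; apply: hs.
- exists z, r; split=> // t t0 tr; have [s [s0 hs]] := IH t t0 tr.
  exists s; split=> // l hl G v hG h1 h2 h3; have := hs l hl G v hG h1 h2 h3.
  by have [S1 _] := sdet_sym chi (upd G e v); rewrite (S1 p q e); case: xs => -> _.
- have [lt e1] := sb_lt chi xTD h hs ns.
  have g0 : x p e r + x p q s < x p e s + x p r q.
    by move: lt; rewrite /del (x2 p r e) (x2 p s e) (x2 p q r); lra.
  have e2 : x p e r + x p q s = x p e q + x p r s.
    by move: e1; rewrite /del (x2 p r e) (x2 p q e); lra.
  have hp : dst [:: p; e; r; q; s] by dcase h; dsplit.
  pose z := z1 + u p r s - u p q s.
  have [r3 r30 H3] := lt_small (z + u p q s) (z2 + u p r q) g0.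
  exists z, (Num.min (Num.min r1 r2) r3); split; first by rewrite !lt_min r10 r20.
  move=> t t0; rewrite !le_min => /andP[/andP[tr1 tr2] tr3].
  have [s1 [s10 {}IH1]] := IH1 t t0 tr1; have [s2 [s20 {}IH2]] := IH2 t t0 tr2.
  have {}H3 := H3 t (ltW t0) tr3.
  (* This gap depends on [t], which is why [s] comes after [t] in the statement. *)
  pose g := (x p e s + x p r q + t * (z2 + u p r q)) - (x p e r + x p q s + t * (z + u p q s)).
  have gt0 : 0 < g by rewrite subr_gt0.
  pose L := Num.max L0 (Num.max s1 s2).
  have L_0 : L0 <= L by rewrite le_max lexx.
  have L_1 : s1 <= L by rewrite !le_max lexx orbT.
  have L_2 : s2 <= L by rewrite !le_max lexx !orbT.
  have LL : 0 <= L by lra.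
  pose C0 := (4 * L + 1) / g; have C00 : 0 <= C0 by rewrite divr_ge0 // ?ltW //; lra.
  exists (Num.max (3 * L + 1) C0); split; first by rewrite le_max C00 orbT.
  move=> l; rewrite ge_max => /andP[hC1 hC2] G v hG h1 h2 h3.
  have C_1 : s1 <= l by lra.
  have C_2 : s2 <= l by lra.
  have k1 := IH1 l C_1 G v hG h1 h2 h3; have k2 := IH2 l C_2 G v hG h1 h2 h3.
  have [S1 S2] := sdet_sym chi (upd G e v).
  have e3 : l * (x p e r + t * z) + l * (x p q s + t * u p q s) =
            l * (x p e q + t * z1) + l * (x p r s + t * u p r s).
    by rewrite -!mulrDr /z; congr (l * _); lra.
  have gap : l * (x p e r + t * z) + l * (x p q s + t * u p q s) + 4 * L + 1 <=
             l * (x p e s + t * z2) + l * (x p r q + t * u p r q).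
    have : 4 * L + 1 <= l * g by rewrite -ler_pdivrMr.
    by rewrite /g; lra.
  have nsp : ~~ special sg p e s r q.
    apply/negP => sp; have := xr p e s r q ltac:(dcase h; dsplit) sp.
    by have := g0; rewrite /ismin (x2 p q s) (x2 p r s); lra.
  have le3 : 3 * L + 1 <= Num.max (3 * L + 1) C0 by rewrite le_max lexx.
  apply: (ap_le le3); rewrite -(S2 p r e) -(x2 p r e).
  apply: (step_dominated chi LL hp e3 gap nsp).
  + by apply: K => //; dcase h; dsplit.
  + by rewrite (S2 p q e) (x2 p q e); apply: ap_le k1.
  + by apply: K => //; dcase h; dsplit.
  + by rewrite (S2 p s e) (x2 p s e); apply: ap_le k2.
  + by apply: K => //; dcase h; dsplit.
- have hp : dst [:: p; e; r; q; s] by dcase h; dsplit.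
  have sp := lo_special chi h l1 l2.
  have [z' hz'] := smin_ex (x p e q + x p r s) (x p e s + x p r q) (z1 + u p r s) (z2 + u p r q).
  have [r3 r30 H3] := smin_small (xr _ _ _ _ _ hp sp) hz'.
  exists (z' - u p q s), (Num.min (Num.min r1 r2) r3); split; first by rewrite !lt_min r10 r20.
  move=> t t0; rewrite !le_min => /andP[/andP[tr1 tr2] tr3].
  have [s1 [s10 {}IH1]] := IH1 t t0 tr1; have [s2 [s20 {}IH2]] := IH2 t t0 tr2.
  have {}H3 := H3 t (ltW t0) tr3.
  pose L := Num.max L0 (Num.max s1 s2).
  have L_0 : L0 <= L by rewrite le_max lexx.
  have L_1 : s1 <= L by rewrite !le_max lexx orbT.
  have L_2 : s2 <= L by rewrite !le_max lexx !orbT.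
  exists (3 * L + 1); split; first by lra.
  move=> l hl G v hG h1 h2 h3.
  have l0 : 0 <= l by lra.
  have C_1 : s1 <= l by lra.
  have C_2 : s2 <= l by lra.
  have k1 := IH1 l C_1 G v hG h1 h2 h3; have k2 := IH2 l C_2 G v hG h1 h2 h3.
  have [S1 S2] := sdet_sym chi (upd G e v).
  have mn : ismin (l * (x p e r + t * (z' - u p q s)) + l * (x p q s + t * u p q s))
     (l * (x p e q + t * z1) + l * (x p r s + t * u p r s))
     (l * (x p e s + t * z2) + l * (x p r q + t * u p r q)).
    rewrite -!mulrDr; apply: isminZ => //.
    by move: H3; rewrite /ismin; lra.
  rewrite -(S2 p r e) -(x2 p r e); apply: (step_special chi hp sp mn).
  + by apply: K => //; dcase h; dsplit.
  + by rewrite (S2 p q e) (x2 p q e); apply: ap_le k1.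
  + by apply: K => //; dcase h; dsplit.
  + by rewrite (S2 p s e) (x2 p s e); apply: ap_le k2.
  + by apply: K => //; dcase h; dsplit.
Qed.

(** The rates of [known_lift] define [w] on triples with [e]. For small [t], all large multiples of
    [x + t w] are realised with bounded error: realise [x + t u] without [e], place [e] by its
    seeds, and propagate. By [TD_asymptotic] the points [x + t w] are in the prevariety. *)
Lemma lift_star a b1 b2 b c : dst [:: e; a; b1; b2] -> dst [:: e; a; b; c] ->
  (forall p q, dst [:: e; p; q] -> known sg V e x a b1 b2 b c p q) ->
  exists w, St sg V x w /\ agree (V :\ e) w u.
Proof.
move=> hd1 hd2 kn; have [L0 L00 HL] := realV; have [us _] := uSt; have [u1 u2] := us.
have [xs _] := xTD.
pose Q p q (z : R) (r : R) := 0 < r /\ forall t, 0 < t -> t <= r -> exists s, 0 <= s /\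
    forall l, s <= l -> forall G v,
    realises sg (V :\ e) L0 (fun a b c => l * tadd x u t a b c) G ->
    ap 0 (sdet sg (upd G e v) a b1 e) (l * x a b1 e) ->
    ap 0 (sdet sg (upd G e v) a b2 e) (l * x a b2 e) ->
    ap 0 (sdet sg (upd G e v) b c e) (l * x b c e) ->
    ap s (sdet sg (upd G e v) p q e) (l * (x p q e + t * z)).
pose Q' (p : I * I) z := dst [:: e; p.1; p.2] -> exists r, Q p.1 p.2 z r.
have hQ p : exists z, Q' p z.
  have [h|h] := boolP (dst [:: e; p.1; p.2]); last by exists 0; rewrite /Q' (negPf h).
  by have [z [r hr]] := known_lift L00 (kn _ _ h); exists z => _; exists r.
have [zf hzf] := choice hQ.
(* Of the rates chosen for [(p, q)] and [(q, p)] only one is kept, to make [Z] symmetric. *)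
pose Z p q := if (enum_rank p < enum_rank q)%N then zf (p, q) else zf (q, p).
have Zs : sym2 Z.
  move=> p q; rewrite /Z; case: ltngtP => // h; have : p = q by apply/enum_rank_inj/val_inj.
  by move=> ->.
have hZ p q : dst [:: e; p; q] -> exists r, Q p q (Z p q) r.
  move=> h; rewrite /Z; case: ifP => _; first exact: (hzf (p, q)).
  have h' : dst [:: e; q; p] by dcase h; dsplit.
  have [r [r0 H]] := hzf (q, p) h'; exists r; split=> // t t0 tr; have [s [s0 hs]] := H t t0 tr.
  exists s; split=> // l hl G v hG k1 k2 k3; have := hs l hl G v hG k1 k2 k3 => /=.
  by have [S1 _] := sdet_sym chi (upd G e v); rewrite (S1 q p e); case: xs => -> _.
(* Values of [u] on triples with [e] are dropped, so that the brackets of the seeds keep their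
   exponents. *)
pose u0 p q r := if [|| p == e, q == e | r == e] then 0 else u p q r.
have u0s : sym3 u0.
  by split=> p q r; rewrite /u0 ?(u1 p q r) ?(u2 p q r) ?(orbCA (q == e)) ?(orbC (r == e)).
pose w := tadd u0 (emove e Z) 1; have ws : sym3 w by apply: sym3_tadd => //; exact: emove_sym.
have we p q : dst [:: e; p; q] -> w p q e = Z p q.
  move=> h; dcase h; rewrite /w /tadd /u0 eqxx !orbT /emove eqxx add0r mul1r.
  by rewrite !(eq_sym _ e) (negPf (_ : e != p)) // (negPf (_ : e != q)).
have wu : agree (V :\ e) w u.
  move=> p q r; rewrite distinctD1 // => h; dcase h.
  rewrite /w /tadd /u0 /emove !(eq_sym _ e) (negPf (_ : e != p)) // (negPf (_ : e != q)) //.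
  by rewrite (negPf (_ : e != r)) //= mulr0 addr0.
exists w; split=> //.
have xTD' : TD sg (V :\ e) x by apply: TD_sub xTD; exact: subD1set.
have [t1 t10 H1] := St_TD xTD' uSt.
have [t2 t20 H2] : exists2 t2, 0 < t2 & forall t, 0 <= t -> t <= t2 -> forall p : I * I,
    0 < t -> dst [:: e; p.1; p.2] -> exists s, 0 <= s /\
    forall l, s <= l -> forall G v,
    realises sg (V :\ e) L0 (fun a b c => l * tadd x u t a b c) G ->
    ap 0 (sdet sg (upd G e v) a b1 e) (l * x a b1 e) ->
    ap 0 (sdet sg (upd G e v) a b2 e) (l * x a b2 e) ->
    ap 0 (sdet sg (upd G e v) b c e) (l * x b c e) ->
    ap s (sdet sg (upd G e v) p.1 p.2 e) (l * (x p.1 p.2 e + t * Z p.1 p.2)).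
  apply: fin_small => p; have [h|h] := boolP (dst [:: e; p.1; p.2]); last by exists 1.
  by have [r [r0 hr]] := hZ _ _ h; exists r => // t _ tr t0 _; apply: hr.
have tm : 0 < Num.min t1 t2 by rewrite lt_min t10.
apply: (TD_St xTD ws tm) => t t0; rewrite le_min => /andP[tt1 tt2].
have {}H2 p q := H2 t (ltW t0) tt2 (p, q) t0; have {}H1 := H1 t (ltW t0) tt1.
pose P (p : I * I) (s : R) := dst [:: e; p.1; p.2] -> 0 <= s /\
    forall l, s <= l -> forall G v,
    realises sg (V :\ e) L0 (fun a b c => l * tadd x u t a b c) G ->
    ap 0 (sdet sg (upd G e v) a b1 e) (l * x a b1 e) ->
    ap 0 (sdet sg (upd G e v) a b2 e) (l * x a b2 e) ->
    ap 0 (sdet sg (upd G e v) b c e) (l * x b c e) ->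
    ap s (sdet sg (upd G e v) p.1 p.2 e) (l * (x p.1 p.2 e + t * Z p.1 p.2)).
have P1 p (s s' : R) : s <= s' -> P p s -> P p s'.
  move=> le H /H[s0 K]; split=> [|l hl G v hG k1 k2 k3]; first exact: le_trans le.
  by apply: (ap_le le); apply: K => //; exact: le_trans le hl.
have P2 p : exists s, P p s.
  have [h|h] := boolP (dst [:: e; p.1; p.2]); last by exists 0; rewrite /P (negPf h).
  by have [s hs] := H2 p.1 p.2 h; exists s.
have [s hs] := fin_bound P1 P2.
have s0 : 0 <= s by have [] := hs (a, b1) ltac:(dcase hd1; dsplit).
pose L := Num.max L0 s.
apply: (@TD_asymptotic _ _ _ chi V _ L s); first exact: sym3_tadd.
move=> l hl; have l0 : 0 <= l by exact: le_trans hl.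
have lTD : TD sg (V :\ e) (fun a b c => l * tadd x u t a b c).
  have [As Ar] := H1; split; first exact: sym3Z.
  by move=> p a' b' c' d' h sp; rewrite -!mulrDr; apply: isminZ => //; apply: Ar.
have [G hG] := HL _ lTD.
have u0E p q r : dst [:: e; p; q; r] -> u0 p q r = u p q r.
  move=> h; dcase h; rewrite /u0 !(eq_sym _ e) (negPf (_ : e != p)) // (negPf (_ : e != q)) //.
  by rewrite (negPf (_ : e != r)).
have u0e p q : u0 p q e = 0 by rewrite /u0 eqxx !orbT.
have hG0 : realises sg (V :\ e) L0 (fun p q r => l * tadd x u0 t p q r) G.
  move=> p q r h; have h' := h; rewrite distinctD1 // in h'.
  by rewrite /tadd u0E //; apply: hG.
have [v] := extend3 eV hG0 hd1 hd2; rewrite /tadd !u0e mulr0 !addr0 => -[k1 k2 k3].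
exists (upd G e v); apply: (realises_ext chi eV).
- by rewrite /L le_max L00.
- by apply: sym3Z; exact: sym3_tadd.
- move=> p q r h; have := hG p q r h; rewrite /tadd wu //; apply: ap_le.
  by rewrite le_max lexx.
move=> p q h; rewrite /tadd we //; have [_ K] := hs (p, q) h.
have sL : s <= L by rewrite le_max lexx orbT.
by apply: (ap_le sL); apply: K.
Qed.

End Lift.

(** * Stars consisting of a lineality space and one ray *)

Section OneSided.
Variables (R : realType) (I : finType) (sg : I -> I -> I -> bool).
Hypothesis chi : chirotope sg.
Implicit Types (x v w : I -> I -> I -> R).

Definition one_sided (V : {set I}) x v := [/\ TD sg V x, St sg V x v, ~ Lin sg V x v &
  forall w, St sg V x w -> exists2 c, 0 <= c & Lin sg V x (tadd w v (- c))].

(** Where [x] has a tie, the two terms differ at [tadd x v t] by [t] times their difference at [v].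
    So the relation satisfied by [w] there is exactly the one needed to perturb [v] by a small
    multiple of [w]. *)
Lemma St_move V x v w t : 0 < t -> sym3 v -> St sg V x v -> St sg V (tadd x v t) w ->
  (forall p a b c d, x p a b + x p c d < x p a c + x p b d ->
     tadd x v t p a b + tadd x v t p c d < tadd x v t p a c + tadd x v t p b d) ->
  sym3 x -> exists2 h, 0 < h & St sg V x (tadd v w h).
Proof.
move=> t0 vs [_ vr] [ws wr] strict xs; have [_ x2] := xs; have [_ v2] := vs.
pose P (u : I * I * I * I * I) h := let: (p, a, b, c, d) := u in
  distinct V [:: p; a; b; c; d] -> special sg p a b c d ->
  smin (x p a c + x p b d) (x p a d + x p b c) (tadd v w h p a b + tadd v w h p c d)
    (tadd v w h p a c + tadd v w h p b d) (tadd v w h p a d + tadd v w h p b c).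
have [h h0 H] : exists2 h, 0 < h & forall s, 0 <= s -> s <= h -> forall u, P u s.
  apply: fin_small => -[[[[p a] b] c] d] /=.
  have [hd|hd] := boolP (distinct V [:: p; a; b; c; d]); last by exists 1.
  have [sp|sp] := boolP (special sg p a b c d); last by exists 1.
  have [k1 k2 k3] := vr _ _ _ _ _ hd sp; have [l1 l2 l3] := wr _ _ _ _ _ hd sp.
  have [lt|lt|E] := ltgtP (x p a c + x p b d) (x p a d + x p b c).
  - have lt' : tadd x v t p a c + tadd x v t p b d < tadd x v t p a d + tadd x v t p b c.
      have := strict p a c d b; have [_ T2] := sym3_tadd t xs vs.
      by rewrite (T2 p b d) (T2 p b c) (x2 p b d) (x2 p b c); apply.
    exists 1 => // s _ _ _ _; split=> // h'; [|by exfalso; lra|by exfalso; lra].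
    by rewrite /tadd addrACA -mulrDr (k1 lt) (l1 lt'); ring.
  - have lt' : tadd x v t p a d + tadd x v t p b c < tadd x v t p a c + tadd x v t p b d.
      have := strict p a d c b; have [_ T2] := sym3_tadd t xs vs.
      by rewrite (T2 p b d) (T2 p b c) (x2 p b d) (x2 p b c); apply.
    exists 1 => // s _ _ _ _; split=> // h'; [by exfalso; lra| |by exfalso; lra].
    by rewrite /tadd addrACA -mulrDr (k2 lt) (l2 lt'); ring.
  - have sm : smin (v p a c + v p b d) (v p a d + v p b c) (w p a b + w p c d)
       (w p a c + w p b d) (w p a d + w p b c).
      have M : t * (v p a c + v p b d) < t * (v p a d + v p b c) <->
          v p a c + v p b d < v p a d + v p b c by rewrite ltr_pM2l.
      have M' : t * (v p a d + v p b c) < t * (v p a c + v p b d) <->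
          v p a d + v p b c < v p a c + v p b d by rewrite ltr_pM2l.
      split=> lt.
      + by apply: l1; have := proj2 M lt; rewrite /tadd; lra.
      + by apply: l2; have := proj2 M' lt; rewrite /tadd; lra.
      + by apply: l3; have := congr1 ( *%R t) lt; rewrite /tadd; lra.
    have [h h0 hh] := smin_small (k3 E) sm; exists h => // s s0 sh _ _.
    split=> h'; [by exfalso; lra|by exfalso; lra|].
    by have := hh s s0 sh; rewrite /tadd /ismin; lra.
by exists h => //; split; [exact: sym3_tadd | move=> p a b c d; exact: (H h (ltW h0) (lexx _) (p, a, b, c, d))].
Qed.

Section Step.
Variables (V : {set I}) (x v : I -> I -> I -> R).
Hypothesis os : one_sided V x v.
Variable t : R.
Hypothesis t0 : 0 < t.
Hypothesis strict : forall p a b c d, x p a b + x p c d < x p a c + x p b d ->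
  tadd x v t p a b + tadd x v t p c d < tadd x v t p a c + tadd x v t p b d.
Local Notation x' := (tadd x v t).
Hypothesis x'TD : TD sg V x'.

Let xTD : TD sg V x. Proof. by case: os. Qed.
Let vSt : St sg V x v. Proof. by case: os. Qed.

Lemma os_span w : St sg V x' w -> exists c, Lin sg V x (tadd w v c).
Proof.
move=> hw; have [xs _] := xTD; have [vs _] := vSt; have [_ _ _ H] := os.
have [h h0 hvw] := St_move t0 vs vSt hw strict xs.
have [c c0 hL] := H _ hvw; exists ((1 - c) / h).
have := Lin_scale h^-1 hL; congr Lin.
do 3 (apply/funext => ?); rewrite /tadd.
by field; rewrite gt_eqF.
Qed.

Lemma os_Lin w : Lin sg V x w -> Lin sg V x' w.
Proof.
have [xs _] := xTD; have [vs _] := vSt; have [_ x2] := xs; have [_ T2] := sym3_tadd t xs vs.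
move=> [ws wr]; split=> // p a b c d h sp; have [k1 k2 k3] := wr _ _ _ _ _ h sp.
have S1 := strict (p := p) (a := a) (b := c) (c := d) (d := b).
have S2 := strict (p := p) (a := a) (b := d) (c := c) (d := b).
rewrite (T2 p b d) (T2 p b c) (x2 p b d) (x2 p b c) in S1 S2.
have [lt|lt|E] := ltgtP (x p a c + x p b d) (x p a d + x p b c).
- by have := S1 lt => l; split=> [_|h'|h']; [exact: k1 | exfalso; lra | exfalso; lra].
- by have := S2 lt => l; split=> [h'|_|h']; [exfalso; lra | exact: k2 | exfalso; lra].
- by have [e1 e2] := k3 E; split=> _.
Qed.

Lemma os_Lin_v : Lin sg V x' v.
Proof.
have [xs _] := xTD; have [vs vr] := vSt; have [_ x2] := xs; have [_ T2] := sym3_tadd t xs vs.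
split=> // p a b c d h sp; have [k1 k2 k3] := vr _ _ _ _ _ h sp.
have S1 := strict (p := p) (a := a) (b := c) (c := d) (d := b).
have S2 := strict (p := p) (a := a) (b := d) (c := c) (d := b).
rewrite (T2 p b d) (T2 p b c) (x2 p b d) (x2 p b c) in S1 S2.
have [lt|lt|E] := ltgtP (x p a c + x p b d) (x p a d + x p b c).
- by have := S1 lt => l; split=> [_|h'|h']; [exact: k1 | exfalso; lra | exfalso; lra].
- by have := S2 lt => l; split=> [h'|_|h']; [exfalso; lra | exact: k2 | exfalso; lra].
- have hm := k3 E.
  have P : t * (v p a c + v p b d) <= t * (v p a d + v p b c) ->
      v p a c + v p b d <= v p a d + v p b c by rewrite ler_pM2l.
  have P' : t * (v p a d + v p b c) <= t * (v p a c + v p b d) ->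
      v p a d + v p b c <= v p a c + v p b d by rewrite ler_pM2l.
  move: E hm; rewrite /tadd /ismin => E hm; split=> l.
  + by have := P ltac:(lra); lra.
  + by have := P' ltac:(lra); lra.
  + by have := P ltac:(lra); have := P' ltac:(lra); lra.
Qed.

Lemma os_addK w c : Lin sg V x' (tadd w v c) -> Lin sg V x' w.
Proof.
move=> h; have := Lin_add (- c) h os_Lin_v; congr Lin.
by do 3 (apply/funext => ?); rewrite /tadd; ring.
Qed.

(** By [os_span] the star of the moved point lies in the lineality space at [x] plus the line of
    [v], and both are lineal at the moved point. *)
Lemma os_generic : generic sg V x'.
Proof. by move=> w /os_span[c /os_Lin/os_addK]. Qed.

Lemma os_St w : St sg V x w -> Lin sg V x' w.
Proof. by move=> hw; have [_ _ _ /(_ w hw)[c _ /os_Lin/os_addK]] := os. Qed.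

Variable e : I.
Hypothesis eV : e \in V.
Hypothesis realV : realisable_TD R sg (V :\ e).
Local Notation dst := (distinct V).
Local Notation col y := (col V e y).

Lemma os_fib (w : I -> I -> R) : fib sg V e x w -> fib sg V e x' w.
Proof.
move=> fw; have [ws _] := fw; apply: (St_fib chi x'TD) => //.
by apply/Lin_St/os_St/(fib_St chi xTD).
Qed.

Let lin' : fib_linear sg V e x'.
Proof. exact: fib_linear_generic os_generic. Qed.

Lemma os_flat (w : I -> I -> R) : fib sg V e x w -> flat V e x' w.
Proof. by move=> /os_fib; apply: (fib_flat chi x'TD lin'). Qed.

Lemma agree_emove (w w' : I -> I -> R) : (forall p q, dst [:: e; p; q] -> w p q = w' p q) ->
  agree V (emove e w) (emove e w').
Proof.
move=> H a b c h; rewrite /emove; have [ea|ea] := eqVneq a e.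
  by apply: H; subst a; dcase h; dsplit.
have [eb|eb] := eqVneq b e; first by apply: H; subst b; dcase h; dsplit.
by have [ec|ec] := eqVneq c e; first by apply: H; subst c; dcase h; dsplit.
Qed.

(** The sets [U] and [U'] of [vanishing_fib] at [x] are unions of colours of the moved point that
    are not seen by [a], so both are the class of [j]. Not being disjoint, they fall under the
    second alternative: the indicator and its negative are both in the star. *)
Lemma os_colour a b1 b2 j : dst [:: e; a; b1; b2] ->
  (forall p q, dst [:: e; p; q] -> [|| col x' p q == col x' a b1, col x' p q == col x' a b2 | col x' p q == j]) ->
  Lin sg V x (emove e (fun p q => (col x' p q == j)%:R)).
Proof.
move=> h cov; set f := fun _ _ => _.
have fs : sym2 f by move=> p q; rewrite /f colC.
have [U [U' [Hd [v1 [t1 U1]] [v2 [t2 U2]] fU fU']]] := vanishing_fib chi eV xTD realV h.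
have main (W : I -> I -> bool) (c : R) (v3 t3 : I) : c != 0 -> W v3 t3 ->
    (forall p q : I, W p q -> dst [:: e; a; p; q]) ->
    flat V e x' (fun p q : I => c * (W p q)%:R) -> forall p q, dst [:: e; p; q] -> (col x' p q == j) = W p q.
  move=> c0 hW hd fl.
  have Wa b : W a b = false by apply/negP => /hd hh; dcase hh; dsub.
  have sep p q p' q' : col x' p q = col x' p' q' -> W p q = W p' q'.
    move=> /(flat_col fl)/(mulfI c0)/eqP; rewrite eqr_nat.
    by case: (W p q); case: (W p' q').
  have d3 : dst [:: e; v3; t3] by have hh := hd _ _ hW; dcase hh; dsplit.
  have colj p q : dst [:: e; p; q] -> W p q -> col x' p q == j.
    move=> hpq hw; case/or3P: (cov p q hpq) => // /eqP/sep; by rewrite hw Wa.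
  move=> p q hpq; apply/idP/idP; last exact: colj.
  by have /eqP <- := colj _ _ d3 hW => /eqP/sep->.
have HU (p q : I) : U p q -> dst [:: e; a; p; q] by move=> hu; apply: Hd; rewrite hu.
have HU' (p q : I) : U' p q -> dst [:: e; a; p; q] by move=> hu; apply: Hd; rewrite hu orbT.
have one0 : (1 : R) != 0 by exact: oner_neq0.
have mone0 : (-1 : R) != 0 by rewrite oppr_eq0 oner_neq0.
have jU : forall p q, dst [:: e; p; q] -> (col x' p q == j) = U p q.
  apply: (main U 1 v1 t1 one0 U1 HU).
  by have := os_flat fU; congr flat; do 2 (apply/funext => ?); rewrite mul1r.
have SU : St sg V x (emove e f).
  apply: St_agree (fib_St chi xTD fU); first exact: emove_sym.
  by apply: agree_emove => p q hpq; rewrite /f jU.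
case: fU' => [[fU' disj]|fU'].
  have jU' : forall p q, dst [:: e; p; q] -> (col x' p q == j) = U' p q.
    apply: (main U' 1 v2 t2 one0 U2 HU').
    by have := os_flat fU'; congr flat; do 2 (apply/funext => ?); rewrite mul1r.
  have d1 : dst [:: e; v1; t1] by have hh := HU _ _ U1; dcase hh; dsplit.
  by have := disj v1 t1; rewrite -jU' // jU // U1.
have jU' : forall p q, dst [:: e; p; q] -> (col x' p q == j) = U' p q.
  apply: (main U' (-1) v2 t2 mone0 U2 HU').
  by have := os_flat fU'; congr flat; do 2 (apply/funext => ?); rewrite mulN1r.
apply/LinP; split=> //.
have fsN : sym2 (fun p q => - f p q) by move=> p q; rewrite fs.
apply: (St_agree (w := emove e (fun p q => - (U' p q)%:R))).
- by have [f1 f2] := emove_sym e fs; split=> p q r; [rewrite f1 | rewrite f2].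
- move=> p q r hpqr; have := agree_emove (w := fun p q : I => - (U' p q)%:R) (w' := fun p q => - f p q) _ hpqr.
  move=> ->; last by move=> p' q' h'; rewrite /f jU'.
  by rewrite /emove; case: ifP => // _; case: ifP => // _; case: ifP => // _; rewrite oppr0.
- exact: (fib_St chi xTD fU').
Qed.

(** Rescaling the vector of [e] adds the same amount to the three sums of a relation. *)
Lemma const_Lin : Lin sg V x (emove e (fun _ _ => 1)).
Proof.
split; first by apply: emove_sym.
move=> p a b c d h sp; dcase h.
have E : emove e (fun _ _ => 1 : R) p a b + emove e (fun _ _ => 1) p c d =
  emove e (fun _ _ => 1) p a c + emove e (fun _ _ => 1) p b d /\
  emove e (fun _ _ => 1 : R) p a b + emove e (fun _ _ => 1) p c d =
  emove e (fun _ _ => 1) p a d + emove e (fun _ _ => 1) p b c.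
  rewrite /emove; have [ep|ep] := eqVneq p e; first by [].
  have [ea|ea] := eqVneq a e.
    have [-> [-> ->]] : (b == e) = false /\ ((c == e) = false /\ (d == e) = false).
      by subst a; rewrite !(eq_sym _ e); do !split; apply/negbTE.
    by [].
  have [eb|eb] := eqVneq b e.
    have [-> ->] : (c == e) = false /\ (d == e) = false.
      by subst b; rewrite !(eq_sym _ e); split; apply/negbTE.
    by rewrite ?add0r ?addr0.
  have [ec|ec] := eqVneq c e.
    have -> : (d == e) = false by subst c; rewrite (eq_sym d); apply/negbTE.
    by rewrite ?add0r ?addr0.
  by have [ed|ed] := eqVneq d e; rewrite ?add0r ?addr0.
by have [e1 e2] := E; split=> _ //; split.
Qed.

Hypothesis few : few_colours (V :\ e) (col x').

(** Functions of three colours are spanned by the constants and two indicators. By [os_colour],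
    these are supplied by the colour missing at [a] and by the one missing at [b], which sees the
    colour of [b c] and one of the colours of [a]. *)
Lemma os_fib_Lin p0 q0 r0 (w : I -> I -> R) : dst [:: e; p0; q0; r0] -> fib sg V e x' w -> Lin sg V x (emove e w).
Proof.
move=> h0 /(fib_flat chi x'TD lin') fw.
have [a [b1 [b2 [b [c sds]]]]] := seeds_ex chi eV x'TD realV lin' h0.
have [h12 hbc n12 n1 n2] := sds; have [ws _ _] := fw.
have cov p q := @seeds_cover _ _ _ _ _ eV a b1 b2 b c p q sds few.
have LD := os_colour h12 cov.
have hba : dst [:: e; b; a; c] by dcase hbc; dsplit.
have Eab : col x' a b = col x' a b1 \/ col x' a b = col x' a b2.
  have [->|nb1] := eqVneq b b1; first by left.
  have [->|nb2] := eqVneq b b2; first by right.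
  have := @col_two _ _ V e x' eV a b1 b2 b; rewrite distinctD1 // (negPf n12) /= => C.
  have := C ltac:(dcase h12; dcase hbc; dsplit) => /orP[]/eqP->; by [right | left].
have finish k l : [/\ col x' b a = k, l != k, col x' b c != l & forall p q, dst [:: e; p; q] ->
    [|| col x' p q == k, col x' p q == l | col x' p q == col x' b c]] ->
    forall p1 q1, col x' p1 q1 = l -> Lin sg V x (emove e w).
  move=> [Ek lk Dl cov'] p1 q1 El.
  have cov2 p q : dst [:: e; p; q] ->
      [|| col x' p q == col x' b a, col x' p q == col x' b c | col x' p q == l].
    by move=> /cov'; rewrite Ek => /or3P[]->; rewrite ?orbT.
  have Ll := os_colour hba cov2.
  have L0 := Lin_scale (w b a) const_Lin.
  have L1 := Lin_add (w b c - w b a) L0 LD.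
  have L2 := Lin_add (w p1 q1 - w b a) L1 Ll.
  apply: Lin_agree L2; first exact: emove_sym.
  pose w2 p q := w b a + (w b c - w b a) * (col x' p q == col x' b c)%:R +
    (w p1 q1 - w b a) * (col x' p q == l)%:R.
  move=> p q r h; have <- := agree_emove (w := w2) (w' := w) _ h.
    rewrite /tadd /emove /w2; case: ifP => _; first by rewrite mulr1.
    by case: ifP => _; [rewrite mulr1 | case: ifP => _; rewrite ?mulr1 // !mulr0 !addr0].
  move=> p' q' h'; rewrite /w2; case/or3P: (cov' p' q' h') => /eqP E.
  - rewrite (flat_col fw (_ : col x' p' q' = col x' b a)) ?Ek // E.
    have -> : (k == col x' b c) = false.
      have -> : k = col x' a b by rewrite -Ek colC.
      by apply/negbTE; case: Eab => ->; rewrite eq_sym.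
    by rewrite eq_sym (negPf lk) !mulr0 !addr0.
  - rewrite (flat_col fw (_ : col x' p' q' = col x' p1 q1)) ?El // E eqxx eq_sym (negPf Dl) mulr0.
    by rewrite addr0 mulr1; ring.
  - by rewrite (flat_col fw E) E eqxx (negPf Dl) mulr0 mulr1; ring.
case: Eab => E.
- apply: (finish (col x' a b1) (col x' a b2) _ a b2 (erefl _)); split=> //.
  + by rewrite colC.
  + by rewrite eq_sym.
- apply: (finish (col x' a b2) (col x' a b1) _ a b1 (erefl _)); split=> //.
  + by rewrite colC.
  + by move=> p q /cov /or3P[]->; rewrite ?orbT.
Qed.

End Step.
End OneSided.

Section NoOneSided.
Variables (R : realType) (I : finType) (sg : I -> I -> I -> bool).
Hypothesis chi : chirotope sg.
Implicit Types (x v w : I -> I -> I -> R).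

Lemma St_sub (V U : {set I}) x w : U \subset V -> St sg V x w -> St sg U x w.
Proof.
move=> /fintype.subsetP UV [s H]; split=> // p a b c d /andP[u /allP h]; apply: H.
by rewrite /distinct u; apply/allP => z /h; apply: UV.
Qed.

Lemma Lin_sub (V U : {set I}) x w : U \subset V -> Lin sg V x w -> Lin sg U x w.
Proof.
move=> /fintype.subsetP UV [s H]; split=> // p a b c d /andP[u /allP h]; apply: H.
by rewrite /distinct u; apply/allP => z /h; apply: UV.
Qed.

(** [e] is chosen with few colours at the nearby generic point [x + t v]. All directions moving only
    [e] turn out to be lineal at [x], so the ray must survive the removal of [e]. *)
Lemma no_one_sided_step (V : {set I}) x v : (#|V| <= 8)%N ->
  (forall e x v, e \in V -> ~ one_sided sg (V :\ e) x v) -> ~ one_sided sg V x v.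
Proof.
move=> V8 IH os; have [xTD vSt nL H] := os; have [vs _] := vSt.
have [e0 [p0 [q0 [r0 [s0 h0]]]]] : exists e p q r s, distinct V [:: e; p; q; r; s].
  apply: contrapT => N; apply: nL; split=> // p a b c d h _.
  by case: N; exists p, a, b, c, d.
have [t1 t10 T1] := St_TD xTD vSt; have [t2 t20 T2] := strict_small x v.
pose t := Num.min t1 t2; have t0 : 0 < t by rewrite lt_min t10.
have x'TD : TD sg V (tadd x v t) by apply: T1; [exact: ltW | rewrite ge_min lexx].
have strict := T2 t (ltW t0) ltac:(by rewrite ge_min lexx orbT).
have e0V : e0 \in V by dcase h0.
have [e eV few] := few_colours_ex chi V8 x'TD e0V.
have cardV : (#|V :\ e| <= 8)%N by apply: leq_trans (subset_leq_card (finset.subD1set V e)) V8.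
have realV : realisable_TD R sg (V :\ e) by exact: realisable_le8.
have [p [q [r hpqr]]] : exists p q r, distinct V [:: e; p; q; r].
  dcase h0; have [E|n1] := eqVneq e e0; first by exists p0, q0, r0; subst e; dsplit.
  have [E|n2] := eqVneq e p0; first by exists e0, q0, r0; subst e; dsplit.
  have [E|n3] := eqVneq e q0; first by exists e0, p0, r0; subst e; dsplit.
  by exists e0, p0, q0; dsplit.
have FL (w : I -> I -> R) : fib sg V e (tadd x v t) w -> Lin sg V x (emove e w).
  exact: (os_fib_Lin chi os t0 strict x'TD eV realV few hpqr).
have Ffib (w : I -> I -> R) : fib sg V e x w -> fib sg V e (tadd x v t) w.
  exact: (os_fib chi os t0 strict x'TD).
have lin' : fib_linear sg V e (tadd x v t).
  by apply: (fib_linear_generic chi eV x'TD); apply: (os_generic os t0 strict).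
have FLx (w : I -> I -> R) : fib sg V e x w -> Lin sg V x (emove e w) by move=> /Ffib/FL.
have lin : fib_linear sg V e x.
  move=> w fw; have [ws _] := fw; apply: (St_fib chi xTD).
    by move=> a b; rewrite ws.
  have /LinP[_] := FLx _ fw; apply: St_agree; first by apply: emove_sym => a b; rewrite ws.
  move=> a b c h; rewrite /emove; case: ifP => // _; case: ifP => // _; case: ifP => // _.
  by rewrite oppr0.
(* Thus [x] has the same colours as the nearby point, and [known_all] and [lift_star] apply to [x]
   itself. *)
have flatE (w : I -> I -> R) : flat V e x w <-> flat V e (tadd x v t) w.
  split=> fw; first by apply: (fib_flat chi x'TD lin'); apply: Ffib; apply: (flat_fib chi xTD).
  apply: (fib_flat chi xTD lin); have fw' := flat_fib chi x'TD fw; have [ws _] := fw'.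
  by apply: (St_fib chi xTD ws); apply: Lin_St; apply: FL.
have colE a b : col V e x a b = col V e (tadd x v t) a b.
  by apply/setP => -[f g]; rewrite !inE /=; apply/asboolP/asboolP => K w /flatE; apply: K.
have few' : few_colours (V :\ e) (col V e x).
  by have [k1 [k2 [k3 hk]]] := few; exists k1, k2, k3 => a b h; rewrite colE; apply: hk.
have [a [b1 [b2 [b [c sds]]]]] := seeds_ex chi eV xTD realV lin hpqr.
have kn := known_all chi eV xTD realV lin sds few'; have [h12 hbc _ _ _] := sds.
have lift u : St sg (V :\ e) x u -> exists w, St sg V x w /\ agree (V :\ e) w u.
  by move=> uSt; exact: (lift_star chi eV xTD realV uSt h12 hbc kn).
have sub := finset.subD1set V e.
(* If [v] is not lineal without [e], one-sidedness passes to [V :\ e] by lifting; otherwise [- v] is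
   lifted. *)
have [vL|nvL] := pselect (Lin sg (V :\ e) x v); last first.
  apply: (IH e x v eV); split=> //; [exact: TD_sub sub xTD | exact: St_sub sub vSt |].
  move=> u uSt; have [w [hw ag]] := lift u uSt; have [c0 c00 hc] := H w hw; exists c0 => //.
  have [us _] := uSt; apply: Lin_agree (Lin_sub sub hc); first exact: sym3_tadd.
  by move=> f g h hd; rewrite /tadd ag.
have /LinP[_ vN] := vL; have [w [hw ag]] := lift _ vN; have [c0 c00 hc] := H w hw.
have [ws _] := hw.
(* [w] restricts to [- v], so [y] only moves [e] and is lineal; but modulo lineal directions it is
   [c0 + 1] times [v]. *)
pose y := tadd w v 1; have ys : sym3 y by exact: sym3_tadd.
have ySt : St sg V x y.
  have c1 : 0 <= c0 + 1 by lra.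
  have := St_Lin_add 1 (St_scale c1 vSt) hc; congr St.
  by do 3 (apply/funext => ?); rewrite /y /tadd; ring.
pose z f g := y e f g.
have zs : sym2 z by move=> f g; rewrite /z; case: ys => _ ->.
have yz : agree V y (emove e z).
  move=> f g h hd; rewrite /emove /z; have [y1 y2] := ys.
  have [E|nf] := eqVneq f e; first by subst f.
  have [E|ng] := eqVneq g e; first by subst g; rewrite y1.
  have [E|nh] := eqVneq h e; first by subst h; rewrite (y2 f e g) y1.
  rewrite /y /tadd ag ?mul1r ?addNr // distinctD1 //; dcase hd; dsplit.
have fz : fib sg V e x z.
  by apply: (St_fib chi xTD zs); apply: St_agree ySt => //; exact: emove_sym.
have yL : Lin sg V x y.
  by apply: Lin_agree (FLx _ fz) => //; move=> f g h hd; rewrite yz.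
apply: nL; have c1 : c0 + 1 != 0 by rewrite gt_eqF //; lra.
have := Lin_scale (c0 + 1)^-1 (Lin_add (-1) yL hc); congr Lin.
by do 3 (apply/funext => ?); rewrite /y /tadd; field.
Qed.

Lemma no_one_sided (V : {set I}) x v : (#|V| <= 8)%N -> ~ one_sided sg V x v.
Proof.
move: {2}#|V| (leqnn #|V|) => n; elim: n V x v => [|n IH] V x v Vn V8;
  apply: no_one_sided_step => // e x' v' eV.
  by move: Vn; rewrite (cardsD1 e V) eV.
have eVn := cardsD1 e V; rewrite eV add1n in eVn.
by apply: IH; [rewrite -ltnS -eVn | apply: ltnW; rewrite -eVn].
Qed.

End NoOneSided.

(** * Polyhedral cones *)

Local Open Scope classical_set_scope.

Section ConicHulls.
Variables (R : realType) (E : lmodType R).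
Implicit Types (s : seq E) (v w : E) (C D : set E).

Lemma hull0 s : conic_hull s 0.
Proof. by exists (fun _ => 0); split=> //; rewrite big1 // => i _; rewrite scale0r. Qed.

Lemma hullD s v w : conic_hull s v -> conic_hull s w -> conic_hull s (v + w).
Proof.
move=> [a [a0 ->]] [b [b0 ->]]; exists (fun i => a i + b i); split=> [i|].
  exact: addr_ge0.
by rewrite -big_split; apply: eq_bigr => i _; rewrite scalerDl.
Qed.

Lemma hullZ s c v : 0 <= c -> conic_hull s v -> conic_hull s (c *: v).
Proof.
move=> c0 [a [a0 ->]]; exists (fun i => c * a i); split=> [i|]; first exact: mulr_ge0.
by rewrite scaler_sumr; apply: eq_bigr => i _; rewrite scalerA.
Qed.

Lemma hull_sum s (T : Type) (r : seq T) (P : pred T) (F : T -> E) :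
  (forall i, P i -> conic_hull s (F i)) -> conic_hull s (\sum_(i <- r | P i) F i).
Proof. by move=> H; apply: big_ind => //; [exact: hull0 | exact: hullD]. Qed.

Lemma hull_mem s v : v \in s -> conic_hull s v.
Proof.
move=> vs; have i_lt : (index v s < size s)%N by rewrite index_mem.
exists (fun i => (i == Ordinal i_lt)%:R); split=> [i|]; first exact: ler0n.
rewrite (bigD1 (Ordinal i_lt)) //= eqxx scale1r nth_index // big1 ?addr0 // => i /negPf ->.
by rewrite scale0r.
Qed.

Lemma hull_sub s s' : (forall v, v \in s -> conic_hull s' v) -> conic_hull s `<=` conic_hull s'.
Proof.
move=> H v [a [a0 ->]]; apply: hull_sum => i _; apply: hullZ => //; apply: H.
exact: mem_nth.
Qed.

(* One step of the double description method. *)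
Lemma polyhedral_halfspace C (l : {scalar E}) : polyhedral_cone C ->
  polyhedral_cone (C `&` [set v | 0 <= l v]).
Proof.
move=> [s ->]; pose pairs := [seq l p *: q - l q *: p | p <- [seq p <- s | 0 < l p],
   q <- [seq q <- s | l q < 0]].
exists ([seq v <- s | 0 <= l v] ++ pairs); set s' := _ ++ _; rewrite eqEsubset; split; last first.
  move=> v hv; split.
    move: v hv; apply: hull_sub => v; rewrite mem_cat => /orP[|/allpairsP[[p q] /= []]].
      by rewrite mem_filter => /andP[_ /hull_mem].
    rewrite !mem_filter => /andP[lp /hull_mem hp] /andP[lq /hull_mem hq] ->.
    by rewrite -scaleNr; apply: hullD; apply: hullZ; rewrite // ?oppr_ge0 ltW.
  case: hv => a [a0 ->] /=; rewrite linear_sum sumr_ge0 // => i _; rewrite linearZ.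
  apply: mulr_ge0 => //; have := mem_nth 0 (ltn_ord i); rewrite mem_cat.
  move=> /orP[|/allpairsP[[p q] /= [_ _ ->]]]; first by rewrite mem_filter => /andP[].
  by rewrite linearB !linearZ /= mulrC subrr.
move=> v [[a [a0 ev]] /= lv].
have pos i : 0 <= l s`_i -> (i < size s)%N -> conic_hull s' s`_i.
  by move=> li hi; apply: hull_mem; rewrite mem_cat mem_filter li mem_nth.
have neg (i j : 'I_(size s)) : 0 < l s`_i -> l s`_j < 0 ->
    conic_hull s' (l s`_i *: s`_j - l s`_j *: s`_i).
  move=> li lj; apply: hull_mem; rewrite mem_cat; apply/orP; right.
  by apply/allpairsP; exists (s`_i, s`_j); rewrite /= !mem_filter li lj !mem_nth.
pose A := \sum_(i < size s | 0 < l s`_i) a i * l s`_i.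
pose B := \sum_(j < size s | l s`_j < 0) a j * - l s`_j.
have B0 : 0 <= B by apply: sumr_ge0 => j /ltW lj; rewrite mulr_ge0 // oppr_ge0.
have split3 (Z : zmodType) (F : 'I_(size s) -> Z) : \sum_(i < size s) F i =
    \sum_(i < size s | l s`_i == 0) F i + (\sum_(i < size s | 0 < l s`_i) F i + \sum_(i < size s | l s`_i < 0) F i).
  rewrite (bigID (fun i : 'I_(size s) => l s`_i == 0)) /=; congr (_ + _).
  rewrite (bigID (fun i : 'I_(size s) => 0 < l s`_i)) /=; congr (_ + _); apply: eq_bigl => i.
    by case: ltgtP.
  by case: ltgtP.
have lvE : l v = A - B.
  rewrite ev linear_sum split3 big1 => [|i /eqP li]; last by rewrite linearZ /= li mulr0.
  rewrite add0r /A /B -sumrN; congr (_ + _); apply: eq_bigr => i _; rewrite linearZ //=.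
  by rewrite mulrN opprK.
have AB : B <= A by rewrite -subr_ge0 -lvE.
rewrite ev split3; apply: hullD.
  by apply: hull_sum => i /eqP li; apply: hullZ => //; apply: pos; rewrite ?li.
have [A0|A0] := eqVneq A 0.
  have B00 : B = 0 by apply/eqP; rewrite eq_le B0 -A0 AB.
  apply: hullD; first by apply: hull_sum => i li; apply: hullZ => //; apply: pos; rewrite // ltW.
  rewrite big1 => [|j lj]; first exact: hull0.
  move: B00 => /eqP; rewrite psumr_eq0; last by move=> k /ltW lk; rewrite mulr_ge0 // oppr_ge0.
  move=> /allP/(_ j); rewrite mem_index_enum lj => /(_ isT).
  rewrite mulf_eq0 oppr_eq0 (lt_eqF lj) orbF => /eqP ->; by rewrite scale0r.
have A_gt0 : 0 < A by rewrite lt_neqAle eq_sym A0 (le_trans B0).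
(* Negative generators are paired with positive ones in proportion to their share in [A]; the part
   [1 - B / A] of the positive generators is left over, and it is nonnegative because [l v] is
   [A - B]. *)
have -> : \sum_(i < size s | 0 < l s`_i) a i *: s`_i + \sum_(i < size s | l s`_i < 0) a i *: s`_i =
    \sum_(i < size s | 0 < l s`_i) \sum_(j < size s | l s`_j < 0) (a i * a j / A) *: (l s`_i *: s`_j - l s`_j *: s`_i)
    + (1 - B / A) *: \sum_(i < size s | 0 < l s`_i) a i *: s`_i.
  have e1 : \sum_(i < size s | 0 < l s`_i) \sum_(j < size s | l s`_j < 0) (a i * a j / A) *: (l s`_i *: s`_j) =
      \sum_(j < size s | l s`_j < 0) a j *: s`_j.
    rewrite exchange_big /=; apply: eq_bigr => j _.
    rewrite (eq_bigr (fun i : 'I_(size s) => ((a i * l s`_i) * (a j / A)) *: s`_j)); last first.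
      by move=> i _; rewrite scalerA; congr (_ *: _); ring.
    by rewrite -scaler_suml -mulr_suml -/A mulrCA divff // mulr1.
  have e2 : \sum_(i < size s | 0 < l s`_i) \sum_(j < size s | l s`_j < 0) (a i * a j / A) *: (l s`_j *: s`_i) =
      - (B / A) *: \sum_(i < size s | 0 < l s`_i) a i *: s`_i.
    rewrite scaler_sumr; apply: eq_bigr => i _.
    rewrite (eq_bigr (fun j : 'I_(size s) => ((a j * - l s`_j) * - (a i / A)) *: s`_i)); last first.
      by move=> j _; rewrite scalerA; congr (_ *: _); ring.
    by rewrite -scaler_suml -mulr_suml -/B scalerA; congr (_ *: _); ring.
  have e3 : \sum_(i < size s | 0 < l s`_i) \sum_(j < size s | l s`_j < 0) (a i * a j / A) *: (l s`_i *: s`_j - l s`_j *: s`_i) =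
      \sum_(j < size s | l s`_j < 0) a j *: s`_j + (B / A) *: \sum_(i < size s | 0 < l s`_i) a i *: s`_i.
    rewrite -e1 -[(B / A) *: _]opprK -scaleNr -e2 -sumrB; apply: eq_bigr => i _.
    by rewrite -sumrB; apply: eq_bigr => j _; rewrite scalerBr.
  rewrite e3 scalerBl scale1r -[RHS]addrA [X in _ = _ + X]addrC subrK.
  by rewrite addrC.
apply: hullD.
  apply: hull_sum => i li; apply: hull_sum => j lj; apply: hullZ; last exact: neg.
  by rewrite divr_ge0 ?mulr_ge0 // ltW.
apply: hullZ; first by rewrite subr_ge0 ler_pdivrMr // mul1r.
by apply: hull_sum => i li; apply: hullZ => //; apply: pos; rewrite // ltW.
Qed.

Lemma polyhedral_system (T : eqType) (r : seq T) (l : T -> {scalar E}) :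
  polyhedral_cone [set: E] -> polyhedral_cone [set v | forall t, t \in r -> 0 <= l t v].
Proof.
move=> h; elim: r => [|t r IH].
  rewrite (_ : [set v | _] = setT) //.
  by rewrite eqEsubset; split=> v //= _ t.
rewrite (_ : [set v | _] = [set v | forall t, t \in r -> 0 <= l t v] `&` [set v | 0 <= l t v]).
  exact: polyhedral_halfspace.
rewrite eqEsubset; split=> v /=.
  by move=> H; split=> [u hu|]; apply: H; rewrite inE ?eqxx // hu orbT.
by move=> [H1 H2] u; rewrite inE => /orP[/eqP->|] //; exact: H1.
Qed.

End ConicHulls.

(** * The fan of a prevariety of minima *)

(** The sign of [q] tells, for all three triples, which of the two terms is the minimum; on that
    side the relation is linear. *)
Lemma ismin_sub (R : realType) (q c w1 w2 w3 g1 g2 g3 : R)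
  (same := fun d : R => d = 0 \/ (0 < q /\ 0 < d) \/ (q < 0 /\ d < 0)) :
  ismin w1 w2 w3 -> ismin g1 g2 g3 -> same (w2 - w3) -> same (g2 - g3) ->
  same (w2 - w3 - c * (g2 - g3)) -> ismin (w1 - c * g1) (w2 - c * g2) (w3 - c * g3).
Proof.
rewrite /same /ismin => h1 h2 s1 s2 s3; have [q0|q0] := ltP 0 q.
  have [-> ->] : w1 = w3 /\ g1 = g3 by (split; lra). lra.
have [-> ->] : w1 = w2 /\ g1 = g2 by (split; lra). lra.
Qed.

Section MinFan.
Variables (R : realType) (E : lmodType R) (J : finType) (f1 f2 f3 : J -> {scalar E}).
Implicit Types (x y z w v g h : E) (r : J) (D : set E).

Definition prevariety : set E := [set x | forall r, ismin (f1 r x) (f2 r x) (f3 r x)].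
Local Notation T := prevariety.

Definition gap r x := f2 r x - f3 r x.

Definition below y x := forall r, gap r y = 0 \/
  (0 < gap r x /\ 0 < gap r y) \/ (gap r x < 0 /\ gap r y < 0).

Definition agreeing y z := forall r,
  (0 <= gap r y /\ 0 <= gap r z) \/ (gap r y <= 0 /\ gap r z <= 0).

Definition cell x : set E := [set y | T y /\ below y x].

Lemma gapD r x y : gap r (x + y) = gap r x + gap r y.
Proof. by rewrite /gap !linearD /=; ring. Qed.

Lemma gapZ r c x : gap r (c *: x) = c * gap r x.
Proof. by rewrite /gap !linearZ /=; ring. Qed.

Lemma gap0 r : gap r 0 = 0.
Proof. by rewrite /gap !linear0 subrr. Qed.

Lemma T0 : T 0.
Proof. by move=> r; rewrite !linear0; left. Qed.

Lemma T_ge r x : T x -> 0 <= gap r x -> f1 r x = f3 r x.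
Proof. by move=> /(_ r); rewrite /gap /ismin; lra. Qed.

Lemma T_le r x : T x -> gap r x <= 0 -> f1 r x = f2 r x.
Proof. by move=> /(_ r); rewrite /gap /ismin; lra. Qed.

Lemma below_refl x : below x x.
Proof. by move=> r; lra. Qed.

Lemma below_trans y x z : below x y -> below y z -> below x z.
Proof. by move=> h k r; have := h r; have := k r; lra. Qed.

Lemma below_agree x y z : below y x -> below z x -> agreeing y z.
Proof. by move=> h k r; have := h r; have := k r; lra. Qed.

Lemma agree_T y z : T y -> T z -> agreeing y z -> T (y + z).
Proof.
move=> Ty Tz h r; have := h r; have := Ty r; have := Tz r.
by rewrite !linearD /= /gap /ismin; lra.
Qed.

(** The minimum is superadditive, and strictly so when the gaps have opposite signs. *)
Lemma T_agree y z : T y -> T z -> T (y + z) -> agreeing y z.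
Proof.
move=> Ty Tz Tyz r; have := Tyz r; have := Ty r; have := Tz r.
by rewrite !linearD /= /gap /ismin; lra.
Qed.

Lemma below_addl y z : agreeing y z -> below y (y + z).
Proof. by move=> h r; have := h r; rewrite gapD; lra. Qed.

Lemma below_addr y z : agreeing y z -> below z (y + z).
Proof. by move=> h r; have := h r; rewrite gapD; lra. Qed.

Lemma add_below y z x : below y x -> below z x -> below (y + z) x.
Proof. by move=> h k r; have := h r; have := k r; rewrite gapD; lra. Qed.

Lemma cell0 x : cell x 0.
Proof. by split; [exact: T0 | move=> r; rewrite gap0; left]. Qed.

Lemma cell_refl x : T x -> cell x x.
Proof. by move=> Tx; split=> //; exact: below_refl. Qed.

Lemma cellD x y z : cell x y -> cell x z -> cell x (y + z).
Proof.
move=> [Ty hy] [Tz hz]; split; last exact: add_below.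
by apply: agree_T => //; apply: below_agree hy hz.
Qed.

Lemma cell_sub x y : below x y -> cell x `<=` cell y.
Proof. by move=> h z [Tz hz]; split=> //; exact: below_trans hz h. Qed.

Lemma cell_eq x y : below x y -> below y x -> cell x = cell y.
Proof. by move=> h k; rewrite eqEsubset; split; apply: cell_sub. Qed.

Definition strict x : nat := #|[pred r | gap r x != 0]|.

Lemma strict_below x y : below x y -> ~ below y x -> (strict x < strict y)%N.
Proof.
move=> h nk; apply: proper_card; apply/properP; split.
  by apply/fintype.subsetP => r; rewrite !inE => n; apply/eqP => E0; move/eqP: n; apply; have := h r; lra.
have [r hr] : exists r, gap r x = 0 /\ gap r y != 0.
  apply: contrapT => H; apply: nk => r; have [E0|n] := eqVneq (gap r y) 0; first by left.
  have [E1|n1] := eqVneq (gap r x) 0; first by case: H; exists r.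
  by case: (h r) => [E2|]; [rewrite E2 eqxx in n1 | lra].
by exists r; rewrite !inE; [case: hr | case: hr => -> _; rewrite eqxx].
Qed.

Lemma strict_max (P : E -> Prop) x : P x -> exists2 y, P y & forall z, P z -> (strict z <= strict y)%N.
Proof.
move=> Px; pose Q n := `[< exists y, P y /\ strict y = n >].
have Q0 : exists n, Q n by exists (strict x); apply/asboolP; exists x.
have Qm n : Q n -> (n <= #|J|)%N by move=> /asboolP[y [_ <-]]; exact: max_card.
case: (ex_maxnP Q0 Qm) => n /asboolP[y [Py <-]] mx; exists y => // z Pz.
by apply: mx; apply/asboolP; exists z.
Qed.

(* The sum of the elements of a convex subset of the prevariety would be a
   point of its relative interior; one of maximal pattern does as well. *)
Lemma interior_point D : D `<=` T -> D 0 -> (forall y z, D y -> D z -> D (y + z)) ->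
  exists2 y, D y & forall z, D z -> below z y.
Proof.
move=> DT D0 DD; have [y Dy mx] := strict_max D0; exists y => // z Dz.
have Dyz := DD _ _ Dy Dz; have ag := T_agree (DT _ Dy) (DT _ Dz) (DT _ Dyz).
have [h|h] := pselect (below (y + z) y); first exact: below_trans (below_addr ag) h.
by have := strict_below (below_addl ag) h; rewrite ltnNge mx.
Qed.

Definition star x w := forall r, smin (f2 r x) (f3 r x) (f1 r w) (f2 r w) (f3 r w).
Definition lin x w := forall r, slin (f2 r x) (f3 r x) (f1 r w) (f2 r w) (f3 r w).

Lemma star_small x w : T x -> star x w -> exists2 e, 0 < e &
  forall t, 0 <= t -> t <= e -> T (x + t *: w) /\ below x (x + t *: w).
Proof.
move=> Tx hw.
have [e1 e10 H1] := @fin_small R J (fun r t => ismin (f1 r x + t * f1 r w) (f2 r x + t * f2 r w)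
   (f3 r x + t * f3 r w)) (fun r => smin_small (Tx r) (hw r)).
have [e2 e20 H2] : exists2 e, 0 < e & forall t, 0 <= t -> t <= e -> forall r,
    gap r x = 0 \/ (0 < gap r (x + t *: w) /\ 0 < gap r x) \/ (gap r (x + t *: w) < 0 /\ gap r x < 0).
  apply: fin_small => r; have [lt|lt|E0] := ltgtP (gap r x) 0.
  - have [e e0 he] := lt_small (gap r w) 0 lt; exists e => // t t0 te; right; right.
    by rewrite gapD gapZ; have := he t t0 te; rewrite mulr0 addr0.
  - have [e e0 he] := lt_small 0 (gap r w) lt; exists e => // t t0 te; right; left.
    by rewrite gapD gapZ; have := he t t0 te; rewrite mulr0 addr0.
  - by exists 1 => // t _ _; left.
exists (Num.min e1 e2); first by rewrite lt_min e10.
move=> t t0; rewrite le_min => /andP[te1 te2]; split=> r; last exact: H2.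
by have := H1 t t0 te1 r; rewrite !linearD !linearZ.
Qed.

Lemma below_lin z x : T x -> T z -> below z x -> lin x z.
Proof.
move=> Tx Tz h r; have := h r; have := Tz r; rewrite /gap /ismin => h1 h2.
by split=> lt; lra.
Qed.

Lemma lin_star x w : lin x w -> star x w.
Proof. by move=> h r; apply: slinW. Qed.

Lemma lin_opp x w : lin x w -> lin x (- w).
Proof.
move=> h r; have [k1 k2 k3] := h r; rewrite !linearN.
by split=> lt; [rewrite k1 | rewrite k2 | have [<- <-] := k3 lt].
Qed.

Lemma lin_small x w : T x -> lin x w -> exists2 e, 0 < e &
  forall t, 0 <= t -> t <= e -> cell x (x + t *: w).
Proof.
move=> Tx hw; have [e e0 he] := star_small Tx (lin_star hw); exists e => // t t0 te.
have [h1 h2] := he t t0 te; split=> // r; have := h2 r; have [_ _ k3] := hw r.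
rewrite gapD gapZ; have [E0|n] := eqVneq (gap r x) 0; last first.
  by case=> [E2|]; [rewrite E2 eqxx in n | lra].
have [k4 k5] := k3 ltac:(by move: E0; rewrite /gap; lra).
by move=> _; left; rewrite E0 /gap -k4 -k5 subrr mulr0 addr0.
Qed.

Definition comb (q : J * (R * R * R)) x :=
  q.2.1.1 * f1 q.1 x + q.2.1.2 * f2 q.1 x + q.2.2 * f3 q.1 x.

Lemma comb_scalar q : scalar (comb q).
Proof. by move=> c x y; rewrite /comb !linearP /=; ring. Qed.

HB.instance Definition _ q := GRing.isLinear.Build R E R *%R (comb q) (comb_scalar q).

Definition bounds x r : seq (R * R * R) :=
  if 0 < gap r x then [:: (1, 0, -1); (-1, 0, 1); (0, 1, -1)]
  else if gap r x < 0 then [:: (1, -1, 0); (-1, 1, 0); (0, -1, 1)]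
  else [:: (1, -1, 0); (-1, 1, 0); (1, 0, -1); (-1, 0, 1)].

Lemma cell_polyhedral x : polyhedral_cone [set: E] -> polyhedral_cone (cell x).
Proof.
move=> hE; pose L := [seq (r, q) | r <- enum J, q <- bounds x r].
have := polyhedral_system L (fun q => comb q : {scalar E}) hE; congr polyhedral_cone.
rewrite eqEsubset; split=> y /=.
  move=> H; have K r q : q \in bounds x r -> 0 <= comb (r, q) y.
    by move=> hq; apply: H; apply/allpairsPdep; exists r, q; rewrite mem_enum.
  have Kr r : ismin (f1 r y) (f2 r y) (f3 r y) /\ (gap r y = 0 \/
      (0 < gap r x /\ 0 < gap r y) \/ (gap r x < 0 /\ gap r y < 0)).
    move: (K r); rewrite /bounds; have [lt|lt|E0] := ltgtP 0 (gap r x) => {}K.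
    - have := K (1, 0, -1) ltac:(by rewrite !inE eqxx); have := K (-1, 0, 1) ltac:(by rewrite !inE eqxx ?orbT).
      have := K (0, 1, -1) ltac:(by rewrite !inE eqxx ?orbT); rewrite /comb /ismin /gap /=; lra.
    - have := K (1, -1, 0) ltac:(by rewrite !inE eqxx); have := K (-1, 1, 0) ltac:(by rewrite !inE eqxx ?orbT).
      have := K (0, -1, 1) ltac:(by rewrite !inE eqxx ?orbT); rewrite /comb /ismin /gap /=; lra.
    - have := K (1, -1, 0) ltac:(by rewrite !inE eqxx); have := K (-1, 1, 0) ltac:(by rewrite !inE eqxx ?orbT).
      have := K (1, 0, -1) ltac:(by rewrite !inE eqxx ?orbT).
      have := K (-1, 0, 1) ltac:(by rewrite !inE eqxx ?orbT); rewrite /comb /ismin /gap /=; lra.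
  by split=> r; have [] := Kr r.
move=> [Ty hy] t /allpairsPdep[r [q [_ + ->]]]; have := Ty r; have := hy r.
rewrite /bounds /comb /ismin /gap /= => h1 h2.
case: ifP => [c1|/negbT c1]; last case: ifP => [c2|/negbT c2].
- by rewrite !inE => /or3P[]/eqP-> /=; lra.
- by rewrite !inE => /or3P[]/eqP-> /=; lra.
- by rewrite !inE => /or4P[]/eqP-> /=; lra.
Qed.

Definition gap_sum (c : J -> R) x := \sum_r c r * gap r x.

Lemma gap_sum_scalar c : scalar (gap_sum c).
Proof.
move=> a x y; rewrite /gap_sum mulr_sumr -big_split; apply: eq_bigr => r _.
by rewrite /= gapD gapZ; ring.
Qed.

HB.instance Definition _ c := GRing.isLinear.Build R E R *%R (gap_sum c) (gap_sum_scalar c).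

Definition cells : set (set E) := [set C | exists2 x, T x & C = cell x].

Lemma cells_cell x : T x -> cells (cell x).
Proof. by exists x. Qed.

Lemma cells_finite : finite_set cells.
Proof.
pose K (p : {ffun J -> bool * bool}) : set E := [set y | T y /\ forall r,
  gap r y = 0 \/ ((p r).1 /\ 0 < gap r y) \/ ((p r).2 /\ gap r y < 0)].
apply: (@sub_finite_set _ _ (K @` setT)); last exact/finite_image/finite_finset.
move=> C [x Tx ->]; exists [ffun r => (0 < gap r x, gap r x < 0)] => //.
rewrite eqEsubset; split=> y [Ty hy]; split=> // r; have := hy r; rewrite ?ffunE /=.
  by [].
by [].
Qed.

Lemma cell_face x D : T x -> face_of (cell x) D -> cells D.
Proof.
move=> Tx [u [u0 ->]].
have [y [[Ty yx] /= uy] my] : exists2 y, (cell x `&` [set v | u v = 0]) y &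
    forall z, (cell x `&` [set v | u v = 0]) z -> below z y.
  apply: interior_point.
  - by move=> z [[]].
  - by split; [exact: cell0 | rewrite /= linear0].
  - move=> y z [hy /= uy] [hz /= uz]; split; first exact: cellD.
    by rewrite /= linearD uy uz addr0.
exists y => //; rewrite eqEsubset; split=> z.
  by move=> hz; split; [case: hz => -[] | exact: my].
move=> [Tz zy]; have cz : cell x z by apply: cell_sub yx _ _.
split=> //=; apply/eqP; rewrite eq_le u0 // andbT.
(* The functional vanishes at the interior point [y] of the face, and [y] can be moved a little away
   from [z] within the cell; so it cannot be positive at [z]. *)
have [e e0 he] := lin_small Ty (lin_opp (below_lin Ty Tz zy)).
have := u0 _ (cell_sub yx (he e (ltW e0) (lexx _))).
by rewrite linearD linearZ linearN /= uy add0r mulrN oppr_ge0 pmulr_rle0.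
Qed.

Lemma cell_meet x z : T x -> T z -> exists g, [/\ T g, below g x, below g z & cell x `&` cell z = cell g].
Proof.
move=> Tx Tz; have [g [[Tg gx] [_ gz]] mg] : exists2 g, (cell x `&` cell z) g &
    forall y, (cell x `&` cell z) y -> below y g.
  apply: interior_point; first by move=> y [[]].
    by split; exact: cell0.
  by move=> y w [h1 h2] [k1 k2]; split; exact: cellD.
exists g; split=> //; rewrite eqEsubset; split=> y.
  by move=> hy; split; [case: hy => -[] | exact: mg].
by move=> hy; split; [exact: cell_sub gx _ hy | exact: cell_sub gz _ hy].
Qed.

(** The supporting functional adds up the gaps that vanish at [g], with the signs that make them
    nonnegative on the cell of [x]. *)
Lemma cell_face_below x g : T x -> T g -> below g x -> face_of (cell x) (cell g).
Proof.
move=> Tx Tg gx; pose c r := if gap r g == 0 then Num.sg (gap r x) else 0.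
have c0 y r : cell x y -> 0 <= c r * gap r y.
  move=> [_ /(_ r) hy]; rewrite /c; case: ifP => _; last by rewrite mul0r.
  case: hy => [->|[[h1 h2]|[h1 h2]]]; first by rewrite mulr0.
    by rewrite gtr0_sg // mul1r ltW.
  by rewrite ltr0_sg // mulN1r oppr_ge0 ltW.
exists (gap_sum c : {scalar E}); split=> [y hy|]; first by apply: sumr_ge0 => r _; exact: c0.
rewrite eqEsubset; split=> y.
  move=> hy; have hx := cell_sub gx hy; split=> //=; rewrite /gap_sum big1 // => r _.
  rewrite /c; case: eqP => E0; last by rewrite mul0r.
  case: hy => _ /(_ r); rewrite E0 => hh.
  have E1 : gap r y = 0 by case: hh => [//|hh]; lra.
  by rewrite E1 mulr0.
move=> [hy /= /eqP]; rewrite /gap_sum psumr_eq0 => [/allP h|r _]; last exact: c0.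
have [Ty yx] := hy; split=> // r.
have /eqP k : c r * gap r y == 0 by have := h r; rewrite mem_index_enum => /(_ isT).
have := yx r; have := gx r; move: k; rewrite /c; case: eqP => [E0|n] k h1 h2; last first.
  by case: h1 => // h1; lra.
case: h2 => [->|h2]; [by left | left].
by case: h2 => -[h2 h3]; move: k; rewrite ?(gtr0_sg h2) ?(ltr0_sg h2); lra.
Qed.

Lemma cells_fan : polyhedral_cone [set: E] -> fan_structure_on T cells.
Proof.
move=> hE; split; first split.
- exact: cells_finite.
- by move=> C [x Tx ->]; exact: cell_polyhedral.
- by move=> C D [x Tx ->]; exact: cell_face.
- move=> C D [x Tx ->] [z Tz ->]; have [g [Tg gx gz ->]] := cell_meet Tx Tz.
  exact: cell_face_below.
rewrite eqEsubset; split=> x.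
  by move=> [C [y Ty ->] []].
by move=> Tx; exists (cell x); [exact: cells_cell | exact: cell_refl].
Qed.

(** A convex cone inside the prevariety lies in the cell of any of its points of maximal pattern. *)
Lemma cells_coarsest : polyhedral_cone [set: E] -> coarsest_fan_structure T cells.
Proof.
move=> hE; split; first exact: cells_fan.
move=> G [[_ Gp _ _] GT] D GD; have [s sE] := Gp D GD.
have [y Dy my] : exists2 y, D y & forall z, D z -> below z y.
  apply: interior_point.
  - by move=> z Dz; rewrite -GT; exists D.
  - by rewrite sE; exact: hull0.
  - by move=> y z; rewrite sE; exact: hullD.
have DT z : D z -> T z by move=> Dz; rewrite -GT; exists D.
by exists (cell y); [apply: cells_cell; exact: DT | move=> z Dz; split; [exact: DT | exact: my]].
Qed.

Lemma maximal_cell x : T x -> exists2 p, T p & below x p /\ maximal_cone cells (cell p).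
Proof.
move=> Tx; have [p [Tp xp] mp] := @strict_max (fun p => T p /\ below x p) x (conj Tx (below_refl x)).
exists p => //; split=> //; split; first exact: cells_cell.
move=> C [z Tz ->] sub; have [_ pz] := sub _ (cell_refl Tp).
have [zp|nzp] := pselect (below z p); first exact: cell_eq.
have := strict_below pz nzp; rewrite ltnNge mp //; split=> //; exact: below_trans xp pz.
Qed.

Hypothesis no_one_sided : forall h v, T h -> star h v -> ~ lin h v ->
  exists2 w, star h w & forall c, 0 <= c -> ~ lin h (w - c *: v).

Lemma maximal_below p z : maximal_cone cells (cell p) -> T p -> T z -> below p z -> below z p.
Proof.
move=> [_ mp] Tp Tz pz; have E0 := mp _ (cells_cell Tz) (cell_sub pz).
by have [_] : cell p z by rewrite -E0; exact: cell_refl.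
Qed.

(* Among the directions into the cell [q] at [h], all but the multiples of
   [g] are lineal: otherwise a minimum ratio step away from [g] would yield a
   face of larger pattern that still misses [g]. *)
Lemma directions h g q w : T h -> cell q h -> cell q g -> ~ below g h ->
  (forall h', cell q h' -> below h h' -> ~ below g h' -> (strict h' <= strict h)%N) ->
  star h w -> (forall r, gap r h = 0 ->
     gap r w = 0 \/ (0 < gap r q /\ 0 < gap r w) \/ (gap r q < 0 /\ gap r w < 0)) ->
  exists2 c, 0 <= c & lin h (w - c *: g).
Proof.
move=> Th [_ hq] [Tg gq] ngh mh hw qw.
pose A := [pred r | (gap r h == 0) && (gap r g != 0)].
have [r0 hr0] : exists r, r \in A.
  apply: contrapT => N; apply: ngh => r; have [E0|n] := eqVneq (gap r g) 0; first by left.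
  have [E1|n1] := eqVneq (gap r h) 0; first by case: N; exists r; rewrite !inE E1 eqxx n.
  case: (gq r) (hq r) => [E2|gq'] [E3|hq']; try by rewrite ?E2 ?E3 eqxx in n n1.
  by lra.
have [r1 Ar1 mr1] := @arg_minP _ R J r0 (mem A) (fun r => gap r w / gap r g) hr0.
(* The largest multiple of [g] that can be subtracted while the gaps vanishing at [h] keep their
   signs; at [r1] the gap becomes zero. *)
pose c := gap r1 w / gap r1 g.
have /andP[/eqP h1 g1] : (gap r1 h == 0) && (gap r1 g != 0) by exact: Ar1.
have sign r : gap r h = 0 -> gap r g != 0 -> 0 <= gap r w / gap r g.
  move=> E0 n; case: (gq r) => [E1|gq']; first by rewrite E1 eqxx in n.
  case: (qw r E0) => [->|qw']; first by rewrite mul0r.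
  have [[a1 a2]|[a1 a2]] : (0 < gap r w /\ 0 < gap r g) \/ (gap r w < 0 /\ gap r g < 0) by lra.
    by rewrite divr_ge0 // ltW.
  by rewrite -divrNN divr_ge0 // oppr_ge0 ltW.
have c0 : 0 <= c by exact: sign.
exists c => //; set w' := w - c *: g.
have gw' r : gap r w' = gap r w - c * gap r g by rewrite gapD -scaleNr gapZ mulNr.
have cg r : gap r h = 0 -> gap r g != 0 -> c <= gap r w / gap r g.
  by move=> E0 n; apply: mr1; apply/andP; split=> //; exact/eqP.
have qw' r : gap r h = 0 -> gap r w' = 0 \/ (0 < gap r q /\ 0 < gap r w') \/ (gap r q < 0 /\ gap r w' < 0).
  move=> E0; rewrite gw'; have [Eg|n] := eqVneq (gap r g) 0.
    by rewrite Eg mulr0 subr0; exact: qw.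
  have := cg r E0 n; case: (gq r) => [E1|[[q1 q2]|[q1 q2]]]; first by rewrite E1 eqxx in n.
    by rewrite ler_pdivlMr //; lra.
  by rewrite ler_ndivlMr //; lra.
have T_hg r : (gap r h < 0 -> f1 r g = f2 r g) /\ (0 < gap r h -> f1 r g = f3 r g).
  by split=> lt; [apply: T_le | apply: T_ge] => //; have := hq r; have := gq r; lra.
have star' : star h w'.
  move=> r; have [k1 k2 k3] := hw r; have [g2 g3] := T_hg r.
  rewrite !linearB !linearZ /=; split=> lt.
  - by rewrite k1 // g2 // /gap subr_lt0.
  - by rewrite k2 // g3 // /gap subr_gt0.
  - have E0 : gap r h = 0 by rewrite /gap lt subrr.
    apply: (ismin_sub (q := gap r q)) (k3 lt) (Tg r) (qw r E0) (gq r) _.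
    by rewrite -/(gap r w) -/(gap r g) -gw'; exact: qw'.
have [e e0 he] := star_small Th star'.
have [Th' hh'] := he e (ltW e0) (lexx _); set h' := h + e *: w' in Th' hh'.
have gh' r : gap r h' = gap r h + e * gap r w' by rewrite gapD gapZ.
have qh' : below h' q.
  move=> r; rewrite gh'; have [E0|n] := eqVneq (gap r h) 0.
    rewrite E0 add0r; case: (qw' r E0) => [->|[[q1 q2]|[q1 q2]]]; first by rewrite mulr0; left.
      by right; left; rewrite pmulr_rgt0.
    by right; right; rewrite pmulr_rlt0.
  right; have := hh' r; rewrite gh'; have := hq r; move: n => /eqP n.
  by case=> [//|h2]; case=> [//|h3]; lra.
have ngh' : ~ below g h'.
  move=> /(_ r1); rewrite gh' h1 gw' /c divfK // subrr mulr0 addr0.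
  by case=> [E1|]; [rewrite E1 eqxx in g1 | lra].
have [hb|nb] := pselect (below h' h); last first.
  by have := strict_below hh' nb; rewrite ltnNge mh.
move=> r; have [k1 k2 k3] := star' r; split=> // E0.
have E1 : gap r h = 0 by rewrite /gap E0 subrr.
have E2 : gap r w' = 0.
  have := hb r; rewrite gh' E1 add0r; case=> [/eqP|]; last by lra.
  by rewrite mulf_eq0 (gt_eqF e0) => /eqP.
by have := k3 E0; move: E2; rewrite /gap /ismin; lra.
Qed.

Lemma strict_min (P : E -> Prop) x : P x -> exists2 y, P y & forall z, P z -> (strict y <= strict z)%N.
Proof.
move=> Px; pose Q n := `[< exists y, P y /\ strict y = n >].
have Q0 : exists n, Q n by exists (strict x); apply/asboolP; exists x.
case: (ex_minnP Q0) => n /asboolP[y [Py <-]] mn; exists y => // z Pz.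
by apply: mn; apply/asboolP; exists z.
Qed.

Lemma cell_star q h g : cell q h -> cell q g -> star h g.
Proof.
move=> [_ hq] [Tg gq] r; split=> [lt|lt|_]; last exact: Tg.
  by apply: T_le => //; have := hq r; have := gq r; move: lt; rewrite -subr_lt0 -/(gap r h); lra.
by apply: T_ge => //; have := hq r; have := gq r; move: lt; rewrite -subr_gt0 -/(gap r h); lra.
Qed.

Lemma lin_gap h w r : lin h w -> gap r h = 0 -> gap r w = 0.
Proof.
move=> /(_ r)[_ _ k3] /eqP; rewrite /gap subr_eq0 => /eqP /k3[<- <-].
by rewrite subrr.
Qed.

Lemma lin_below q h g : cell q h -> cell q g -> lin h g -> below g h.
Proof.
move=> [_ hq] [_ gq] hg r; have [E0|/eqP n] := eqVneq (gap r h) 0.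
  by left; exact: lin_gap hg E0.
by have := hq r; have := gq r; case=> [->|g1]; [left | case=> [//|h1]; lra].
Qed.

Lemma cells_two_determined : two_determined cells.
Proof.
move=> C [x Tx ->]; have [mx|nmx] := pselect (maximal_cone cells (cell x)); [by left | right].
pose P g := T g /\ exists p q, [/\ T p /\ T q, maximal_cone cells (cell p),
  maximal_cone cells (cell q), below x p /\ below x q & cell p `&` cell q = cell g].
have [p0 Tp0 [xp0 mp0]] := maximal_cell Tx.
(* The intersection of two maximal cells around [x] is taken with the fewest strict gaps; a maximal
   cell met with itself shows that there is one. *)
have [g [Tg [p [q [[Tp Tq] mp mq [xp xq] pqE]]]] mg] : exists2 g, P g & forall z, P z -> (strict g <= strict z)%N.
  by apply: (@strict_min P p0); split=> //; exists p0, p0; rewrite setIid.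
have [cpg cqg] : (cell p `&` cell q) g by rewrite pqE; exact: cell_refl.
have [_ gp] := cpg; have [_ gq] := cqg.
have xg : below x g by have [_] : cell g x by rewrite -pqE; split.
have [gx|ngx] := pselect (below g x).
  exists (cell p), (cell q); split=> // [pq|]; last by rewrite pqE; exact: cell_eq.
  by apply: nmx; rewrite (cell_eq xg gx) -pqE -pq setIid.
(* [h] plays the role of a facet of [cell q] that contains [x] but not [g]. *)
exfalso; have [h [[qh xh] ngh] mh] : exists2 h, (cell q h /\ below x h) /\ ~ below g h &
    forall z, (cell q z /\ below x z) /\ ~ below g z -> (strict z <= strict h)%N.
  by apply: (@strict_max (fun h => (cell q h /\ below x h) /\ ~ below g h) x); split=> //; split=> //; exact: below_refl.
have [Th hq] := qh.
have dir := directions Th qh cqg ngh (fun z qz hz nz => mh z (conj (conj qz (below_trans xh hz)) nz)).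
(* For the direction of [q] itself: modulo lineal directions it is a multiple of [g], so [h + g]
   already has the pattern of [q]. *)
have q_hg : below q (h + g).
  have [|r E0|c c0 hc] := dir q; first exact: cell_star qh (cell_refl Tq).
    by have := below_refl q r; lra.
  move=> r; have := hq r; have := gq r; rewrite gapD.
  have [E0|/eqP n] := eqVneq (gap r h) 0; last by lra.
  have := lin_gap hc E0; rewrite gapD -scaleNr gapZ mulNr => qE h1 _; rewrite E0 add0r.
  case: h1 => [E1|h1]; last by right; lra.
  by left; move: qE; rewrite E1 mulr0; lra.
have T_hg : T (h + g) by have [] := cellD qh cqg.
have [w hw nw] := no_one_sided Th (cell_star qh cqg) (fun l => ngh (lin_below qh cqg l)).
have [e e0 he] := star_small Th hw; have [Te be] := he e (ltW e0) (lexx _).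
have [n Tn [bn mn]] := maximal_cell Te; have hn := below_trans be bn.
(* Above both [h] and [g], the cell of [n] would be that of [q], and [w] would be one of the
   directions excluded by [directions]. *)
have ngn : ~ below g n.
  move=> gn; have qn := below_trans q_hg (add_below hn gn).
  have nq := maximal_below mq Tq Tn qn; have wq := below_trans bn nq.
  have [//|r E0|c c0 hc] := dir w; last exact: nw c c0 hc.
  have := wq r; rewrite gapD gapZ E0 add0r => -[/eqP|[[h1]|[h1]]].
  - by rewrite mulf_eq0 (gt_eqF e0) => /eqP; left.
  - by rewrite pmulr_rgt0 //; right; left.
  - by rewrite pmulr_rlt0 //; right; right.
have [g' [Tg' gp' gn' E']] := cell_meet Tp Tn.
(* [g'] has signs compatible with [g] through [p] and with [h] through [n]. So [g' + (h + g)] is in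
   the prevariety, and being above [q] it stays in the maximal cell of [q]. *)
have gg : below g' g.
  have ag : agreeing g' (h + g).
    move=> r; have := below_agree gp' gp r; have := below_agree gn' hn r.
    by have := below_agree hq gq r; rewrite gapD; lra.
  have Tz := agree_T Tg' T_hg ag.
  have zq := maximal_below mq Tq Tz (below_trans q_hg (below_addr ag)).
  by have [_] : cell g g' by rewrite -pqE; split=> //; split=> //; exact: below_trans (below_addl ag) zq.
have := strict_below gg (fun k => ngn (below_trans k gn')).
rewrite ltnNge mg //; split=> //; exists p, n; split=> //; split=> //.
exact: below_trans xh hn.
Qed.

End MinFan.

(** * Minors and signs *)

Lemma mul_lt0_xor (R : realDomainType) (r s : R) : r != 0 -> s != 0 ->
  ((0 < r) (+) (0 < s)) = (r * s < 0).
Proof.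
rewrite !neq_lt => /orP[hr|hr] /orP[hs|hs]; rewrite ?hr ?hs ?(lt_gtF hr) ?(lt_gtF hs) /=.
- by rewrite nmulr_rlt0 // (lt_gtF hs).
- by rewrite nmulr_rlt0 // hs.
- by rewrite pmulr_rlt0 // hs.
- by rewrite pmulr_rlt0 // (lt_gtF hs).
Qed.

Section Minors.
Variable n : nat.
Implicit Types (a b c d p : 'I_n) (I J : ksub 3 n).

Definition nth3 I : 'I_n * 'I_n * 'I_n :=
  (ksub_nth I 0, ksub_nth I (inord 1), ksub_nth I (inord 2)).

Lemma nth3_uniq I : uniq [:: (nth3 I).1.1; (nth3 I).1.2; (nth3 I).2].
Proof.
have inj i j : ksub_nth I i = ksub_nth I j -> i = j.
  by move=> /enum_val_inj /cast_ord_inj.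
rewrite /= !inE negb_or !andbT; apply/andP; split; first (apply/andP; split).
- by apply/eqP => /inj /(congr1 val); rewrite /= inordK.
- by apply/eqP => /inj /(congr1 val); rewrite /= inordK.
- by apply/eqP => /inj /(congr1 val); rewrite /= !inordK.
Qed.

Lemma nth3_mem I : [/\ (nth3 I).1.1 \in val I, (nth3 I).1.2 \in val I & (nth3 I).2 \in val I].
Proof. by split; apply: enum_valP. Qed.

Lemma card3 a b c : uniq [:: a; b; c] -> #|[set a; b; c]%SET| == 3%N.
Proof.
move=> u; apply/eqP; transitivity #|[:: a; b; c]|; last exact/card_uniqP.
by apply: eq_card => z; rewrite !inE orbA.
Qed.

Lemma nth3_set I : val I = [set (nth3 I).1.1; (nth3 I).1.2; (nth3 I).2]%SET.
Proof.
apply/esym/eqP; rewrite eqEcard (ksub_card I) (eqP (card3 (nth3_uniq I))) leqnn andbT.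
have [h1 h2 h3] := nth3_mem I.
by apply/fintype.subsetP => z; rewrite !inE => /orP[/orP[]|] /eqP->.
Qed.

Lemma nth3_ind I a b c (P : 'I_n -> 'I_n -> 'I_n -> Prop) :
  (forall a b c, P a b c -> P b a c) -> (forall a b c, P a b c -> P a c b) ->
  uniq [:: a; b; c] -> val I = [set a; b; c]%SET ->
  P (nth3 I).1.1 (nth3 I).1.2 (nth3 I).2 -> P a b c.
Proof.
move=> P1 P2 u e; have := nth3_uniq I; have := nth3_mem I; rewrite e.
move: (nth3 I).1.1 (nth3 I).1.2 (nth3 I).2 => x y z [].
rewrite !inE => h1 h2 h3 /= ; rewrite !inE.
by case/orP: h1 => [/orP[]|] /eqP->; case/orP: h2 => [/orP[]|] /eqP->;
  case/orP: h3 => [/orP[]|] /eqP->; rewrite ?eqxx //= ?orbT ?andbF //= => _ h; auto.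
Qed.

Definition det3c (A : comNzRingType) (h : 'M[A]_(3, n)) a b c : A :=
  h 0 a * (h 1 b * h (inord 2) c - h (inord 2) b * h 1 c)
  - h 1 a * (h 0 b * h (inord 2) c - h (inord 2) b * h 0 c)
  + h (inord 2) a * (h 0 b * h 1 c - h 1 b * h 0 c).

Lemma det_mx33 (A : comNzRingType) (M : 'M[A]_3) (F := fun i j => M (inord i) (inord j)) :
  \det M = F 0 0 * (F 1 1 * F 2 2 - F 2 1 * F 1 2) - F 1 0 * (F 0 1 * F 2 2 - F 2 1 * F 0 2)
    + F 2 0 * (F 0 1 * F 1 2 - F 1 1 * F 0 2).
Proof.
have MF i j : M i j = F (val i) (val j) by rewrite /F !inord_val.
rewrite (expand_det_row _ ord0) !big_ord_recl big_ord0 /cofactor.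
rewrite !(expand_det_row _ ord0) !big_ord_recl !big_ord0 /cofactor !det_mx11 !mxE.
rewrite !MF /= /bump /=; move: (F) => G; ring.
Qed.

Lemma minor_det3 (A : comNzRingType) (h : 'M[A]_(3, n)) I :
  minor h I = det3c h (nth3 I).1.1 (nth3 I).1.2 (nth3 I).2.
Proof.
have e0 : inord 0 = 0 :> 'I_3 by apply: val_inj; rewrite /= inordK.
have e1 : inord 1 = 1 :> 'I_3 by apply: val_inj; rewrite /= inordK.
by rewrite /minor det_mx33 !mxE /det3c /nth3 e0 -e1.
Qed.

Lemma det3c_swapl (A : comNzRingType) (h : 'M[A]_(3, n)) a b c : det3c h b a c = - det3c h a b c.
Proof. by rewrite /det3c; ring. Qed.

Lemma det3c_swapr (A : comNzRingType) (h : 'M[A]_(3, n)) a b c : det3c h a c b = - det3c h a b c.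
Proof. by rewrite /det3c; ring. Qed.

Lemma det3c_plucker (A : comNzRingType) (h : 'M[A]_(3, n)) p a b c d :
  det3c h p a b * det3c h p c d + det3c h p a c * det3c h p d b + det3c h p a d * det3c h p b c = 0.
Proof. by rewrite /det3c; ring. Qed.

(** The sign comes before the ring and the matrix, so that the same one serves for the generic
    matrix and for a real one. *)
Lemma det3c_sign I a b c : uniq [:: a; b; c] -> val I = [set a; b; c]%SET ->
  exists s : bool, forall (A : comNzRingType) (h : 'M[A]_(3, n)), det3c h a b c = (-1) ^+ s * minor h I.
Proof.
move=> u e; apply: (nth3_ind (P := fun a b c => exists s : bool,
  forall (A : comNzRingType) (h : 'M[A]_(3, n)), det3c h a b c = (-1) ^+ s * minor h I) _ _ u e).
- by move=> f g k [s hs]; exists (~~ s) => A h; rewrite det3c_swapl hs signrN mulNr.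
- by move=> f g k [s hs]; exists (~~ s) => A h; rewrite det3c_swapr hs signrN mulNr.
- by exists false => A h; rewrite mul1r minor_det3.
Qed.

Definition tri a b c : option (ksub 3 n) := insub [set a; b; c]%SET.

Lemma tri_some a b c : uniq [:: a; b; c] -> exists2 I, tri a b c = Some I & val I = [set a; b; c]%SET.
Proof.
by move=> /card3 u; rewrite /tri; case: insubP => [I _ e|]; [exists I | rewrite u].
Qed.

Lemma tri_swapl a b c : tri b a c = tri a b c.
Proof. by rewrite /tri (finset.setUC [set b]). Qed.

Lemma tri_swapr a b c : tri a c b = tri a b c.
Proof. by rewrite /tri finset.setUAC. Qed.

Lemma tri_nth3 I : tri (nth3 I).1.1 (nth3 I).1.2 (nth3 I).2 = Some I.
Proof.
have [J -> e] := tri_some (nth3_uniq I); congr Some; apply: val_inj.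
by rewrite e -nth3_set.
Qed.

Section Coordinates.
Variable R : realType.
Implicit Types x : weight_space R 3 n.

Definition ev x a b c : R := if tri a b c is Some J then x J else 0.

Lemma ev_sym x : sym3 (ev x).
Proof. by split=> a b c; rewrite /ev; [rewrite tri_swapl | rewrite tri_swapr]. Qed.

Lemma ev_nth3 x I : ev x (nth3 I).1.1 (nth3 I).1.2 (nth3 I).2 = x I.
Proof. by rewrite /ev tri_nth3. Qed.

Lemma evP (t : R) x y : ev (t *: x + y) = fun p q r => t * ev x p q r + ev y p q r.
Proof.
apply/funext => p; apply/funext => q; apply/funext => r; rewrite /ev.
by case: (tri _ _ _) => [I|]; rewrite ?ffunE // mulr0 addr0.
Qed.

Lemma ev_onto (w : 'I_n -> 'I_n -> 'I_n -> R) : sym3 w -> exists x,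
  forall a b c, uniq [:: a; b; c] -> ev x a b c = w a b c.
Proof.
move=> [w1 w2]; exists [ffun I => w (nth3 I).1.1 (nth3 I).1.2 (nth3 I).2] => a b c u.
have [I e eI] := tri_some u; rewrite /ev e ffunE.
apply: (nth3_ind (P := fun a b c => w _ _ _ = w a b c) _ _ u eI) => // f g k ->.
  by rewrite w1.
by rewrite w2.
Qed.

Lemma weight_space_polyhedral : polyhedral_cone [set: weight_space R 3 n]%classic.
Proof.
pose d (J : ksub 3 n) : weight_space R 3 n := [ffun K => (K == J)%:R].
exists ([seq d K | K <- enum {: ksub 3 n}] ++ [seq - d K | K <- enum {: ksub 3 n}]); apply/esym/seteqP; split=> // x _.
have -> : x = \sum_K x K *: d K.
  apply/ffunP => J; rewrite sum_ffunE (bigD1 J) //= big1 => [|K nK].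
    by rewrite addr0 !ffunE eqxx; rewrite /GRing.scale /= mulr1.
  by rewrite !ffunE eq_sym (negbTE nK); rewrite /GRing.scale /= mulr0.
apply: hull_sum => K _; have [h|h] := leP 0 (x K).
  by apply: hullZ => //; apply: hull_mem; rewrite mem_cat map_f ?mem_enum.
rewrite -[x K]opprK scaleNr -scalerN; apply: hullZ; first by rewrite oppr_ge0 ltW.
by apply: hull_mem; rewrite mem_cat (map_f (fun K => - d K)) ?mem_enum ?orbT.
Qed.

End Coordinates.

Section Signs.
Variables (R : realType) (g : 'M[R]_(3, n)).
Hypothesis g0 : forall I, minor g I != 0.

Definition sgn a b c := 0 < det3c g a b c.

Lemma det3c_neq0 a b c : uniq [:: a; b; c] -> det3c g a b c != 0.
Proof.
move=> u; have [I _ e] := tri_some u; have [s ->] := det3c_sign u e.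
by rewrite mulf_neq0 // signr_eq0.
Qed.

Lemma sgn_chirotope : chirotope sgn.
Proof.
have N (r : R) : r != 0 -> (0 < - r) = ~~ (0 < r).
  by move=> r0; rewrite oppr_gt0 -leNgt le_eqVlt (negbTE r0).
split=> [a b c u|a b c u|p a b c d u].
- by rewrite /sgn det3c_swapl N ?det3c_neq0.
- by rewrite /sgn det3c_swapr N ?det3c_neq0.
have D q f k : uniq [:: q; f; k] -> det3c g q f k != 0 by exact: det3c_neq0.
have := det3c_plucker g p a b c d; rewrite /sgn.
have := D p a b ltac:(dcase u; dsplit); have := D p c d ltac:(dcase u; dsplit).
have := D p a c ltac:(dcase u; dsplit); have := D p d b ltac:(dcase u; dsplit).
have := D p a d ltac:(dcase u; dsplit); have := D p b c ltac:(dcase u; dsplit).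
move: (det3c _ _ _ _) (det3c _ _ _ _) (det3c _ _ _ _) (det3c _ _ _ _) (det3c _ _ _ _) (det3c _ _ _ _).
move=> r1 r2 r3 r4 r5 r6 n1 n2 n3 n4 n5 n6 rel [e1 e2].
rewrite !mul_lt0_xor // in e1 e2.
have P (r s : R) : r != 0 -> s != 0 -> r * s != 0 by exact: mulf_neq0.
have := P _ _ n6 n5; have := P _ _ n4 n3; have := P _ _ n2 n1; move: e1 e2 rel.
move: (_ * _) (_ * _) (_ * _) => A B C.
by case: (ltgtP A 0) => // hA; case: (ltgtP B 0) => // hB; case: (ltgtP C 0) => // hC; lra.
Qed.

End Signs.

End Minors.

(** * Tropical hypersurfaces *)

Lemma bigmine_le (R : realType) (T : eqType) (s : seq T) (F : T -> R) (b : R) :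
  ((\big[mine/+oo]_(i <- s) (F i)%:E)%E <= b%:E)%E <-> exists2 i, i \in s & F i <= b.
Proof.
elim: s => [|i s IH]; first by rewrite big_nil; split=> // -[].
rewrite big_cons ge_min lee_fin; split.
  move=> /orP[h|/IH[j js h]]; first by exists i; rewrite ?inE ?eqxx.
  by exists j; rewrite ?inE ?js ?orbT.
move=> [j]; rewrite inE => /orP[/eqP-> -> //|js h]; apply/orP; right.
by apply/IH; exists j.
Qed.

Lemma le_bigmine (R : realType) (T : eqType) (s : seq T) (F : T -> R) (z : \bar R) :
  (z <= \big[mine/+oo]_(i <- s) (F i)%:E)%E <-> forall i, i \in s -> (z <= (F i)%:E)%E.
Proof.
elim: s => [|i s IH]; first by rewrite big_nil leey.
rewrite big_cons le_min; split.
  by move=> /andP[h /IH k] j; rewrite inE => /orP[/eqP->|/k].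
by move=> h; rewrite h ?inE ?eqxx //=; apply/IH => j js; apply: h; rewrite inE js orbT.
Qed.

Section Tropical.
Variables (R : realType) (k n : nat) (chi : {ffun ksub k n -> int}).
Implicit Types (f : plucker_poly R k n) (x : weight_space R k n) (m : plucker_exp k n).

Lemma Trop_le f g x : (Trop f x <= Trop g x)%E <->
  forall m, m \in msupp g -> exists2 m', m' \in msupp f & weight m' x <= weight m x.
Proof.
rewrite /Trop le_bigmine; split=> h m hm; have := h m hm.
  by move/bigmine_le.
by move=> ?; apply/bigmine_le.
Qed.

Lemma mcoeff_part f (P : pred (plucker_exp k n)) m :
  mcoeff m (\sum_(m' <- msupp f | P m') mcoeff m' f *: mpolyX R m') = if P m then mcoeff m f else 0.
Proof.
rewrite raddf_sum /=.
have E m' : mcoeff m (mcoeff m' f *: mpolyX R m') = if m' == m then mcoeff m f else 0.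
  by rewrite mcoeffZ mcoeffX; case: eqP => [->|_]; rewrite ?mulr1 ?mulr0.
rewrite (eq_bigr _ (fun m' _ => E m')) -big_mkcondr /=.
have [hm|hm] := boolP (m \in msupp f); last first.
  have -> : mcoeff m f = 0 by apply/eqP; rewrite mcoeff_eq0.
  by rewrite if_same big1.
rewrite big_mkcond (bigD1_seq m) //= eqxx andbT big1 ?addr0 // => m' /negPf ->.
by rewrite andbF.
Qed.

Lemma mem_pos_part f m : (m \in msupp (pos_part chi f)) = (0 < term_at chi f m).
Proof.
rewrite mcoeff_msupp mcoeff_part; case: ifP => h; last by rewrite eqxx.
by apply: contraTneq h => e; rewrite /term_at e mul0r ltxx.
Qed.

Lemma mem_neg_part f m : (m \in msupp (neg_part chi f)) = (term_at chi f m < 0).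
Proof.
rewrite mcoeff_msupp mcoeff_part; case: ifP => h; last by rewrite eqxx.
by apply: contraTneq h => e; rewrite /term_at e mul0r ltxx.
Qed.

(** Equality of the two minima in a form that needs no case of an empty part. *)
Lemma chi_hypersurfaceP f x : chi_trop_hypersurface chi f x <->
  (forall m, 0 < term_at chi f m -> exists2 m', term_at chi f m' < 0 & weight m' x <= weight m x) /\
  (forall m, term_at chi f m < 0 -> exists2 m', 0 < term_at chi f m' & weight m' x <= weight m x).
Proof.
split=> [/= e|[h1 h2]].
  split=> m; [rewrite -mem_pos_part | rewrite -mem_neg_part].
    have /Trop_le h : (Trop (neg_part chi f) x <= Trop (pos_part chi f) x)%E by rewrite e.
    by move=> /h[m']; rewrite mem_neg_part; exists m'.
  have /Trop_le h : (Trop (pos_part chi f) x <= Trop (neg_part chi f) x)%E by rewrite e.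
  by move=> /h[m']; rewrite mem_pos_part; exists m'.
apply/eqP; rewrite eq_le; apply/andP; split; apply/Trop_le => m.
  by rewrite mem_neg_part => /h2[m' h]; exists m' => //; rewrite mem_pos_part.
by rewrite mem_pos_part => /h1[m' h]; exists m' => //; rewrite mem_neg_part.
Qed.

Lemma plucker_ideal_minors f (M : 'M[R]_(k, n)) : plucker_ideal f ->
  \sum_(m <- msupp f) mcoeff m f * \prod_(I : ksub k n) minor M I ^+ exponent m I = 0.
Proof.
move=> /= h; pose v i := mxvec M 0 i; have := congr1 (meval v) h.
rewrite meval0 comp_mpoly_meval mevalE => e; rewrite -[RHS]e {e}; apply: eq_bigr => m _; congr (_ * _).
rewrite [RHS](reindex (enum_rank : ksub k n -> _)) /=; last first.
  by apply: onW_bij; exact: enum_rank_bij.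
apply: eq_bigr => I _; congr (_ ^+ _); rewrite tnth_mktuple enum_rankK /minor -det_map_mx; congr (\det _).
by apply/matrixP => i j; rewrite !mxE /= mevalXU /v mxvecE.
Qed.

Lemma ap_pow L (p A : R) e : ap L p A -> ap (e%:R * L) (p ^+ e) (e%:R * A).
Proof.
move=> h; elim: e => [|e IH].
  by rewrite expr0 !mul0r /ap subr0 addr0 oppr0 expR0 lexx.
by rewrite exprS -natr1 !mulrDl !mul1r addrC [_ + A]addrC; exact: ap_mul.
Qed.

Lemma ap_prod L (T : finType) (p A : T -> R) (e : T -> nat) : (forall i, ap L (p i) (A i)) ->
  ap ((\sum_i e i)%:R * L) (\prod_i p i ^+ e i) (\sum_i (e i)%:R * A i).
Proof.
move=> h; rewrite natr_sum mulr_suml.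
elim/big_rec3: _ => [|i l q B _ IH]; first by rewrite /ap subr0 addr0 oppr0 expR0 lexx.
by apply: ap_mul => //; exact: ap_pow.
Qed.

Lemma seq_bound (T : eqType) (s : seq T) (P : T -> R -> Prop) :
  (forall t, t \in s -> exists r, forall r', r <= r' -> P t r') ->
  exists2 r, 0 <= r & forall t, t \in s -> P t r.
Proof.
move=> H; suff [r h] : exists r, forall r', r <= r' -> forall t, t \in s -> P t r'.
  exists (Num.max 0 r); first by rewrite le_max lexx.
  by apply: h; rewrite le_max lexx orbT.
elim: s H => [|t s IH] H; first by exists 0.
have [t1 h1] := H t (mem_head _ _); have [|r2 h2] := IH.
  by move=> u us; apply: H; rewrite inE us orbT.
exists (Num.max t1 r2) => r'; rewrite ge_max => /andP[k1 k2] u.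
by rewrite inE => /orP[/eqP->|us]; [exact: h1 | exact: h2].
Qed.

Lemma exp_dominates (C d : R) : 0 < d -> exists r, forall r', r <= r' -> C < expR (r' * d).
Proof.
move=> d0; exists (C / d) => r'; rewrite ler_pdivrMr // => h.
by have := expR_ge1Dx (r' * d); lra.
Qed.

Hypothesis chi_unit : forall I, chi I * chi I = 1.

(* In a polynomial relation between exponentially scaled minors, a term of
   minimal weight must be cancelled by a term of the other sign. *)
Lemma term_cancelled L f x m : plucker_ideal f ->
  (forall l : R, 0 <= l -> exists M : 'M[R]_(k, n), forall I, ap L ((chi I)%:~R * minor M I) (l * x I)) ->
  0 < term_at chi f m -> exists2 m', term_at chi f m' < 0 & weight m' x <= weight m x.
Proof.
move=> hf real pm; apply: contrapT => N.
have N' m' : term_at chi f m' < 0 -> weight m x < weight m' x.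
  by move=> h; rewrite ltNge; apply/negP => h'; apply: N; exists m'.
(* [D] is the error of a monomial given that of its factors; [K] is one more than the number of
   terms. *)
pose D m' : R := (\sum_I exponent m' I)%:R * L; pose K : R := (size (msupp f)).+1%:R.
have K0 : 0 < K by rewrite ltr0n.
(* Negative terms all have larger weight, so at a large scale [l] each is less than a fraction
   [1 / K] of the term of [m]; together they cannot cancel it. *)
have [l l0 hl] : exists2 l, 0 <= l & forall m', m' \in msupp f -> term_at chi f m' < 0 ->
    - term_at chi f m' * expR (- (l * weight m' x) + D m') < term_at chi f m / K * expR (- (l * weight m x) - D m).
  apply: seq_bound => m' _; have [neg|ge] := ltP (term_at chi f m') 0; last first.
    by exists 0 => r' _ lt; exfalso; lra.
  have d0 : 0 < weight m' x - weight m x by rewrite subr_gt0 N'.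
  have c0 : 0 < term_at chi f m / K by rewrite divr_gt0.
  have [r hr] := exp_dominates (- term_at chi f m' * expR (D m' + D m) / (term_at chi f m / K)) d0.
  exists r => l /hr; rewrite ltr_pdivrMr // => lt _.
  set wm := weight m x in lt *; set wm' := weight m' x in lt *.
  set y := - (l * wm) - D m.
  have -> : - (l * wm') + D m' = y + (D m' + D m) - l * (wm' - wm) by rewrite /y; ring.
  have y0 := expR_gt0 y; have z0 := expR_gt0 (l * (wm' - wm)).
  rewrite [X in _ * X]expRD expRN expRD; move: lt c0 y0 z0 {d0 hr}.
  move: (term_at chi f m / K) (expR y) (expR (D m' + D m)) (expR (l * _)) => c u v z lt c0 u0 z0.
  have -> : - term_at chi f m' * (u * v / z) = u * (- term_at chi f m' * v) / z by ring.
  by rewrite ltr_pdivrMr // (mulrC c) -mulrA (mulrC c) ltr_pM2l.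
have [M hM] := real l l0; pose p I := (chi I)%:~R * minor M I.
pose Q m' := \prod_I p I ^+ exponent m' I.
have hQ m' : ap (D m') (Q m') (l * weight m' x).
  have := ap_prod (exponent m') hM; rewrite -/(Q m') -/(D m').
  rewrite /weight mulr_sumr; congr (ap _ _ _); apply: eq_bigr => I _; ring.
have Q0 m' : 0 < Q m' := ap_gt0 (hQ m').
have rel : \sum_(m' <- msupp f) term_at chi f m' * Q m' = 0.
  rewrite -[RHS](plucker_ideal_minors M hf); apply: eq_bigr => m' _.
  rewrite /term_at -mulrA -big_split /=; congr (_ * _); apply: eq_bigr => I _.
  by rewrite -exprMn /p mulrA -rmorphM chi_unit mul1r.
have mf : m \in msupp f by rewrite mcoeff_msupp; apply/eqP => e; move: pm; rewrite /term_at e mul0r ltxx.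
pose b := term_at chi f m * Q m / K; have b0 : 0 < b by apply: divr_gt0 => //; apply: mulr_gt0.
have low m' : m' \in msupp f -> - b <= term_at chi f m' * Q m'.
  move=> m'f; have [neg|ge] := ltP (term_at chi f m') 0; last first.
    by apply: (@le_trans _ _ 0); [rewrite oppr_le0 ltW | apply: mulr_ge0 => //; exact: ltW].
  have [/andP[h1 _] /andP[_ h2]] := (hQ m, hQ m'); have h3 := hl m' m'f neg.
  have h4 : - term_at chi f m' * Q m' <= - term_at chi f m' * expR (- (l * weight m' x) + D m').
    by rewrite ler_pM2l ?oppr_gt0.
  have h5 : term_at chi f m / K * expR (- (l * weight m x) - D m) <= b.
    by rewrite /b mulrAC ler_pM2r ?invr_gt0 // ler_pM2l.
  by rewrite lerNl -mulNr; exact: le_trans h4 (le_trans (ltW h3) h5).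
have : term_at chi f m * Q m - b * (size (msupp f))%:R <= 0.
  rewrite -rel (bigD1_seq m) //= lerD2l.
  apply: (@le_trans _ _ (\sum_(m' <- msupp f | m' != m) (- b))).
    rewrite big_const_seq iter_addr_0 mulNrn lerN2.
    by rewrite -[X in X <= _]mulr_natr ler_pM2l // ler_nat count_size.
  by rewrite big_seq_cond [X in _ <= X]big_seq_cond; apply: ler_sum => m' /andP[/low].
have -> : term_at chi f m * Q m = b * K by rewrite /b divfK ?gt_eqF.
by rewrite -mulrBr pmulr_rle0 // /K -natr1 addrAC subrr add0r ler10.
Qed.

End Tropical.

Lemma signr_negb (R : realType) (b : bool) : (-1) ^+ b <> (-1) ^+ (~~ b) :> R.
Proof. by case: b => /=; rewrite expr0 expr1 => e; lra. Qed.

Lemma ismin_le (R : realType) (u v w : R) : v <= u -> u <= v -> u <= w -> ismin u v w.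
Proof. by rewrite /ismin; lra. Qed.

Lemma sum3_neg (R : realType) (u v w : R) : u + v + w = 0 -> v < 0 -> w < 0 -> 0 <= u.
Proof. by lra. Qed.

Lemma sum3_pos (R : realType) (u v w : R) : u + v + w = 0 -> v != 0 -> 0 <= v -> 0 <= w -> u < 0.
Proof.
move=> e n h1 h2; have : 0 < v by rewrite lt_neqAle eq_sym n.
lra.
Qed.

Section Monomials.
Variables (R : realType) (k n : nat).
Implicit Types (I J K : ksub k n).

Definition mnm2 I J : plucker_exp k n := mnm_add (mnm1 (enum_rank I)) (mnm1 (enum_rank J)).

Lemma exponent_mnm2 I J K : exponent (mnm2 I J) K = ((I == K) + (J == K))%N.
Proof. by rewrite /exponent mnmDE !mnm1E !(inj_eq enum_rank_inj). Qed.

Lemma mnm2_neq I J I' J' : I != I' -> I != J' -> mnm2 I J != mnm2 I' J'.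
Proof.
move=> n1 n2; apply/eqP => /(congr1 (fun m => exponent m I)).
by rewrite !exponent_mnm2 eqxx !(eq_sym _ I) (negbTE n1) (negbTE n2).
Qed.

Lemma prod_mnm2 (A : comNzRingType) (c : ksub k n -> A) I J :
  \prod_K c K ^+ exponent (mnm2 I J) K = c I * c J.
Proof.
have P1 L : \prod_K c K ^+ (L == K) = c L.
  rewrite (bigD1 L) //= eqxx big1 ?mulr1 // => K nK.
  by rewrite eq_sym (negbTE nK).
by under eq_bigr do rewrite exponent_mnm2 exprD; rewrite big_split /= !P1.
Qed.

Lemma weight_mnm2 (x : weight_space R k n) I J : weight (mnm2 I J) x = x I + x J.
Proof.
have P1 L : \sum_K (L == K)%:R * x K = x L.
  rewrite (bigD1 L) //= eqxx big1 ?mul1r ?addr0 // => K nK.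
  by rewrite eq_sym (negbTE nK) mul0r.
rewrite /weight; under eq_bigr do rewrite exponent_mnm2 natrD mulrDl.
by rewrite big_split /= !P1.
Qed.

Lemma comp_mnm2 I J :
  comp_mpoly [tuple minor (generic_mx R k n) (enum_val i) | i < #|{: ksub k n}|] (mpolyX R (mnm2 I J)) =
  minor (generic_mx R k n) I * minor (generic_mx R k n) J.
Proof.
rewrite comp_mpolyX -(prod_mnm2 (fun K => minor (generic_mx R k n) K)).
rewrite (reindex (enum_rank : ksub k n -> _)) /=; last by apply: onW_bij; exact: enum_rank_bij.
by apply: eq_bigr => K _; rewrite tnth_mktuple enum_rankK.
Qed.

End Monomials.

(** * The Grassmannian and the three-term prevariety *)

Section ThreeTerm.
Variables (R : realType) (n : nat) (chi : {ffun ksub 3 n -> int}) (g : 'M[R]_(3, n)).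
Hypothesis g_chi : forall I, minor g I != 0 /\ chi I = sgz (minor g I).
Let g0 I : minor g I != 0. Proof. by case: (g_chi I). Qed.

Lemma term_three f I J (s t : bool) a b c d e i :
  det3c g a b c = (-1) ^+ s * minor g I -> det3c g d e i = (-1) ^+ t * minor g J ->
  mcoeff (mnm2 I J) f = (-1) ^+ s * (-1) ^+ t :> R ->
  term_at chi f (mnm2 I J) = Num.sg (det3c g a b c * det3c g d e i).
Proof.
move=> e1 e2 ef; rewrite /term_at ef prod_mnm2 e1 e2.
have [_ ->] := g_chi I; have [_ ->] := g_chi J.
rewrite -!sgrEz !sgrM; have S (r : bool) : Num.sg ((-1) ^+ r) = (-1) ^+ r :> R.
  by case: r; rewrite ?expr0 ?expr1 ?sgrN ?sgr1.
by rewrite !S; ring.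
Qed.

(** In a three-term polynomial every monomial needs one of opposite sign and no larger weight. The
    isolated one is the only choice for the other two, and needs one of them itself. *)
Lemma Grassmannian_TD x : chirotropical_Grassmannian (R := R) chi x -> TD (sgn g) [set: 'I_n]%SET (ev x).
Proof.
move=> hx; split; first exact: ev_sym.
move=> p a b c d h sp; dcase h.
have T3 i j k : uniq [:: i; j; k] -> exists I : ksub 3 n, exists s : bool,
  [/\ val I = [set i; j; k]%SET, forall (A : comNzRingType) (h : 'M[A]_(3, n)), det3c h i j k = (-1) ^+ s * minor h I
   & forall x : weight_space R 3 n, ev x i j k = x I].
  move=> u; have [I e eI] := tri_some u; have [s hs] := det3c_sign u eI.
  by exists I, s; split=> // y; rewrite /ev e.
have [Ipab [s1 [E1 D1 X1]]] := T3 p a b ltac:(by dsplit).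
have [Ipcd [t1 [F1 C1 Y1]]] := T3 p c d ltac:(by dsplit).
have [Ipac [s2 [E2 D2 X2]]] := T3 p a c ltac:(by dsplit).
have [Ipdb [t2 [F2 C2 Y2]]] := T3 p d b ltac:(by dsplit).
have [Ipad [s3 [E3 D3 X3]]] := T3 p a d ltac:(by dsplit).
have [Ipbc [t3 [F3 C3 Y3]]] := T3 p b c ltac:(by dsplit).
have [_ sy] := ev_sym x; rewrite (sy p d b) X1 Y1 X2 Y2 X3 Y3 -!weight_mnm2.
pose m1 := mnm2 Ipab Ipcd; pose m2 := mnm2 Ipac Ipdb; pose m3 := mnm2 Ipad Ipbc.
rewrite -/m1 -/m2 -/m3.
have ne (I J : ksub 3 n) z : z \in val I -> z \notin val J -> I != J.
  by move=> zI; apply: contraNneq => <-.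
have m12 : m1 != m2.
  by apply: mnm2_neq; [apply: (ne _ _ b) | apply: (ne _ _ a)]; rewrite ?E1 ?E2 ?F2 !inE ?eqxx ?orbT //; dsplit.
have m13 : m1 != m3.
  by apply: mnm2_neq; [apply: (ne _ _ b) | apply: (ne _ _ a)]; rewrite ?E1 ?E3 ?F3 !inE ?eqxx ?orbT //; dsplit.
have m23 : m2 != m3.
  by apply: mnm2_neq; [apply: (ne _ _ c) | apply: (ne _ _ a)]; rewrite ?E2 ?E3 ?F3 !inE ?eqxx ?orbT //; dsplit.
(* The signs account for triples that are not in increasing order. *)
pose f : plucker_poly R 3 n := ((-1) ^+ s1 * (-1) ^+ t1) *: mpolyX R m1
  + ((-1) ^+ s2 * (-1) ^+ t2) *: mpolyX R m2 + ((-1) ^+ s3 * (-1) ^+ t3) *: mpolyX R m3.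
have hf : plucker_ideal f.
  rewrite /plucker_ideal /= /f !linearD !linearZ /= !comp_mnm2.
  rewrite -[RHS](det3c_plucker (generic_mx R 3 n) p a b c d) D1 C1 D2 C2 D3 C3.
  have S (s t : bool) (u v : mpoly (3 * n) R) :
     ((-1) ^+ s * (-1) ^+ t : R) *: (u * v) = ((-1) ^+ s * u) * ((-1) ^+ t * v).
    by case: s; case: t; rewrite ?(expr0, expr1, mulNr, mulrN, mul1r, mulr1, opprK, scaleNr, scale1r).
  by rewrite !S.
have cf m : mcoeff m f = (-1) ^+ s1 * (-1) ^+ t1 * (m1 == m)%:R
  + (-1) ^+ s2 * (-1) ^+ t2 * (m2 == m)%:R + (-1) ^+ s3 * (-1) ^+ t3 * (m3 == m)%:R.
  by rewrite /f !mcoeffD !mcoeffZ !mcoeffX.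
have T1 : term_at chi f m1 = Num.sg (det3c g p a b * det3c g p c d).
  apply: (term_three (D1 _ g) (C1 _ g) _).
  by rewrite cf eqxx (eq_sym m2) (eq_sym m3) (negbTE m12) (negbTE m13) /=; ring.
have T2 : term_at chi f m2 = Num.sg (det3c g p a c * det3c g p d b).
  apply: (term_three (D2 _ g) (C2 _ g) _).
  by rewrite cf eqxx (eq_sym m3) (negbTE m12) (negbTE m23) /=; ring.
have T3' : term_at chi f m3 = Num.sg (det3c g p a d * det3c g p b c).
  apply: (term_three (D3 _ g) (C3 _ g) _).
  by rewrite cf eqxx (negbTE m13) (negbTE m23) /=; ring.
have supp m : term_at chi f m != 0 -> [\/ m = m1, m = m2 | m = m3].
  move=> n0; have [->|n1] := eqVneq m m1; first by constructor 1.
  have [->|n2] := eqVneq m m2; first by constructor 2.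
  have [->|n3] := eqVneq m m3; first by constructor 3.
  move: n0; rewrite /term_at cf !(eq_sym _ m) (negbTE n1) (negbTE n2) (negbTE n3).
  by rewrite !mulr0 !addr0 mul0r eqxx.
have [h1 h2] := (chi_hypersurfaceP chi f x).1 (hx f hf).
have G0 i j k : uniq [:: i; j; k] -> det3c g i j k != 0 by exact: det3c_neq0.
have N1 := mulf_neq0 (G0 p a b ltac:(by dsplit)) (G0 p c d ltac:(by dsplit)).
have N2 := mulf_neq0 (G0 p a c ltac:(by dsplit)) (G0 p d b ltac:(by dsplit)).
have N3 := mulf_neq0 (G0 p a d ltac:(by dsplit)) (G0 p b c ltac:(by dsplit)).
have rel := det3c_plucker g p a b c d.
have same : (det3c g p a c * det3c g p d b < 0) = (det3c g p a d * det3c g p b c < 0).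
  by move: sp; rewrite /special /sgn => /eqP sp; rewrite -!mul_lt0_xor ?G0 //; dsplit.
move: T1 T2 T3' N1 N2 N3 rel same.
move: (_ * _) (_ * _) (_ * _) => A B C T1 T2 T3' N1 N2 N3 rel same.
have sub m (P : Prop) : term_at chi f m != 0 -> (m = m1 -> P) -> (m = m2 -> P) -> (m = m3 -> P) -> P.
  by move=> /supp[] e k1 k2 k3; [exact: k1 | exact: k2 | exact: k3].
(* The common sign of the last two products may be either one; [sgn] treats both cases at once. *)
have K (sgn : bool) : (C < 0) = ~~ sgn -> (B < 0) = sgn -> ismin (weight m1 x) (weight m2 x) (weight m3 x).
  move=> eC eB; have eA : (A < 0) = sgn by rewrite -same.
  have [hC hB hA] : [/\ Num.sg C = (-1) ^+ (~~ sgn), Num.sg B = (-1) ^+ sgn & Num.sg A = (-1) ^+ sgn].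
    by rewrite !sgr_def N1 N2 N3 eC eB eA.
  rewrite hC in T1; rewrite hB in T2; rewrite hA in T3'.
  have opp m (y : bool) : term_at chi f m = (-1) ^+ y -> exists2 m', term_at chi f m' = (-1) ^+ (~~ y) & weight m' x <= weight m x.
    move=> em; have [m' nm' le] : exists2 m', (term_at chi f m' < 0) = ~~ y /\ term_at chi f m' != 0 & weight m' x <= weight m x.
      case: y em => em.
        by have [|m' lt le] := h2 m; [rewrite em expr1 ltrN10 | exists m' => //; rewrite gt_eqF // lt_gtF].
      by have [|m' lt le] := h1 m; [rewrite em expr0 ltr01 | exists m' => //; rewrite lt_eqF].
    exists m' => //; case: nm' => lt n0; move: lt.
    by apply: (sub m' _ n0) => ->; rewrite ?T1 ?T2 ?T3' signr_lt0 => ->.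
  have nb := @signr_negb R sgn.
  have [u1 U1 V1] := opp _ _ T1; have [u2 U2 V2] := opp _ _ T2; have [u3 U3 V3] := opp _ _ T3'.
  rewrite negbK in U1.
  have le2 : weight m1 x <= weight m2 x.
    move: V2; apply: (sub u2) => [|->//|e|e]; first by rewrite U2 signr_eq0.
      by case: nb; rewrite -U2 e T2.
    by case: nb; rewrite -U2 e T3'.
  have le3 : weight m1 x <= weight m3 x.
    move: V3; apply: (sub u3) => [|->//|e|e]; first by rewrite U3 signr_eq0.
      by case: nb; rewrite -U3 e T2.
    by case: nb; rewrite -U3 e T3'.
  move: V1 le2 le3; apply: (sub u1) => [|e|->|->]; first by rewrite U1 signr_eq0.
  - by case: nb; rewrite -U1 e T1.
  - by move=> V1; exact: ismin_le.
  - by move=> V1 l2 l3; rewrite isminC; exact: ismin_le.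
have [lB|lB] := ltP B 0; [apply: (K true) | apply: (K false)] => //.
- by apply/negbTE; rewrite -leNgt; apply: (sum3_neg rel lB); rewrite -same.
- by apply: (sum3_pos rel N2 lB); rewrite leNgt -same -leNgt.
- by rewrite ltNge lB.
Qed.

(** All nonnegative multiples of [x] are realised with one error bound, so [term_cancelled] applies;
    negative terms of [f] are positive terms of [- f]. *)
Lemma TD_Grassmannian x : (n <= 8)%N -> TD (sgn g) [set: 'I_n]%SET (ev x) ->
  chirotropical_Grassmannian (R := R) chi x.
Proof.
move=> n8 xTD; have := @realisable_le8 R _ _ (sgn_chirotope g0) [set: 'I_n]%SET.
rewrite cardsT card_ord => /(_ n8)[L L0 real].
have unit I : chi I * chi I = 1.
  have [m0 ->] := g_chi I.
  by case: sgzP m0 => // ->; rewrite eqxx.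
have scaled (l : R) : 0 <= l -> exists M : 'M[R]_(3, n), forall I, ap L ((chi I)%:~R * minor M I) (l * x I).
  move=> l0; have [|G hG] := real (fun a b c => l * ev x a b c).
    have [s H] := xTD; split; first exact: sym3Z.
    by move=> p a b c d h sp; rewrite -!mulrDr; apply: isminZ => //; exact: H.
  pose M : 'M[R]_(3, n) := \matrix_(i, j) if i == 0 then (G j).1.1 else if i == 1 then (G j).1.2 else (G j).2.
  exists M => I; have hI : distinct [set: 'I_n]%SET [:: (nth3 I).1.1; (nth3 I).1.2; (nth3 I).2].
    by rewrite /distinct nth3_uniq /= !finset.in_setT.
  have := hG _ _ _ hI; rewrite ev_nth3; congr ap.
  have [m0 ->] := g_chi I; rewrite -sgrEz (minor_det3 M).
  have -> : det3c M (nth3 I).1.1 (nth3 I).1.2 (nth3 I).2 = det3 (G (nth3 I).1.1) (G (nth3 I).1.2) (G (nth3 I).2).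
    have e2 : inord 2 = 2 :> 'I_3 by apply: val_inj; rewrite /= inordK.
    by rewrite /det3c !mxE /= -!(inj_eq val_inj) /= inordK.
  rewrite /sdet /sgn -minor_det3; case: (ltgtP (minor g I) 0) m0 => // lt _.
    by rewrite ltr0_sg // mulN1r.
  by rewrite gtr0_sg // mul1r.
move=> f hf; apply/chi_hypersurfaceP; split=> m.
  exact: (@term_cancelled R 3 n chi unit L f x m hf scaled).
have tN m' : term_at chi (- f) m' = - term_at chi f m' by rewrite /term_at mcoeffN mulNr.
have hN : plucker_ideal (- f) by rewrite /plucker_ideal /= comp_mpolyN hf oppr0.
move=> neg; have [|m' h le] := @term_cancelled R 3 n chi unit L (- f) x m hN scaled.
  by rewrite tN oppr_gt0.
by exists m' => //; rewrite tN oppr_lt0 in h.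
Qed.

End ThreeTerm.

(** * The theorem *)

Section ThreeTermPrevariety.
Variables (R : realType) (n : nat) (sg : 'I_n -> 'I_n -> 'I_n -> bool).
Implicit Types (x w v : weight_space R 3 n).

Definition pair_sum (p a b c d : 'I_n) x : R := ev x p a b + ev x p c d.

Lemma pair_sum_scalar p a b c d : scalar (pair_sum p a b c d).
Proof. by move=> t x y; rewrite /pair_sum evP; ring. Qed.

HB.instance Definition _ p a b c d :=
  GRing.isLinear.Build R (weight_space R 3 n) R *%R (pair_sum p a b c d) (pair_sum_scalar p a b c d).

Definition special_tuple (q : 'I_n * 'I_n * 'I_n * 'I_n * 'I_n) :=
  let: (p, a, b, c, d) := q in uniq [:: p; a; b; c; d] && special sg p a b c d.

Definition relations : finType := {q | special_tuple q}.

Definition rel1 (r : relations) : {scalar weight_space R 3 n} :=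
  let: (p, a, b, c, d) := val r in pair_sum p a b c d.
Definition rel2 (r : relations) : {scalar weight_space R 3 n} :=
  let: (p, a, b, c, d) := val r in pair_sum p a c b d.
Definition rel3 (r : relations) : {scalar weight_space R 3 n} :=
  let: (p, a, b, c, d) := val r in pair_sum p a d b c.

Local Notation U := [set: 'I_n]%SET.

Lemma relationsP (P : R -> R -> R -> R -> R -> R -> Prop) x w :
  (forall r : relations, P (rel1 r x) (rel2 r x) (rel3 r x) (rel1 r w) (rel2 r w) (rel3 r w)) <->
  (forall p a b c d, distinct U [:: p; a; b; c; d] -> special sg p a b c d ->
     P (ev x p a b + ev x p c d) (ev x p a c + ev x p b d) (ev x p a d + ev x p b c)
       (ev w p a b + ev w p c d) (ev w p a c + ev w p b d) (ev w p a d + ev w p b c)).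
Proof.
split=> H.
  move=> p a b c d /andP[u _] sp; have q : special_tuple (p, a, b, c, d) by apply/andP.
  exact: (H (Sub (p, a, b, c, d) q)).
case=> -[[[[p a] b] c] d] /= q; have /andP[u sp] := q; apply: H => //.
by apply/andP; split=> //; rewrite /= !finset.in_setT.
Qed.

Lemma prevarietyE x : prevariety rel1 rel2 rel3 x <-> TD sg U (ev x).
Proof.
have := @relationsP (fun u1 u2 u3 _ _ _ => ismin u1 u2 u3) x x.
move=> [h1 h2]; split=> [h|[_ h]]; last exact: h2.
by split; [exact: ev_sym | exact: h1].
Qed.

Lemma starE x w : star rel1 rel2 rel3 x w <-> St sg U (ev x) (ev w).
Proof.
have := @relationsP (fun _ u2 u3 y1 y2 y3 => smin u2 u3 y1 y2 y3) x w.
move=> [h1 h2]; split=> [h|[_ h]]; last exact: h2.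
by split; [exact: ev_sym | exact: h1].
Qed.

Lemma linE x w : lin rel1 rel2 rel3 x w <-> Lin sg U (ev x) (ev w).
Proof.
have := @relationsP (fun _ u2 u3 y1 y2 y3 => slin u2 u3 y1 y2 y3) x w.
move=> [h1 h2]; split=> [h|[_ h]]; last exact: h2.
by split; [exact: ev_sym | exact: h1].
Qed.

Hypothesis chi : chirotope sg.
Hypothesis n8 : (n <= 8)%N.

Lemma prevariety_no_one_sided h v : prevariety rel1 rel2 rel3 h -> star rel1 rel2 rel3 h v ->
  ~ lin rel1 rel2 rel3 h v ->
  exists2 w, star rel1 rel2 rel3 h w & forall c, 0 <= c -> ~ lin rel1 rel2 rel3 h (w - c *: v).
Proof.
move=> /prevarietyE hT /starE hv nv; apply: contrapT => N.
have card8 : (#|U| <= 8)%N by rewrite cardsT card_ord.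
apply: (no_one_sided chi (x := ev h) (v := ev v) card8); split=> //.
  by move/linE.
move=> w wSt; have [ws _] := wSt; have [u hu] := ev_onto ws.
have uw : agree U w (ev u) by move=> a b c /andP[d _]; rewrite (hu a b c d).
have : star rel1 rel2 rel3 h u by apply/starE; apply: St_agree wSt => //; exact: ev_sym.
move=> us; apply: contrapT => M; apply: N; exists u => // c c0 /linE l; apply: M; exists c => //.
apply: Lin_agree l; first by apply: sym3_tadd => //; exact: ev_sym.
move=> a b d /andP[hd _].
by rewrite -scaleNr [u + _]addrC evP /tadd (hu a b d hd) addrC.
Qed.

End ThreeTermPrevariety.

Local Close Scope ring_scope.
Local Close Scope classical_set_scope.

Theorem theorem5p5 (R : realType) (n : nat) (hn : n = 6 \/ n = 7 \/ n = 8)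
    (chi : {ffun ksub 3 n -> int})
    (hchi : uniform_realizable_chirotope R chi) :
  exists F : set (set (weight_space R 3 n)),
    coarsest_fan_structure (chirotropical_Grassmannian chi) F /\
    two_determined F.
Proof.
have n8 : (n <= 8)%N by case: hn => [->|[]->].
have [g hg] := hchi; have g0 I : minor g I != 0%R by case: (hg I).
have chiG := sgn_chirotope g0.
have -> : chirotropical_Grassmannian chi = prevariety (@rel1 R n (sgn g)) (@rel2 R n (sgn g)) (@rel3 R n (sgn g)).
  apply/seteqP; split=> x.
    by move=> /(Grassmannian_TD hg) /prevarietyE.
  by move=> /prevarietyE; exact: TD_Grassmannian.
exists (cells (@rel1 R n (sgn g)) (@rel2 R n (sgn g)) (@rel3 R n (sgn g))); split.
  by apply: cells_coarsest; exact: weight_space_polyhedral.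
by apply: cells_two_determined => h v; exact: prevariety_no_one_sided.
Qed.
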